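(* Let $u,v:\mathrm{SPD}(n)\to\mathrm{SPD}(n)$ be two univariate diffeomorphisms and let $w=v\circ u^{-1}$, which is a univariate diffeomorphism, so that $u:(\mathrm{SPD}(n),g^{\mathrm{ME}(u,v)})\to(\mathrm{SPD}(n),\frac{w'(1)}{u'(1)v'(1)}g^{\mathrm{ME}(\mathrm{Id},w)})$ is an isometry. For $\Sigma=PDP^\top\in\mathrm{SPD}(n)$ with $P\in\mathrm{O}(n)$ and $D=\mathrm{Diag}(d_1,\dots,d_n)$, write $X=PX'P^\top\in T_\Sigma\mathrm{SPD}(n)$ and analogously $Y,Z,T\in T_\Sigma\mathrm{SPD}(n)$; write $u_{ij}=u^{[1]}(d_i,d_j)$, $u_{ijk}=u^{[2]}(d_i,d_j,d_k)$, and analogously for $v$; and write $m_{ij}=w^{[1]}(u(d_i),u(d_j))=\frac{v_{ij}}{u_{ij}}$ and $m_{ijk}=w^{[2]}(u(d_i),u(d_j),u(d_k))$. Then the curvature of the mixed-Euclidean metric $g^{\mathrm{ME}(u,v)}$ is $$R^{\mathrm{ME}(u,v)}_\Sigma(X,Y,Z,T)=\frac{1}{u'(1)v'(1)}\sum_{i,j,k,l}\rho_{ijkl}\left(X'_{ij}Y'_{jk}Z'_{kl}T'_{li}-Y'_{ij}X'_{jk}Z'_{kl}T'_{li}+X'_{ij}Z'_{jk}Y'_{kl}T'_{li}-Y'_{ij}Z'_{jk}X'_{kl}T'_{li}\right),$$ where $$\rho_{ijkl}=\frac{m_{ijl}m_{jlk}}{2m_{jl}}u_{ij}u_{jk}u_{kl}u_{li}=\frac{1}{2u_{jl}v_{jl}}(u_{ij}v_{ijl}-v_{ij}u_{ijl})(u_{jk}v_{jkl}-v_{jk}u_{jkl})$$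 is symmetric in $i\leftrightarrow k$, in $j\leftrightarrow l$ and in $u\leftrightarrow v$. In particular, at $\Sigma=I_n$, $$R^{\mathrm{ME}(u,v)}_{I_n}(X,Y,Z,T)=\frac14\left[\left(\ln\left|\frac{v'}{u'}\right|\right)'(1)\right]^2R^{\mathrm{A}}_{I_n}(X,Y,Z,T),$$ where $R^{\mathrm{A}}$ is the curvature tensor of the affine-invariant metric. Therefore the sectional curvature of $g^{\mathrm{ME}(u,v)}$ at $I_n$ takes non-positive values. In particular, for mixed-power-Euclidean metrics $\mathrm{MPE}(\alpha,\beta)$ with $\alpha,\beta\in\mathbb{R}$, $\alpha^2\neq\beta^2$ (and $n\geq2$): one has $\kappa^{\mathrm{MPE}(\alpha,\beta)}_{\lambda\Sigma}(X,Y)=\lambda^{-(\alpha+\beta)}\kappa^{\mathrm{MPE}(\alpha,\beta)}_\Sigma(X,Y)$ for all $\lambda>0$, all $\Sigma\in\mathrm{SPD}(n)$ and all linearly independent $X,Y\in\mathrm{Sym}(n)$, and the lower bound (infimum over all points and all tangent planes) of the sectional curvature is $-\infty$.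
   Context: $\mathrm{Sym}(n)$: real symmetric $n\times n$ matrices; $\mathrm{SPD}(n)$: the manifold of symmetric positive definite matrices, $T_\Sigma\mathrm{SPD}(n)\simeq\mathrm{Sym}(n)$; $\mathrm{O}(n)$: orthogonal group. A univariate map $f:\mathrm{SPD}(n)\to\mathrm{Sym}(n)$ is one induced by a function, also denoted $f:(0,\infty)\to\mathbb{R}$, through $f(PDP^\top)=P\,\mathrm{Diag}(f(d_1),\dots,f(d_n))P^\top$ ($P\in\mathrm{O}(n)$, $D=\mathrm{Diag}(d_1,\dots,d_n)$, $d_i>0$); univariate maps are assumed smooth. $\mathrm{Id}$ is the identity map. First divided difference: $f^{[1]}(x,y)=\frac{f(x)-f(y)}{x-y}$ if $x\neq y$ and $f^{[1]}(x,x)=f'(x)$. Second divided difference: the continuous symmetric function $f^{[2]}$ of three variables with $f^{[2]}(x,y,z)=\frac{f^{[1]}(x,z)-f^{[1]}(x,y)}{z-y}$ if $y\neq z$ (and the formulas obtained by permuting the variables when another pair is distinct), and $f^{[2]}(x,x,x)=\frac12f''(x)$. Mixed-Euclidean metric: $g^{\mathrm{ME}(u,v)}_\Sigma(X,X)=\frac{1}{u'(1)v'(1)}\sum_{i,j}u^{[1]}(d_i,d_j)v^{[1]}(d_i,d_j)(X'_{ij})^2$ where $\Sigma=PDP^\top$, $X=PX'P^\top$, $P\in\mathrm{O}(n)$, $D=\mathrm{Diag}(d_1,\dots,d_n)$. Mixed-power-Euclidean metric: $g^{\mathrm{MPE}(\alpha,\beta)}=g^{\mathrm{ME}(F_\alpha,F_\beta)}$,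 where $F_\alpha(\Sigma)=\Sigma^\alpha$ if $\alpha\neq0$ and $F_0=\log$ (symmetric matrix logarithm; the same formula for the metric is used). Affine-invariant metric: $g^{\mathrm{A}}_\Sigma(X,X)=\mathrm{tr}((\Sigma^{-1}X)^2)$. Curvature conventions, for a metric $g$ with Levi-Civita connection $\nabla$: $R(X,Y)Z=\nabla_X\nabla_YZ-\nabla_Y\nabla_XZ-\nabla_{[X,Y]}Z$, $R(X,Y,Z,T)=-g(R(X,Y)Z,T)$, and sectional curvature $\kappa(X,Y)=\frac{R(X,Y,X,Y)}{g(X,X)g(Y,Y)-g(X,Y)^2}$. *)

(* Defs.v *)
From HB Require Import structures.
From mathcomp Require Export all_boot all_order all_algebra.
From mathcomp Require Export all_classical all_reals all_analysis.

Set Implicit Arguments.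
Unset Strict Implicit.
Unset Printing Implicit Defensive.

Import Order.TTheory GRing.Theory Num.Theory.
Import numFieldNormedType.Exports.

Local Open Scope ring_scope.
Local Open Scope classical_set_scope.

Definition orthogonalmx (R : realType) (n : nat) (P : 'M[R]_n) : Prop :=
  P *m P^T = 1%:M.

Definition Sym (R : realType) (n : nat) : set 'M[R]_n := [set X | X^T = X].

Definition SPD (R : realType) (n : nat) : set 'M[R]_n :=
  [set S | Sym S /\
           forall x : 'cV[R]_n, x != 0 -> 0 < (x^T *m S *m x) ord0 ord0].

(* Calculus on SPD(n), an open subset of the vector space Sym(n), so that it
   has a global chart and every tangent space is Sym(n).  A map defined on
   SPD(n) is represented by a map on all matrices whose values outside SPD(n)
   are irrelevant: only directional derivatives along symmetric directions at
   points of SPD(n), and continuity within SPD(n), are ever used. *)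
Fixpoint Ck (R : realType) (n : nat) (V : normedModType R) (k : nat)
    (F : 'M[R]_n -> V) : Prop :=
  {within @SPD R n, continuous F} /\
  (if k is k'.+1 then
     forall X, Sym X -> (forall S, SPD S -> derivable F S X) /\
                        Ck k' (fun S => 'D_X F S)
   else True).

Definition smooth (R : realType) (n : nat) (V : normedModType R)
  (F : 'M[R]_n -> V) : Prop := forall k, Ck k F.

Definition diffeo (R : realType) (n : nat) (F : 'M[R]_n -> 'M[R]_n) : Prop :=
  smooth F /\
  exists G : 'M[R]_n -> 'M[R]_n,
    [/\ smooth G,
        forall S, SPD S -> SPD (F S) /\ G (F S) = S
      & forall S, SPD S -> SPD (G S) /\ F (G S) = S].

Definition vector_field (R : realType) (n : nat) (X : 'M[R]_n -> 'M[R]_n) :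
    Prop :=
  smooth X /\ forall S, SPD S -> Sym (X S).

(* The sign is the one for which [X, Y] f = X (Y f) - Y (X f). *)
Definition lie_bracket (R : realType) (n : nat) (X Y : 'M[R]_n -> 'M[R]_n) :
    'M[R]_n -> 'M[R]_n :=
  fun S => 'D_(X S) Y S - 'D_(Y S) X S.

Record is_affine_connection (R : realType) (n : nat)
    (nabla : ('M[R]_n -> 'M[R]_n) -> ('M[R]_n -> 'M[R]_n) ->
             'M[R]_n -> 'M[R]_n) : Prop := {
  nabla_vector_field : forall X Y, vector_field X -> vector_field Y ->
    vector_field (nabla X Y);
  nabla_linear : forall (f : 'M[R]_n -> R) X X' Y,
    smooth f -> vector_field X -> vector_field X' -> vector_field Y ->
    forall S, SPD S ->
      nabla (fun T => f T *: X T + X' T) Y S =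
      f S *: nabla X Y S + nabla X' Y S;
  nabla_add : forall X Y Y',
    vector_field X -> vector_field Y -> vector_field Y' ->
    forall S, SPD S ->
      nabla X (fun T => Y T + Y' T) S = nabla X Y S + nabla X Y' S;
  nabla_Leibniz : forall (f : 'M[R]_n -> R) X Y,
    smooth f -> vector_field X -> vector_field Y ->
    forall S, SPD S ->
      nabla X (fun T => f T *: Y T) S =
      f S *: nabla X Y S + 'D_(X S) f S *: Y S }.

Record is_levi_civita (R : realType) (n : nat)
    (g : 'M[R]_n -> 'M[R]_n -> 'M[R]_n -> R)
    (nabla : ('M[R]_n -> 'M[R]_n) -> ('M[R]_n -> 'M[R]_n) ->
             'M[R]_n -> 'M[R]_n) : Prop := {
  levi_civita_connection : is_affine_connection nabla;
  levi_civita_torsion_free : forall X Y, vector_field X -> vector_field Y ->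
    forall S, SPD S -> nabla X Y S - nabla Y X S = lie_bracket X Y S;
  levi_civita_metric : forall X Y Z,
    vector_field X -> vector_field Y -> vector_field Z ->
    forall S, SPD S ->
      'D_(X S) (fun T => g T (Y T) (Z T)) S =
      g S (nabla X Y S) (Z S) + g S (Y S) (nabla X Z S) }.

Definition curvature (R : realType) (n : nat)
    (g : 'M[R]_n -> 'M[R]_n -> 'M[R]_n -> R)
    (nabla : ('M[R]_n -> 'M[R]_n) -> ('M[R]_n -> 'M[R]_n) ->
             'M[R]_n -> 'M[R]_n)
    (X Y Z T : 'M[R]_n -> 'M[R]_n) (S : 'M[R]_n) : R :=
  - g S (nabla X (nabla Y Z) S - nabla Y (nabla X Z) S
         - nabla (lie_bracket X Y) Z S) (T S).

(* The curvature being a tensor, tangent vectors at S may be extended to any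
   vector fields, here to constant ones. *)
Definition sectional (R : realType) (n : nat)
    (g : 'M[R]_n -> 'M[R]_n -> 'M[R]_n -> R)
    (nabla : ('M[R]_n -> 'M[R]_n) -> ('M[R]_n -> 'M[R]_n) ->
             'M[R]_n -> 'M[R]_n)
    (S X Y : 'M[R]_n) : R :=
  curvature g nabla (fun=> X) (fun=> Y) (fun=> X) (fun=> Y) S /
  (g S X X * g S Y Y - g S X Y ^+ 2).

Definition isometry (R : realType) (n : nat) (F : 'M[R]_n -> 'M[R]_n)
    (g g' : 'M[R]_n -> 'M[R]_n -> 'M[R]_n -> R) : Prop :=
  diffeo F /\
  forall S X Y, SPD S -> Sym X -> Sym Y ->
    g' (F S) ('D_X F S) ('D_Y F S) = g S X Y.

Definition is_spectral_dec (R : realType) (n : nat) (S P : 'M[R]_n)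
    (d : 'rV[R]_n) : Prop :=
  [/\ orthogonalmx P, forall i, 0 < d ord0 i & S = P *m diag_mx d *m P^T].

(* Some spectral decomposition of S; neither umap nor ME_metric below depends
   on the choice made. *)
Definition spectral_dec (R : realType) (n : nat) (S : 'M[R]_n) :
    'M[R]_n * 'rV[R]_n :=
  xget (1%:M, 0) [set Pd | is_spectral_dec S Pd.1 Pd.2].

(* The univariate map on SPD(n) induced by f : (0, +oo) -> R. *)
Definition umap (R : realType) (n : nat) (f : R -> R) (S : 'M[R]_n) :
    'M[R]_n :=
  let: (P, d) := spectral_dec S in P *m diag_mx (map_mx f d) *m P^T.

Definition dd1 (R : realType) (f : R -> R) (x y : R) : R :=
  if x == y then derive1 f x else (f x - f y) / (x - y).

(* When y = z and x differs from them, the recurrence is applied to the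
   permuted triple (y, x, z). *)
Definition dd2 (R : realType) (f : R -> R) (x y z : R) : R :=
  if y != z then (dd1 f x z - dd1 f x y) / (z - y)
  else if x != z then (dd1 f y z - dd1 f y x) / (z - x)
  else derive1n 2 f x / 2.

(* The bilinear form polarizing the quadratic form of the mixed-Euclidean
   metric. *)
Definition ME_metric (R : realType) (n : nat) (u v : R -> R)
    (S X Y : 'M[R]_n) : R :=
  let: (P, d) := spectral_dec S in
  (derive1 u 1 * derive1 v 1)^-1 *
  \sum_(i < n) \sum_(j < n)
     dd1 u (d ord0 i) (d ord0 j) * dd1 v (d ord0 i) (d ord0 j)
     * (P^T *m X *m P) i j * (P^T *m Y *m P) i j.

Definition power_fun (R : realType) (a : R) (x : R) : R :=
  if a == 0 then ln x else x `^ a.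

Definition MPE_metric (R : realType) (n : nat) (a b : R) :
    'M[R]_n -> 'M[R]_n -> 'M[R]_n -> R :=
  ME_metric (power_fun a) (power_fun b).

Definition affine_metric (R : realType) (n : nat) (S X Y : 'M[R]_n) : R :=
  \tr (invmx S *m X *m (invmx S *m Y)).

(* w = v o u^-1 on (0, +oo). *)
Definition wfun (R : realType) (u v : R -> R) : R -> R :=
  v \o 'pinv_(fun=> 1) [set x : R | 0 < x] u.

(* The coefficient rho_ijkl in the eigenvalues d, in terms of
   m_ij = w^[1](u(d_i), u(d_j)) and m_ijk = w^[2](u(d_i), u(d_j), u(d_k)). *)
Definition rho (R : realType) (n : nat) (u v : R -> R) (d : 'rV[R]_n)
    (i j k l : 'I_n) : R :=
  let u1 a b := dd1 u (d ord0 a) (d ord0 b) in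
  let m1 a b := dd1 (wfun u v) (u (d ord0 a)) (u (d ord0 b)) in
  let m2 a b c :=
    dd2 (wfun u v) (u (d ord0 a)) (u (d ord0 b)) (u (d ord0 c)) in
  m2 i j l * m2 j l k / (2 * m1 j l) * u1 i j * u1 j k * u1 k l * u1 l i.

(* Main.v *)
Require Import Defs.
From mathcomp Require Import ring lra.

Import Order.TTheory GRing.Theory Num.Theory.
Import numFieldNormedType.Exports.

(** Write U and V for the maps of SPD(n) induced by u and v, D for their
    differentials, f[x,y] and f[x,y,z] for divided differences, and
    c = 1/(u'(1)v'(1)).  In an eigenbasis of S, the differential DU multiplies
    the (i,j) entry by u[d_i,d_j], so that the metric is
    g_S(X,Y) = c tr(DU(X) DV(Y)): it pairs the two flat structures that U and V
    pull back from Sym(n).  Koszul's formula then shows that the Levi-Civita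
    connection is the mean of the two flat connections, and if 2K denotes the
    difference of these, all that is left of the curvature is
    g(R(X,Y)Z,T) = g(K_X Z, K_Y T) - g(K_Y Z, K_X T).  In the eigenbasis, K is a
    contraction against u[x,y] v[x,y,z] - v[x,y] u[x,y,z], which is the second
    divided difference of w = v o u^-1 up to first ones of u; expanding the
    products gives the coefficients rho (koszul, half_curvature,
    ME_curvature_entries, dd2_quotient).

    The analysis behind this rests on multiple operator sums
    sum f[a_i,b_j,..] p_i X q_j .., where p_i, q_j are spectral projectors of
    possibly different matrices.  Replacing one matrix A by another one B
    inserts A - B as a new argument and raises the order of the divided
    difference by one (multop_change), because p_i (A - B) q_j is
    (a_i - b_j) p_i q_j.  This identity gives the independence of the eigenbases,
    the continuity and all the derivatives of univariate maps, although
    eigenbases do not depend continuously on the matrix; it only requires that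
    the derivatives of divided differences be bounded by those of f, on compact
    intervals, as a mean value theorem shows (derive_dd1_mean).

    A connection is known only through its axioms, on smooth fields.
    Expanding fields over constant ones with smooth coefficients reduces the
    curvature to constant fields (curvature_tensorial), for which the bracket
    vanishes.

    A diffeomorphism induced by f restricts to scalar matrices, so that f is a
    smooth bijection of the half-line with a smooth inverse and f' does not
    vanish (diffeo_smooth_inverse).  At the identity all the coefficients rho
    coincide and the curvature is a square times tr([X,Y][Z,T])/16; on X, Y, X, Y
    the trace is minus the squared norm of [X,Y].  The affine-invariant metric is
    the case u(x) = x, v(x) = 1/x.  For powers, divided differences are
    homogeneous, hence so is the sectional curvature, which is negative for
    some plane at the identity: moving that plane along the multiples of the
    identity makes the curvature arbitrarily low. *)

Set Implicit Arguments.
Unset Strict Implicit.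
Unset Printing Implicit Defensive.

Local Open Scope ring_scope.
Local Open Scope classical_set_scope.

(** * Smooth functions of the half-line and divided differences *)

(** Difference quotients are only controlled along lines that remain in
    SPD(n), which is not a neighbourhood of its points in the space of all
    matrices; this form isolates such a line. *)
Lemma is_derive_epsP (R : realType) (V W : normedModType R) (F : V -> W)
    (a v : V) (l : W) :
  is_derive a v F l <->
  forall e : R, 0 < e -> exists2 d : R, 0 < d & forall h : R, h != 0 -> `|h| < d ->
    `|h^-1 *: (F (h *: v + a) - F a) - l| <= e.
Proof.
split=> [[dF <-] e e0|H].
  have /cvgrPdist_le/(_ e e0) := dF.
  rewrite near_withinE => /nbhs_ballP[d /= d0 H]; exists d => // h h0 hd.
  by rewrite distrC; apply: H => //; rewrite /ball/= sub0r normrN.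
have H' : (fun h : R => h^-1 *: ((F \o shift a) (h *: v) - F a)) @ 0^' --> l.
  apply/cvgrPdist_le => e /H[d d0 Hd].
  rewrite near_withinE; apply/nbhs_ballP; exists d => //= h.
  by rewrite /ball/= sub0r normrN => hd h0; rewrite distrC; exact: Hd.
by apply: DeriveDef; [apply/cvg_ex; exists l|apply/cvg_lim].
Qed.

Section Scalar.
Variable R : realType.
Implicit Types (f g : R -> R) (x y : R).

(** The rules of derivation for functions written pointwise, with the value
    of the derivative left to a separate equation. *)
Lemma derD (V : normedModType R) (F G : V -> R) a v dF dG d :
  is_derive a v F dF -> is_derive a v G dG -> d = dF + dG ->
  is_derive a v (fun z => F z + G z) d.
Proof. by move=> hF hG ->; exact: is_deriveD. Qed.

Lemma derB (V : normedModType R) (F G : V -> R) a v dF dG :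
  is_derive a v F dF -> is_derive a v G dG ->
  is_derive a v (fun z => F z - G z) (dF - dG).
Proof. by move=> hF hG; exact: is_deriveB. Qed.

Lemma derM (V : normedModType R) (F G : V -> R) a v dF dG d :
  is_derive a v F dF -> is_derive a v G dG -> d = F a * dG + G a * dF ->
  is_derive a v (fun z => F z * G z) d.
Proof. by move=> hF hG ->; exact: is_deriveM. Qed.

Lemma derX (V : normedModType R) (F : V -> R) k a v dF d :
  is_derive a v F dF -> d = k.+1%:R * F a ^+ k * dF ->
  is_derive a v (fun z => F z ^+ k.+1) d.
Proof.
move=> hF ->; elim: k => [|k IH]; first by rewrite expr0 mulr1 mul1r.
under eq_fun do rewrite exprS.
apply: derM hF IH _; rewrite [in RHS]exprS -[in LHS]natr1 exprS.
by ring.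
Qed.

Lemma derV (F : R -> R) (a v dF d : R) :
  F a != 0 -> is_derive a v F dF -> d = - dF / F a ^+ 2 ->
  is_derive a v (fun z => (F z)^-1) d.
Proof.
move=> F0 hF ->; have := is_deriveV F0 hF.
by rewrite /GRing.scale/= mulrC mulrN mulNr.
Qed.

Lemma near_pos x (P : R -> Prop) : 0 < x -> (forall z, 0 < z -> P z) ->
  \near x, P x.
Proof.
move=> x0 H; near=> z; apply: H; near: z; exact: lt_nbhsr.
Unshelve. all: end_near. Qed.

Definition smooth_pos f :=
  forall k x, 0 < x -> derivable (derive1n k f) x 1.

Lemma smooth_pos_is_derive f k x : smooth_pos f -> 0 < x ->
  is_derive x 1 (derive1n k f) (derive1n k.+1 f x).
Proof. by move=> sf x0; rewrite derive1nS derive1E; apply/derivableP/sf. Qed.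

(** Two functions that agree on the half-line agree near each of its points;
    a guess for all the derivatives is thus checked one derivative at a time. *)
Lemma derive_towerP f (F : nat -> R -> R) :
  (forall x, 0 < x -> f x = F 0%N x) ->
  (forall k x, 0 < x -> is_derive x 1 (F k) (F k.+1 x)) ->
  smooth_pos f /\ forall k x, 0 < x -> derive1n k f x = F k x.
Proof.
move=> f0 dF.
have E : forall k x, 0 < x -> derive1n k f x = F k x.
  elim=> [|k IH] x x0; first exact: f0.
  rewrite derive1nS derive1E (@near_eq_derive _ _ _ _ (F k)).
    by have [_ ->] := dF k x x0.
  exact: near_pos.
split => // k x x0.
apply: (@near_eq_derivable _ _ _ (F k)); last by have [] := dF k x x0.
by apply: near_pos => // z z0; rewrite E.
Qed.

Lemma smooth_pos_ext f g : smooth_pos f -> (forall x, 0 < x -> g x = f x) ->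
  smooth_pos g /\ forall k x, 0 < x -> derive1n k g x = derive1n k f x.
Proof.
move=> sf gf; pose F k : R -> R := derive1n k f.
have gF x : 0 < x -> g x = F 0%N x by exact: gf.
by have := derive_towerP gF (fun k x => @smooth_pos_is_derive f k x sf).
Qed.

(** Cauchy's mean value theorem against s |-> (s-y)^(k+1): the factor
    (s-y)^k common to both derivatives cancels. *)
Lemma mean_quotient (N phi : R -> R) (k : nat) (x y : R) : 0 < x -> 0 < y -> x != y ->
  N y = 0 ->
  (forall s : R, 0 < s -> is_derive s 1 N ((s - y) ^+ k * phi s)) ->
  exists c, [/\ Num.min x y < c, c < Num.max x y &
    N x / (x - y) ^+ k.+1 = phi c / k.+1%:R].
Proof.
move=> x0 y0 xy Ny dN.
pose g (s : R) := (s - y) ^+ k.+1.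
pose dg (s : R) := k.+1%:R * (s - y) ^+ k.
have dgP (s : R) : is_derive s 1 g (dg s).
  apply: derX (derB (is_derive_id _ _) (is_derive_cst _ _ _)) _.
  by rewrite /dg subr0 mulr1.
have key (a b : R) : 0 < a -> a < b -> (a = y \/ b = y) ->
    exists2 c, c \in `]a, b[%R & 
     ((c - y) ^+ k * phi c) / dg c = (N b - N a) / (g b - g a).
  move=> a0 ab ay.
  apply: cauchy_MVT => //.
  - apply: derivable_within_continuous => s; rewrite in_itv/= => /andP[as_ _].
    have := dN s (lt_le_trans a0 as_); by case.
  - by apply: derivable_within_continuous => s _; have := dgP s; case.
  - by move=> s; rewrite in_itv/= => /andP[as_ _]; apply: dN; exact: lt_trans as_.
  - move=> s; rewrite in_itv/= => /andP[as_ sb].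
    rewrite mulf_neq0// ?pnatr_eq0// expf_neq0// subr_eq0.
    by case: ay => <-; rewrite neq_lt ?as_ ?sb ?orbT.
have fin c : c != y -> ((c - y) ^+ k * phi c) / dg c = phi c / k.+1%:R.
  move=> cy; have nz : (c - y) ^+ k != 0 by rewrite expf_neq0// subr_eq0.
  by rewrite /dg; field; rewrite nz andbT addrC natr1 pnatr_eq0.
have gy : g y = 0 by rewrite /g subrr expr0n.
have /orP[xly|ylx] : (x < y) || (y < x) by rewrite -neq_lt.
- have [c] := key x y x0 xly (or_intror erefl).
  rewrite in_itv/= => /andP[c1 c2]; rewrite fin ?lt_eqF// Ny gy !sub0r => E.
  exists c; rewrite min_l ?ltW// max_r ?ltW//; split => //.
  by rewrite E invrN mulrNN.
- have [c] := key y x y0 ylx (or_introl erefl).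
  rewrite in_itv/= => /andP[c1 c2]; rewrite fin ?gt_eqF// Ny gy !subr0 => E.
  by exists c; rewrite min_r ?ltW// max_l ?ltW//; split.
Qed.

Section Hadamard.
Variables (f : R -> R) (y : R).
Hypotheses (sf : smooth_pos f) (y0 : 0 < y).

(** Integration by parts of (s-y)^k f^(k+1)(s) from y on, repeated k times. *)
Fixpoint hadamard_num k s : R :=
  if k is k'.+1 then (s - y) ^+ k * derive1n k f s - k%:R * hadamard_num k' s
  else f s - f y.

Lemma hadamard_num_y k : hadamard_num k y = 0.
Proof.
by elim: k => [|k IH] /=; rewrite ?IH subrr// expr0n/= mul0r mulr0 subr0.
Qed.

Lemma is_derive_hadamard_num k (s : R) : 0 < s ->
  is_derive s 1 (hadamard_num k) ((s - y) ^+ k * derive1n k.+1 f s).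
Proof.
move=> s0; elim: k => [|k IH].
  have := smooth_pos_is_derive 0 sf s0; rewrite derive1n0 => df.
  by rewrite mul1r -[X in is_derive _ _ _ X]subr0; apply: derB.
have df := smooth_pos_is_derive k.+1 sf s0.
have dX : is_derive s 1 (fun s : R => (s - y) ^+ k.+1) (k.+1%:R * (s - y) ^+ k).
  apply: derX (derB (is_derive_id _ _) (is_derive_cst _ _ _)) _.
  by rewrite subr0 mulr1.
have dK := derM (is_derive_cst (k.+1%:R : R) s 1) IH erefl.
rewrite /hadamard_num -/hadamard_num.
apply: (is_derive_eq (derB (derM dX df erefl) dK)).
by rewrite mulr0 addr0; ring.
Qed.

(** The k-th derivative of s |-> f[s,y] as in Hadamard's lemma: this is the
    integral of t^k f^(k+1)(y + t(s-y)) over t in [0,1]. *)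
Definition hadamard k s : R :=
  if s == y then derive1n k.+1 f y / k.+1%:R
  else hadamard_num k s / (s - y) ^+ k.+1.

Lemma hadamard_mean k (s : R) : 0 < s ->
  exists c, [/\ Num.min s y <= c, c <= Num.max s y &
    hadamard k s = derive1n k.+1 f c / k.+1%:R].
Proof.
move=> s0; rewrite /hadamard; have [->|sy] := eqVneq s y.
  by exists y; rewrite minxx maxxx.
have [c [c1 c2 E]] := mean_quotient s0 y0 sy (hadamard_num_y k)
   (fun s s0 => is_derive_hadamard_num k s0).
by exists c; rewrite !ltW.
Qed.

(** Away from y this is the quotient rule.  At y, the difference quotient is
    again a quotient by a power of s-y of a function to which the mean value
    lemma applies, and the intermediate point tends to y with s. *)
Lemma is_derive_hadamard k (s : R) : 0 < s ->
  is_derive s 1 (hadamard k) (hadamard k.+1 s).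
Proof.
move=> s0; have [->|sy] := eqVneq s y; last first.
  have dn := is_derive_hadamard_num k s0.
  pose q (s : R) := hadamard_num k s / (s - y) ^+ k.+1.
  have E : \near s, q s = hadamard k s.
    apply/nbhs_ballP; exists `|s - y| => /=; first by rewrite normr_gt0 subr_eq0.
    move=> z; rewrite /ball/= /hadamard /q => sz; rewrite ifN//.
    by apply: contraTneq sz => ->; rewrite ltxx.
  apply: (near_eq_is_derive E).
  have nz : (s - y) ^+ k.+1 != 0 by rewrite expf_neq0// subr_eq0.
  have dp : is_derive s 1 (fun s : R => (s - y) ^+ k.+1) (k.+1%:R * (s - y) ^+ k).
    apply: derX (derB (is_derive_id _ _) (is_derive_cst _ _ _)) _.
    by rewrite subr0 mulr1.
  have dv := @derV (fun s : R => (s - y) ^+ k.+1) _ _ _ _ nz dp erefl.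
  apply: (is_derive_eq (derM dn dv erefl)).
  rewrite /hadamard (negbTE sy) /=.
  have nz' : s - y != 0 by rewrite subr_eq0.
  have nzk : (s - y) ^+ k != 0 by rewrite expf_neq0.
  rewrite /hadamard_num -/hadamard_num expr2 !exprS.
  move: ((s - y) ^+ k) (s - y) nzk nz' => t w t0 w0.
  by field; rewrite w0 t0.
rewrite /hadamard eqxx; apply/is_derive_epsP => e e0.
have df := smooth_pos_is_derive k.+1 sf y0.
have /is_derive_epsP/(_ e e0)[d d0 Hd] := df.
exists (Num.min d y); first by rewrite lt_min d0.
move=> h h0; rewrite lt_min => /andP[hd hy].
have s1 : 0 < h + y.
  by rewrite -ltrBlDr sub0r; move: hy; rewrite ltr_norml => /andP[].
have sy1 : h + y != y by rewrite -subr_eq0 addrK.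
rewrite scaler1 (negbTE sy1).
pose a := derive1n k.+1 f y / k.+1%:R.
pose N (s : R) := hadamard_num k s - a * (s - y) ^+ k.+1.
have Ny : N y = 0 by rewrite /N hadamard_num_y subrr expr0n mulr0 subrr.
pose phi (s : R) := (derive1n k.+1 f s - derive1n k.+1 f y) / (s - y).
have dN (s' : R) : 0 < s' -> is_derive s' 1 N ((s' - y) ^+ k.+1 * phi s').
  move=> s'0; have dn := is_derive_hadamard_num k s'0.
  have dX : is_derive s' 1 (fun s => (s - y) ^+ k.+1) (k.+1%:R * (s' - y) ^+ k).
    apply: derX (derB (is_derive_id _ _) (is_derive_cst _ _ _)) _.
    by rewrite subr0 mulr1.
  apply: (is_derive_eq (derB dn (derM (is_derive_cst a s' 1) dX erefl))).
  rewrite mulr0 addr0 /phi /a /cst exprS.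
  have kn0 : (k.+1%:R : R) != 0 by rewrite pnatr_eq0.
  have [->|ny] := eqVneq s' y.
    rewrite !subrr !mul0r.
    by move: kn0 ((0 : R) ^+ k) => kn0 t; field.
  have nz' : s' - y != 0 by rewrite subr_eq0.
  by move: (k.+1%:R : R) kn0 => kk kn0; field; rewrite ?kn0 ?nz'.
have [c [c1 c2 E]] := mean_quotient s1 y0 sy1 Ny dN.
have cy : c != y.
  move: c1 c2; rewrite /Num.min /Num.max; case: ifP => _ c1 c2.
    by rewrite lt_eqF.
  by rewrite gt_eqF.
rewrite eqxx; have -> : h^-1 *: (hadamard_num k (h + y) / (h + y - y) ^+ k.+1 - derive1n k.+1 f y / k.+1%:R)
   = N (h + y) / (h + y - y) ^+ k.+2.
  rewrite /N addrK -/a (exprS h k.+1) /GRing.scale/=.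
  have : h ^+ k.+1 != 0 by rewrite expf_neq0.
  by move: (h ^+ k.+1) => t t0; field; rewrite ?t0 ?h0.
rewrite E.
have cd : `|c - y| < d.
  apply: (le_lt_trans _ hd).
  have : Num.min (h + y) y <= c <= Num.max (h + y) y by rewrite !ltW.
  rewrite ler_norml.
  have [hp|hn] := leP 0 h.
    by rewrite min_r ?lerDr// max_l ?lerDr// (ger0_norm hp) => /andP[? ?]; lra.
  have hy' : h + y <= y by rewrite gerDr ltW.
  by rewrite (min_l hy') (max_r hy') (ltr0_norm hn) => /andP[? ?]; lra.
have cn : c - y != 0 by rewrite subr_eq0.
have := Hd _ cn cd; rewrite scaler1 subrK /GRing.scale/= mulrC -/(phi c).
rewrite -mulrBl normrM => He.
rewrite -[e]mulr1 ler_pM//.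
by rewrite ger0_norm ?invr_ge0// invf_le1// ler1n.
Qed.

Lemma dd1_hadamard (s : R) : 0 < s -> dd1 f s y = hadamard 0 s.
Proof.
move=> s0; rewrite /dd1 /hadamard; case: eqP => [->|_] /=.
  by rewrite divr1.
by rewrite expr1.
Qed.

Lemma smooth_pos_dd1_aux : smooth_pos (dd1 f ^~ y) /\
  forall k (s : R), 0 < s -> derive1n k (dd1 f ^~ y) s = hadamard k s.
Proof.
apply: derive_towerP; first exact: dd1_hadamard.
exact: is_derive_hadamard.
Qed.

End Hadamard.

Lemma smooth_pos_dd1 f (y : R) : smooth_pos f -> 0 < y -> smooth_pos (dd1 f ^~ y).
Proof. by move=> sf y0; have [] := smooth_pos_dd1_aux sf y0. Qed.

(** The derivatives of a divided difference are controlled by the next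
    derivative of the function, on any interval holding both arguments. *)
Lemma derive_dd1_mean f (y : R) k (s : R) : smooth_pos f -> 0 < y -> 0 < s ->
  exists c, [/\ Num.min s y <= c, c <= Num.max s y &
    derive1n k (dd1 f ^~ y) s = derive1n k.+1 f c / k.+1%:R].
Proof.
move=> sf y0 s0; have [_ ->//] := smooth_pos_dd1_aux sf y0.
exact: hadamard_mean.
Qed.

Lemma derive_dd1_diag f (y : R) k : smooth_pos f -> 0 < y ->
  derive1n k (dd1 f ^~ y) y = derive1n k.+1 f y / k.+1%:R.
Proof.
by move=> sf y0; have [_ ->//] := smooth_pos_dd1_aux sf y0; rewrite /hadamard eqxx.
Qed.

End Scalar.

Section DividedDifferences.
Variable R : realType.
Implicit Types (f g h : R -> R) (a b x y z : R).

Lemma dd1C f x y : dd1 f x y = dd1 f y x.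
Proof.
rewrite /dd1 eq_sym; case: eqP => [->//|_].
by rewrite -opprB -[in RHS](opprB x y) invrN mulrN mulNr.
Qed.

Lemma dd1_diag f x : dd1 f x x = derive1 f x.
Proof. by rewrite /dd1 eqxx. Qed.

Lemma dd1_neq f x y : x != y -> dd1 f x y = (f x - f y) / (x - y).
Proof. by rewrite /dd1 => /negbTE ->. Qed.

Lemma dd1_mul f x y : (x - y) * dd1 f x y = f x - f y.
Proof.
rewrite /dd1; case: eqVneq => [->|xy]; first by rewrite !subrr mul0r.
by rewrite mulrC divfK ?subr_eq0.
Qed.

Lemma derive1_dd1 f x y : smooth_pos f -> 0 < x -> 0 < y -> x != y ->
  derive1 (dd1 f ^~ y) x = (derive1 f x - dd1 f x y) / (x - y).
Proof.
move=> sf x0 y0 xy; rewrite derive1E.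
have [_ /(_ 1%N x x0)] := smooth_pos_dd1_aux sf y0.
rewrite derive1n1 derive1E => ->.
rewrite /hadamard (negbTE xy) /hadamard_num mul1r expr1.
have nz : x - y != 0 by rewrite subr_eq0.
by rewrite dd1_neq// derive1n1; field.
Qed.

Lemma derive1_dd1_diag f x : smooth_pos f -> 0 < x ->
  derive1 (dd1 f ^~ x) x = derive1n 2 f x / 2.
Proof. by move=> sf x0; rewrite -derive1n1 derive_dd1_diag. Qed.

(** The recurrence of the divided differences, at coinciding points too. *)
Lemma dd1_dd1 f a b x : smooth_pos f -> 0 < a -> 0 < b -> 0 < x ->
  (a - b) * dd1 (dd1 f ^~ a) x b = dd1 f x a - dd1 f x b.
Proof.
move=> sf a0 b0 x0; have [->|ab] := eqVneq a b; first by rewrite !subrr mul0r.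
have nab : a - b != 0 by rewrite subr_eq0.
have nba : b - a != 0 by rewrite subr_eq0 eq_sym.
have [->|xb] := eqVneq x b.
  rewrite dd1_diag derive1_dd1// 1?eq_sym// dd1_diag.
  by field.
have nxb : x - b != 0 by rewrite subr_eq0.
rewrite (dd1_neq _ xb) (dd1_neq f xb) (@dd1_neq f b a) 1?eq_sym//.
have [->|xa] := eqVneq x a.
  by rewrite dd1_diag; field; rewrite nab nba.
have nxa : x - a != 0 by rewrite subr_eq0.
by rewrite dd1_neq//; field; rewrite nxa nxb nba.
Qed.

Lemma dd2E f x y z : smooth_pos f -> 0 < x -> 0 < y -> 0 < z ->
  dd2 f x y z = dd1 (dd1 f ^~ x) z y.
Proof.
move=> sf x0 y0 z0; rewrite /dd2; have [->|yz] /= := eqVneq y z.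
  have [->|xz] /= := eqVneq x z.
    by rewrite [RHS]dd1_diag derive1_dd1_diag.
  by rewrite [RHS]dd1_diag derive1_dd1// 1?eq_sym// dd1_diag.
by rewrite (@dd1_neq (dd1 f ^~ x)) 1?eq_sym// (dd1C f x z) (dd1C f x y).
Qed.

(** For h the divided difference of f[.,a] and f[.,b], and c = a - b, this
    carries the recurrence over to the next order. *)
Lemma dd1_linear c f g h : smooth_pos f -> smooth_pos g -> smooth_pos h ->
  (forall x, 0 < x -> c * h x = f x - g x) ->
  forall x y, 0 < x -> 0 < y -> c * dd1 h x y = dd1 f x y - dd1 g x y.
Proof.
move=> sf sg sh E x y x0 y0.
have [->|xy] := eqVneq x y; last first.
  rewrite !dd1_neq// mulrA mulrBr !E// -mulrBl; congr (_ / _).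
  by rewrite opprB addrACA -opprB opprB addrCA; ring.
rewrite !dd1_diag !derive1E.
have dfy := sf 0%N y y0; have dgy := sg 0%N y y0; have dhy := sh 0%N y y0.
rewrite -[RHS](deriveB dfy dgy) -[LHS](deriveZ c dhy).
apply: near_eq_derive; apply: (@near_pos _ _ (fun z => c * h z = f z - g z)) => //.
Qed.

Definition deriv_bound f (m : nat) (al be M : R) :=
  forall (k : nat) (x : R), (k <= m)%N -> al <= x <= be -> `|derive1n k f x| <= M.

Lemma segment_bound h al be : {within `[al, be], continuous h} ->
  exists2 M : R, 0 <= M & forall x : R, al <= x <= be -> `|h x| <= M.
Proof.
move=> ch; have [ab|ba] := leP al be; last first.
  by exists 0 => // x /andP[? ?]; exfalso; lra.
have [c _ Hc] := EVT_max ab ch; have [d _ Hd] := EVT_min ab ch.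
exists (`|h c| + `|h d|); first by rewrite addr_ge0.
move=> x xab; have xab' : x \in `[al, be]%R by rewrite in_itv.
have := Hc _ xab'; have := Hd _ xab'.
have := ler_norm (h c); have := ler_norm (- h d); rewrite normrN.
have := normr_ge0 (h c); have := normr_ge0 (h d).
by rewrite ler_norml => *; lra.
Qed.

Lemma deriv_bound_exists f m al be : smooth_pos f -> 0 < al ->
  exists2 M : R, 0 <= M & deriv_bound f m al be M.
Proof.
move=> sf al0; have B k : exists2 M : R, 0 <= M &
    forall x : R, al <= x <= be -> `|derive1n k f x| <= M.
  apply: segment_bound; apply: derivable_within_continuous => z.
  rewrite in_itv/= => /andP[z1 _].
  by apply: sf; exact: lt_le_trans z1.
elim: m => [|m [M M0 HM]].
  have [M M0 HM] := B 0%N.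
  by exists M => // k x; rewrite leqn0 => /eqP ->; exact: HM.
have [M' M'0 HM'] := B m.+1; exists (Num.max M M'); first by rewrite le_max M0.
move=> k x; rewrite leq_eqVlt => /orP[/eqP ->|km] xab; rewrite le_max.
  by rewrite HM' ?orbT.
by rewrite HM.
Qed.

(** A divided difference costs one derivative and no constant, by the mean
    value form of its derivatives. *)
Lemma deriv_bound_dd1 f m al be M y : smooth_pos f -> 0 < al ->
  al <= y <= be -> deriv_bound f m.+1 al be M ->
  deriv_bound (dd1 f ^~ y) m al be M.
Proof.
move=> sf al0 /andP[y1 y2] HM k x km /andP[x1 x2].
have y0 := lt_le_trans al0 y1; have x0 := lt_le_trans al0 x1.
have [c [c1 c2 ->]] := derive_dd1_mean k sf y0 x0.
rewrite normrM normfV (@ger0_norm _ k.+1%:R)//.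
rewrite ler_pdivrMr ?ltr0n//.
have H : `|derive1n k.+1 f c| <= M.
  apply: HM => //; rewrite (le_trans _ c1) ?le_min ?x1//=.
  by rewrite (le_trans c2)// ge_max x2.
apply: (le_trans H); rewrite ler_peMr ?ler1n//.
exact: le_trans H.
Qed.

End DividedDifferences.

Section SmoothScalars.
Variable R : realType.
Implicit Types (f g h : R -> R) (a b x y z : R).

(** Differentiability of order k with the first derivative outermost in the
    recursion, the form in which products and compositions go by induction. *)
Fixpoint Dk k f : Prop :=
  if k is k'.+1 then (forall x, 0 < x -> derivable f x 1) /\ Dk k' (derive1 f)
  else True.

Lemma smooth_posP f : smooth_pos f <-> forall k, Dk k f.
Proof.
split=> [sf k|].
  elim: k f sf => [//|k IH] f sf; split; first exact: (sf 0%N).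
  by apply: IH => j x x0; rewrite -derive1Sn; exact: sf.
move=> H k; elim: k f H => [|k IH] f H x x0.
  by have [+ _] := H 1%N; apply.
rewrite derive1Sn; apply: IH => // j.
by have [] := H j.+1.
Qed.

Lemma derive1_ext f g : (forall x, 0 < x -> g x = f x) ->
  forall x, 0 < x -> derive1 g x = derive1 f x.
Proof.
by move=> E x x0; rewrite !derive1E; apply: near_eq_derive; exact: near_pos.
Qed.

Lemma Dk_ext k f g : Dk k f -> (forall x, 0 < x -> g x = f x) -> Dk k g.
Proof.
elim: k f g => [//|k IH] f g [df Df] E; split.
  move=> x x0; apply: near_eq_derivable (df x x0).
  by apply: near_pos => // z z0; rewrite E.
by apply: IH Df _; exact: derive1_ext.
Qed.

Lemma DkW k f : Dk k.+1 f -> Dk k f.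
Proof. by elim: k f => [//|k IH] f [df /IH]. Qed.

Lemma DkD k f g : Dk k f -> Dk k g -> Dk k (fun x => f x + g x).
Proof.
elim: k f g => [//|k IH] f g [df Df] [dg Dg]; split.
  by move=> x x0; apply: derivableD; [exact: df|exact: dg].
apply: (Dk_ext (IH _ _ Df Dg)) => x x0.
by rewrite !derive1E -deriveD; [|exact: df|exact: dg].
Qed.

Lemma DkM k f g : Dk k f -> Dk k g -> Dk k (fun x => f x * g x).
Proof.
elim: k f g => [//|k IH] f g Df Dg; split.
  by move=> x x0; apply: derivableM; [exact: (Df.1)|exact: (Dg.1)].
have D1 := IH _ _ (DkW Df) Dg.2; have D2 := IH _ _ (DkW Dg) Df.2.
apply: (Dk_ext (DkD D1 D2)) => x x0.
rewrite !derive1E.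
exact: (@deriveM R R f g x 1 (Df.1 _ x0) (Dg.1 _ x0)).
Qed.

Lemma Dk_comp k f g : (forall x, 0 < x -> 0 < g x) ->
  Dk k f -> Dk k g -> Dk k (f \o g).
Proof.
move=> gp; elim: k f => [//|k IH] f Df Dg; split.
  move=> x x0; apply/derivable1_diffP; apply: differentiable_comp.
    by apply/derivable1_diffP; exact: Dg.1.
  by apply/derivable1_diffP; apply: Df.1; exact: gp.
apply: (Dk_ext (DkM (IH _ Df.2 (DkW Dg)) Dg.2)) => x x0.
by rewrite derive1_comp; [|exact: Dg.1|apply: Df.1; exact: gp].
Qed.

Lemma smooth_pos_comp f g : (forall x, 0 < x -> 0 < g x) ->
  smooth_pos f -> smooth_pos g -> smooth_pos (f \o g).
Proof.
move=> gp /smooth_posP sf /smooth_posP sg; apply/smooth_posP => k.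
exact: Dk_comp.
Qed.

Lemma smooth_pos_powR a : smooth_pos (fun x => x `^ a).
Proof.
pose F (k : nat) (x : R) := \prod_(i < k) (a - i%:R) * x `^ (a - k%:R).
have F0 x : 0 < x -> x `^ a = F 0%N x by rewrite /F big_ord0 mul1r subr0.
have dF k (x : R) : 0 < x -> is_derive x 1 (F k) (F k.+1 x).
  move=> x0; have dp := is_derive1_powR (a - k%:R) x0.
  apply: (is_derive_eq (derM (is_derive_cst (\prod_(i < k) (a - i%:R)) x 1) dp erefl)).
  rewrite mulr0 addr0 /F big_ord_recr /= /cst -mulrA; congr (_ * (_ * _)).
  by rewrite -natr1 opprD addrA.
by have [] := derive_towerP F0 dF.
Qed.

Lemma smooth_pos_derive1 f g : (forall x, 0 < x -> is_derive x 1 f (g x)) ->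
  smooth_pos g -> smooth_pos f.
Proof.
move=> df /smooth_posP sg; apply/smooth_posP => -[//|k]; split.
  by move=> x /df[].
by apply: (Dk_ext (sg k)) => x /df[_ <-]; rewrite derive1E.
Qed.

Lemma smooth_pos_ln : smooth_pos (@ln R).
Proof.
apply: (@smooth_pos_derive1 _ (fun x => x `^ (-1))); last exact: smooth_pos_powR.
by move=> x x0; rewrite powRN powRr1 ?ltW//; exact: is_derive1_ln.
Qed.

Lemma smooth_pos_power_fun a : smooth_pos (power_fun a).
Proof.
rewrite /power_fun; case: eqP => _; first exact: smooth_pos_ln.
exact: smooth_pos_powR.
Qed.

End SmoothScalars.

(** * Second divided differences *)

Section SecondDividedDifferences.
Variable R : realType.
Implicit Types (f u v : R -> R) (x y z : R).

Lemma dd2_swap23 f x y z : smooth_pos f -> 0 < x -> 0 < y -> 0 < z ->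
  dd2 f x y z = dd2 f x z y.
Proof. by move=> sf x0 y0 z0; rewrite !dd2E// dd1C. Qed.

Lemma dd2_swap12 f x y z : smooth_pos f -> 0 < x -> 0 < y -> 0 < z ->
  dd2 f x y z = dd2 f y x z.
Proof.
move=> sf x0 y0 z0; have [->//|xy] := eqVneq x y.
rewrite !dd2E//; have nz : x - y != 0 by rewrite subr_eq0.
have E := dd1_dd1 sf x0 y0 z0; have E' := dd1_dd1 sf y0 x0 z0.
by apply: (mulfI nz); rewrite E -[x - y]opprB mulNr E' opprB.
Qed.

Lemma dd2_rot f x y z : smooth_pos f -> 0 < x -> 0 < y -> 0 < z ->
  dd2 f y z x = dd2 f x y z.
Proof.
move=> sf x0 y0 z0.
by rewrite (dd2_swap23 sf y0 z0 x0) (dd2_swap12 sf y0 x0 z0).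
Qed.

Lemma dd2_mul f x y z : smooth_pos f -> 0 < x -> 0 < y -> 0 < z ->
  (x - y) * dd2 f x y z = dd1 f x z - dd1 f y z.
Proof.
by move=> sf x0 y0 z0; rewrite (dd2E sf x0 y0 z0) (dd1_dd1 sf x0 y0 z0) (dd1C f z x) (dd1C f z y).
Qed.

(** The second divided difference of v with respect to u, up to the factor
    u[x,y] u[y,z] u[x,z]. *)
Definition dd_cross u v x y z :=
  dd1 u x y * dd2 v x y z - dd1 v x y * dd2 u x y z.

Lemma dd_cross_swap12 u v x y z : smooth_pos u -> smooth_pos v ->
  0 < x -> 0 < y -> 0 < z -> dd_cross u v x y z = dd_cross u v y x z.
Proof.
move=> su sv x0 y0 z0; rewrite /dd_cross (dd1C u) (dd1C v).
by rewrite (dd2_swap12 su x0 y0 z0) (dd2_swap12 sv x0 y0 z0).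
Qed.

(** Since u[x,y] = u[x,z] + (y-z) u[x,y,z], and likewise for v, the exchange
    of y and z is a row operation on the 2 x 2 determinant dd_cross. *)
Lemma dd_cross_swap23 u v x y z : smooth_pos u -> smooth_pos v ->
  0 < x -> 0 < y -> 0 < z -> dd_cross u v x y z = dd_cross u v x z y.
Proof.
move=> su sv x0 y0 z0; apply/eqP; rewrite -subr_eq0 /dd_cross.
rewrite -(dd2_swap23 su x0 y0 z0) -(dd2_swap23 sv x0 y0 z0).
rewrite (dd1C u x y) (dd1C u x z) (dd1C v x y) (dd1C v x z).
have Eu := dd2_mul su y0 z0 x0; have Ev := dd2_mul sv y0 z0 x0.
rewrite (dd2_rot su x0 y0 z0) in Eu; rewrite (dd2_rot sv x0 y0 z0) in Ev.
have -> : dd1 u y x = dd1 u z x + (y - z) * dd2 u x y z by rewrite Eu; ring.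
have -> : dd1 v y x = dd1 v z x + (y - z) * dd2 v x y z by rewrite Ev; ring.
apply/eqP; clear; move: (dd2 u x y z) (dd2 v x y z) (dd1 u z x) (dd1 v z x).
by move=> P Q a b; ring.
Qed.

Lemma dd_crossC u v x y z : dd_cross u v x y z = - dd_cross v u x y z.
Proof. by rewrite /dd_cross opprB. Qed.

End SecondDividedDifferences.

(** * Spectral theorem for real symmetric matrices *)

Section MxNorm.
Variable R : realType.

Lemma mx_norm_entry m n (A : 'M[R]_(m, n)) i j : `|A i j| <= `|A|.
Proof.
rewrite [leRHS]/Num.Def.normr/= mx_normrE.
exact: (le_bigmax _ (fun ij => `|A ij.1 ij.2|) (i, j)).
Qed.

Lemma mx_norm_le m n (A : 'M[R]_(m, n)) (c : R) : 0 <= c ->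
  (forall i j, `|A i j| <= c) -> `|A| <= c.
Proof.
move=> c0 H; rewrite [leLHS]/Num.Def.normr/= mx_normrE.
by apply: bigmax_le => // -[i j] _ /=; exact: H.
Qed.

Lemma mx_norm_mul m n p (A : 'M[R]_(m, n)) (B : 'M[R]_(n, p)) :
  `|A *m B| <= n%:R * `|A| * `|B|.
Proof.
apply: mx_norm_le => [|i j]; first by rewrite !mulr_ge0.
rewrite mxE; apply: (le_trans (ler_norm_sum _ _ _)).
rewrite -mulrA mulr_natl -[X in _ *+ X]card_ord -sumr_const.
by apply: ler_sum => k _; rewrite normrM ler_pM// mx_norm_entry.
Qed.

End MxNorm.

Section Rayleigh.
Variable R : realType.

Definition dotv n (x y : 'rV[R]_n) : R := (x *m y^T) ord0 ord0.

Lemma dotvE n (x y : 'rV[R]_n) : dotv x y = \sum_j x ord0 j * y ord0 j.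
Proof. by rewrite /dotv mxE; apply: eq_bigr => j _; rewrite mxE. Qed.

Lemma dotvC n (x y : 'rV[R]_n) : dotv x y = dotv y x.
Proof. by rewrite !dotvE; apply: eq_bigr => j _; rewrite mulrC. Qed.

Lemma dotv_ge0 n (x : 'rV[R]_n) : 0 <= dotv x x.
Proof. by rewrite dotvE sumr_ge0// => j _; rewrite -expr2 sqr_ge0. Qed.

Lemma dotv_eq0 n (x : 'rV[R]_n) : dotv x x = 0 -> x = 0.
Proof.
rewrite dotvE => /eqP; rewrite psumr_eq0 => [/allP H|j _]; last first.
  by rewrite -expr2 sqr_ge0.
apply/rowP => j; rewrite mxE; have := H j (mem_index_enum _).
by rewrite mulf_eq0 orbb => /eqP.
Qed.

Lemma dotvDl n (x y z : 'rV[R]_n) : dotv (x + y) z = dotv x z + dotv y z.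
Proof. by rewrite /dotv mulmxDl mxE. Qed.

Lemma dotvZl n t (x z : 'rV[R]_n) : dotv (t *: x) z = t * dotv x z.
Proof. by rewrite /dotv -scalemxAl mxE. Qed.

Lemma dotvZr n t (x z : 'rV[R]_n) : dotv x (t *: z) = t * dotv x z.
Proof. by rewrite dotvC dotvZl dotvC. Qed.

Lemma dotvBr n (x y z : 'rV[R]_n) : dotv x (y - z) = dotv x y - dotv x z.
Proof. by rewrite dotvC dotvDl -scaleN1r dotvZl mulN1r !(dotvC _ x). Qed.

Lemma continuous_entry m n (i : 'I_m) (j : 'I_n) :
  continuous (fun x : 'M[R]_(m, n) => x i j).
Proof. exact: coord_continuous. Qed.

Lemma continuous_sum (T : topologicalType) n (F : 'I_n -> T -> R) x :
  (forall i, F i @ x --> F i x) ->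
  (fun y => \sum_i F i y) @ x --> \sum_i F i x.
Proof.
move=> H; elim: n F H => [|n IH] F H.
  rewrite big_ord0 (_ : (fun _ => _) = cst 0); first exact: cvg_cst.
  by apply/funext => y; rewrite big_ord0.
rewrite big_ord_recr /= (_ : (fun _ => _) = (fun y => \sum_(i < n) F (widen_ord (leqnSn n) i) y + F ord_max y)).
  by apply: cvgD; [apply: IH => i; exact: H|exact: H].
by apply/funext => y; rewrite big_ord_recr.
Qed.

(** The sign is tested at t = -b/(a+1), as a may vanish. *)
Lemma linear_term_eq0 (a b : R) : 0 <= a ->
  (forall t, 0 <= 2 * t * b + t ^+ 2 * a) -> b = 0.
Proof.
move=> a0 H; apply/eqP/negPn/negP => nz.
have a1 : 0 < a + 1 by lra.
have := H (- b / (a + 1)).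
have -> : 2 * (- b / (a + 1)) * b + (- b / (a + 1)) ^+ 2 * a =
   - (b ^+ 2 * ((a + 2) / (a + 1) ^+ 2)).
  by field; rewrite gt_eqF.
rewrite oppr_ge0 leNgt => /negP; apply.
by rewrite mulr_gt0// ?exprn_even_gt0// divr_gt0 ?exprn_gt0//; lra.
Qed.

(** A maximizer of the Rayleigh quotient over the unit sphere is an
    eigenvector: the form lambda |x|^2 - x S x^T is positive semidefinite and
    vanishes there. *)
Lemma sym_eigenvector n (S : 'M[R]_n.+1) : S^T = S ->
  exists (l : R) (x : 'rV[R]_n.+1), dotv x x = 1 /\ x *m S = l *: x.
Proof.
move=> symS.
pose A := [set x : 'rV[R]_n.+1 | dotv x x = 1].
have contd : continuous (fun x : 'rV[R]_n.+1 => dotv x x).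
  move=> x; have -> : (fun x : 'rV[R]_n.+1 => dotv x x) =
     (fun x => \sum_j x ord0 j * x ord0 j) by apply/funext => z; rewrite dotvE.
  by apply: continuous_sum => i; apply: continuousM; exact: continuous_entry.
have cA : compact A.
  apply: bounded_closed_compact.
    exists 1; split => // r r1 x Ax; apply: ltW; apply: le_lt_trans r1.
    apply: mx_norm_le => // i j; rewrite (ord1 i).
    rewrite -[leRHS]sqrtr1 -(sqrtr_sqr (x 0 j)) ler_sqrt// -Ax dotvE.
    rewrite (bigD1 j)//= -expr2 lerDl sumr_ge0// => k _.
    by rewrite -expr2 sqr_ge0.
  have -> : A = (fun x : 'rV[R]_n.+1 => dotv x x) @^-1` [set 1] by [].
  by apply: closed_comp => [x _|]; [exact: contd|exact: closed_eq].
have A0 : A !=set0.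
  exists (delta_mx 0 0); rewrite /A/= dotvE (bigD1 ord0)//= !mxE !eqxx mulr1.
  by rewrite big1 ?addr0// => j j0; rewrite !mxE (negbTE j0) andbF mul0r.
pose q (x : 'rV[R]_n.+1) := dotv (x *m S) x.
have cq : {within A, continuous q}.
  apply: continuous_subspaceT => x.
  have -> : q = (fun x => \sum_j (\sum_k x ord0 k * S k j) * x ord0 j).
    by apply/funext => z; rewrite /q dotvE; apply: eq_bigr => j _; rewrite mxE.
  apply: continuous_sum => i; apply: continuousM; last exact: continuous_entry.
  apply: continuous_sum => k; apply: continuousM; first exact: continuous_entry.
  exact: cst_continuous.
have [c + Hc] := EVT_max_rV A0 cA cq.
rewrite inE => Ac; exists (q c), c; split => //.
pose Q x y := q c * dotv x y - dotv (x *m S) y.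
have Qge0 x : 0 <= Q x x.
  have [/dotv_eq0 ->|nz] := eqVneq (dotv x x) 0.
    by rewrite /Q mul0mx /dotv !mul0mx mxE mulr0 subrr.
  pose r := Num.sqrt (dotv x x).
  have r0 : r != 0 by rewrite sqrtr_eq0 -ltNge lt_neqAle eq_sym nz dotv_ge0.
  have r2 : r * r = dotv x x by rewrite -expr2 sqr_sqrtr// dotv_ge0.
  have Ax : A (r^-1 *: x).
    by rewrite /A/= dotvZl dotvZr -r2; field.
  have /Hc : r^-1 *: x \in A by rewrite inE.
  rewrite {1}/q -scalemxAl dotvZl dotvZr mulrA -invfM r2 mulrC ler_pdivrMr; last by rewrite lt_neqAle eq_sym nz dotv_ge0.
  by rewrite /Q subr_ge0.
have QC x y : Q x y = Q y x.
  rewrite /Q dotvC; congr (_ - _).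
  by rewrite [RHS]dotvC /dotv trmx_mul symS mulmxA.
have Qadd x y z : Q (x + y) z = Q x z + Q y z.
  by rewrite /Q mulmxDl !dotvDl; ring.
have Qscale t x z : Q (t *: x) z = t * Q x z.
  by rewrite /Q -scalemxAl !dotvZl; ring.
have Qcc : Q c c = 0 by rewrite /Q Ac mulr1 subrr.
have Qc y : Q c y = 0.
  pose b := Q c y; pose a := Q y y.
  apply: (@linear_term_eq0 a) => [|t]; first exact: Qge0.
  have := Qge0 (c + t *: y).
  rewrite Qadd !(QC _ (c + _)) !Qadd Qcc !(QC _ (t *: y)) !Qscale (QC y c) (QC y (t *: y)) Qscale.
  have -> : 2 * t * b + t ^+ 2 * a = 0 + t * b + (t * b + t * (t * a)) by ring.
  by [].
apply/eqP; rewrite -subr_eq0; apply/eqP/rowP => j; rewrite [RHS]mxE.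
have := Qc (delta_mx 0 j).
have dE (x : 'rV[R]_n.+1) : dotv x (delta_mx 0 j) = x ord0 j.
  rewrite dotvE (bigD1 j)//= mxE !eqxx mulr1 big1 ?addr0// => k kj.
  by rewrite mxE (negbTE kj) andbF mulr0.
rewrite /Q !dE => E.
rewrite mxE [X in _ + X]mxE [X in _ - X]mxE.
by apply/eqP; rewrite subr_eq0 eq_sym -subr_eq0; apply/eqP.
Qed.

(** The Householder reflection exchanging e0 and x. *)
Lemma orthogonal_first_row n (x : 'rV[R]_n.+1) : dotv x x = 1 ->
  exists H : 'M[R]_n.+1, H *m H^T = 1%:M /\ row 0 H = x.
Proof.
move=> xx; pose e : 'rV[R]_n.+1 := delta_mx 0 0.
have [xe|xe] := eqVneq x e.
  exists 1%:M; split; first by rewrite trmx1 mulmx1.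
  by rewrite xe; apply/rowP => j; rewrite !mxE eqxx eq_sym.
pose v := x - e; pose c := dotv v v.
have c0 : c != 0.
  by apply/eqP => /dotv_eq0/eqP; rewrite subr_eq0 (negbTE xe).
have ee : dotv e e = 1.
  rewrite dotvE (bigD1 ord0)//= !mxE !eqxx mulr1 big1 ?addr0// => j j0.
  by rewrite !mxE (negbTE j0) andbF mul0r.
have cE : c = 2 * (1 - dotv e x).
  by rewrite /c dotvBr !(dotvC v) !dotvBr xx ee (dotvC x e); ring.
have vv : v *m v^T = c%:M.
  by apply/matrixP => i j; rewrite !ord1 [RHS]mxE eqxx mulr1n.
pose V := v^T *m v; pose k := 2 / c.
have VV : V *m V = c *: V.
  by rewrite /V mulmxA -(mulmxA v^T) vv mul_mx_scalar scalemxAl.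
have VT : V^T = V by rewrite /V trmx_mul trmxK.
pose H := 1%:M - k *: V.
have HT : H^T = H by rewrite /H linearB/= linearZ/= trmx1 VT.
exists H; split.
  rewrite HT {1}/H mulmxBl mul1mx -scalemxAl /H mulmxBr mulmx1 -scalemxAr VV.
  move: (V) => W; apply/matrixP => i j; rewrite !mxE.
  by rewrite /k; field.
rewrite rowE -/e /H mulmxBr mulmx1 -scalemxAr /V mulmxA.
have -> : e *m v^T = (dotv e v)%:M.
  by apply/matrixP => i j; rewrite !ord1 [RHS]mxE eqxx mulr1n.
rewrite mul_scalar_mx scalerA.
have -> : k * dotv e v = -1.
  have -> : dotv e v = - (1 - dotv e x).
    by rewrite /v dotvBr ee opprB.
  by move: c0; rewrite /k cE mulf_eq0 pnatr_eq0 /= => c0; field.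
by rewrite scaleN1r opprK /v addrC subrK.
Qed.

(** By induction: completing a unit eigenvector to an orthogonal matrix splits
    off a 1 x 1 block. *)
Theorem spectral_theorem n (S : 'M[R]_n) : S^T = S ->
  exists (P : 'M[R]_n) (d : 'rV[R]_n),
    orthogonalmx P /\ S = P *m diag_mx d *m P^T.
Proof.
elim: n S => [|n IH] S symS.
  by exists 1%:M, 0; split; [rewrite /orthogonalmx trmx1 mulmx1|rewrite [LHS]flatmx0 [RHS]flatmx0].
have [l [x [xx xS]]] := sym_eigenvector symS.
have [H [HH rH]] := orthogonal_first_row xx.
have HH' : H^T *m H = 1%:M by apply: mulmx1C.
pose S1 : 'M[R]_(1 + n) := H *m S *m H^T.
have symS1 : S1^T = S1 by rewrite /S1 !trmx_mul trmxK symS mulmxA.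
have r0 : row 0 S1 = l *: delta_mx 0 0.
  rewrite /S1 !row_mul rH xS -scalemxAl -rH -row_mul HH.
  by congr (_ *: _); apply/rowP => j; rewrite !mxE eqxx eq_sym.
pose S2 := drsubmx S1.
have ur : ursubmx S1 = 0.
  apply/matrixP => i j; rewrite !ord1 !mxE/=.
  have := congr1 (fun M : 'rV_(1 + n) => M 0 (rshift 1 j)) r0.
  by rewrite !mxE/= mulr0 lshift0.
have S1E : S1 = block_mx l%:M 0 0 S2.
  rewrite -[LHS]submxK ur; congr block_mx.
  - apply/matrixP => i j; rewrite !ord1 !mxE/=.
    have := congr1 (fun M : 'rV_(1 + n) => M 0 0) r0; rewrite !mxE/= mulr1.
    by rewrite !lshift0.
  - by apply: trmx_inj; rewrite trmx_dlsub symS1 ur !trmx0.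
have symS2 : S2^T = S2 by rewrite /S2 -[in RHS]symS1 trmx_drsub.
have [P2 [d2 [oP2 S2E]]] := IH S2 symS2.
pose P3 : 'M[R]_(1 + n) := block_mx 1%:M 0 0 P2.
have oP3 : P3 *m P3^T = 1%:M.
  rewrite /P3 (@tr_block_mx _ 1 n 1 n) trmx1 !trmx0.
  rewrite (@mulmx_block _ 1 n 1 n 1 n) !mulmx0 !mul0mx mulmx1 !addr0 !add0r oP2.
  by rewrite -scalar_mx_block.
pose d : 'rV[R]_(1 + n) := row_mx l%:M d2.
exists (H^T *m P3), d; split.
  rewrite /orthogonalmx trmx_mul trmxK mulmxA -(mulmxA H^T) oP3 mulmx1.
  exact: HH'.
have S1E' : S1 = P3 *m diag_mx d *m P3^T.
  rewrite S1E /d diag_mx_row /P3 (@tr_block_mx _ 1 n 1 n) trmx1 !trmx0.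
  rewrite !(@mulmx_block _ 1 n 1 n 1 n) !mulmx0 !mul0mx !mulmx1 !mul1mx !addr0 !add0r.
  rewrite mul0mx S2E; congr block_mx.
  by apply/matrixP => i j; rewrite !ord1 !mxE.
have -> : S = H^T *m S1 *m H.
  by rewrite /S1 !mulmxA HH' mul1mx -mulmxA HH' mulmx1.
by rewrite S1E' trmx_mul trmxK !mulmxA.
Qed.

End Rayleigh.

(** * Spectral decompositions and SPD(n) *)

Section Decompositions.
Variables (R : realType) (n : nat).
Notation dec := ('M[R]_n * 'rV[R]_n)%type.
Implicit Types (D E : dec) (A S X Y P : 'M[R]_n).

(** Decompositions are handled as pairs D = (P, d), since many pairs give the
    same matrix and, for n > 1, no choice among them is continuous. *)
Definition decmx D : 'M[R]_n := D.1 *m diag_mx D.2 *m D.1^T.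

Definition eigproj D i : 'M[R]_n := col i D.1 *m (col i D.1)^T.

Lemma orthogonalmxT P : orthogonalmx P -> P^T *m P = 1%:M.
Proof. exact: mulmx1C. Qed.

Lemma conj_diagE P (d : 'rV[R]_n) :
  P *m diag_mx d *m P^T = \sum_i d ord0 i *: (col i P *m (col i P)^T).
Proof.
apply/matrixP => a b; rewrite !mxE summxE; apply: eq_bigr => i _.
rewrite mul_mx_diag !mxE big_ord1 !mxE; ring.
Qed.

Lemma decmxE D : decmx D = \sum_i D.2 ord0 i *: eigproj D i.
Proof. exact: conj_diagE. Qed.

Lemma decmx_sym D : Sym (decmx D).
Proof. by rewrite /Sym/= /decmx !trmx_mul trmxK tr_diag_mx mulmxA. Qed.

Lemma sum_eigproj D : orthogonalmx D.1 -> \sum_i eigproj D i = 1%:M.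
Proof.
move=> oD; rewrite -[RHS]oD.
have := conj_diagE D.1 (const_mx 1); rewrite diag_const_mx mulmx1 => ->.
by apply: eq_bigr => i _; rewrite mxE scale1r.
Qed.

Lemma eigproj_mul D i j : orthogonalmx D.1 ->
  eigproj D i *m eigproj D j = if i == j then eigproj D i else 0.
Proof.
move=> /orthogonalmxT oD; rewrite /eigproj mulmxA -(mulmxA (col i _)).
have -> : (col i D.1)^T *m col j D.1 = (i == j)%:R%:M.
  apply/matrixP => a b; rewrite !ord1 tr_col.
  have := congr1 (fun M : 'M[R]_n => M i j) oD; rewrite !mxE eqxx mulr1n => <-.
  by apply: eq_bigr => k _; rewrite !mxE.
by rewrite mul_mx_scalar -scalemxAl; case: eqP => [->|_]; rewrite ?scale1r ?scale0r.
Qed.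

Lemma eigproj_decmx D i : orthogonalmx D.1 ->
  eigproj D i *m decmx D = D.2 ord0 i *: eigproj D i.
Proof.
move=> oD; rewrite decmxE mulmx_sumr (bigD1 i)//= big1 ?addr0 => [|j ji].
  by rewrite -scalemxAr eigproj_mul// eqxx.
by rewrite -scalemxAr eigproj_mul// eq_sym (negbTE ji) scaler0.
Qed.

Lemma decmx_eigproj D i : orthogonalmx D.1 ->
  decmx D *m eigproj D i = D.2 ord0 i *: eigproj D i.
Proof.
move=> oD; rewrite decmxE mulmx_suml (bigD1 i)//= big1 ?addr0 => [|j ji].
  by rewrite -scalemxAl eigproj_mul// eqxx.
by rewrite -scalemxAl eigproj_mul// (negbTE ji) scaler0.
Qed.

Lemma orthogonalmx_entry P i j : orthogonalmx P -> `|P i j| <= 1.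
Proof.
move=> oP; have := congr1 (fun M : 'M[R]_n => M i i) oP; rewrite !mxE eqxx => E.
rewrite -[leRHS]sqrtr1 -(sqrtr_sqr (P i j)) ler_sqrt// -[leRHS]E.
rewrite (bigD1 j)//= mxE -expr2 lerDl sumr_ge0// => k _.
by rewrite mxE -expr2 sqr_ge0.
Qed.

Lemma eigproj_norm D i : orthogonalmx D.1 -> `|eigproj D i| <= 1.
Proof.
move=> oD; apply: mx_norm_le => // a b.
rewrite mxE big_ord1 !mxE normrM -[leRHS]mulr1.
by rewrite ler_pM// orthogonalmx_entry.
Qed.

Lemma decmx_SPD D : orthogonalmx D.1 -> (forall i, 0 < D.2 ord0 i) ->
  SPD (decmx D).
Proof.
move=> oD d0; split; first exact: decmx_sym.
move=> x x0; pose y := D.1^T *m x.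
have xy : x = D.1 *m y by rewrite /y mulmxA oD mul1mx.
have -> : x^T *m decmx D *m x = y^T *m diag_mx D.2 *m y.
  by rewrite /decmx /y trmx_mul trmxK !mulmxA.
have E : (y^T *m diag_mx D.2 *m y) ord0 ord0 = \sum_k D.2 ord0 k * y k ord0 ^+ 2.
  by rewrite mul_mx_diag mxE; apply: eq_bigr => k _; rewrite !mxE; ring.
rewrite E lt_neqAle eq_sym sumr_ge0 ?andbT => [|k _]; last first.
  by rewrite mulr_ge0 ?sqr_ge0// ltW.
apply: contra_neq x0; move/eqP; rewrite psumr_eq0 => [/allP H|k _]; last first.
  by rewrite mulr_ge0 ?sqr_ge0// ltW.
rewrite xy (_ : y = 0) ?mulmx0//; apply/matrixP => k j; rewrite (ord1 j) [RHS]mxE.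
have := H k (mem_index_enum _); rewrite mulf_eq0 gt_eqF//= sqrf_eq0.
by move/eqP.
Qed.

Definition qform A (x : 'cV[R]_n) : R := (x^T *m A *m x) ord0 ord0.

Lemma qformD A B x : qform (A + B) x = qform A x + qform B x.
Proof. by rewrite /qform mulmxDr mulmxDl mxE. Qed.

Lemma qform_col D i : orthogonalmx D.1 -> qform (decmx D) (col i D.1) = D.2 ord0 i.
Proof.
move=> oD; have oD' := orthogonalmxT oD.
have -> : col i D.1 = D.1 *m delta_mx i 0 by rewrite colE.
rewrite /qform /decmx trmx_mul !mulmxA.
rewrite -(mulmxA _ D.1^T) oD' mulmx1 -(mulmxA _ D.1^T) oD' mulmx1.
rewrite mul_mx_diag mxE (bigD1 i)//= !mxE !eqxx mul1r mulr1.
by rewrite big1 ?addr0// => k ki; rewrite !mxE (negbTE ki) !(mul0r, mulr0).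
Qed.

Lemma qform_bound A (x : 'cV[R]_n) : `|x| <= 1 -> `|qform A x| <= n%:R ^+ 2 * `|A|.
Proof.
move=> x1; apply: (le_trans (mx_norm_entry _ ord0 ord0)).
apply: (le_trans (mx_norm_mul _ _)).
have xT : `|x^T| <= 1.
  apply: mx_norm_le => // i j; rewrite mxE.
  exact: le_trans (mx_norm_entry _ _ _) x1.
have H : `|x^T *m A| <= n%:R * `|A|.
  apply: (le_trans (mx_norm_mul _ _)).
  by rewrite -mulrA ler_wpM2l// -[leRHS]mul1r ler_wpM2r.
rewrite expr2 -!mulrA ler_wpM2l// -[leRHS]mulr1 ler_pM//.
Qed.

Lemma qform_decmx_ge D (al : R) x : orthogonalmx D.1 -> (forall i, al <= D.2 ord0 i) ->
  al * (x^T *m x) ord0 ord0 <= qform (decmx D) x.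
Proof.
move=> oD ald; pose y := D.1^T *m x.
have -> : x^T *m x = y^T *m y.
  by rewrite /y trmx_mul trmxK mulmxA -(mulmxA x^T) oD mulmx1.
have -> : qform (decmx D) x = (y^T *m diag_mx D.2 *m y) ord0 ord0.
  by rewrite /qform /decmx /y trmx_mul trmxK !mulmxA.
rewrite mul_mx_diag mxE [leRHS]mxE mulr_sumr; apply: ler_sum => k _.
rewrite !mxE (mulrC _ (D.2 _ _)) -mulrA ler_wpM2r// -expr2 sqr_ge0//.
Qed.

Lemma decmx_spectral S D : is_spectral_dec S D.1 D.2 -> S = decmx D.
Proof. by case. Qed.

Lemma SPD_spectral_dec S : SPD S -> exists D, is_spectral_dec S D.1 D.2.
Proof.
move=> [symS pS]; have [P [d [oP SE]]] := spectral_theorem symS.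
exists (P, d); split => //= i.
have := @qform_col (P, d) i oP; rewrite /= => <-.
rewrite /qform -[decmx _]SE; apply: pS.
apply/negP => /eqP c0; have := @qform_col (P, const_mx 1) i oP.
rewrite /qform /= c0 mulmx0 !mxE => /eqP.
by rewrite eq_sym oner_eq0.
Qed.

Lemma spectral_decP S : SPD S ->
  is_spectral_dec S (spectral_dec S).1 (spectral_dec S).2.
Proof.
move=> /SPD_spectral_dec[D HD].
exact: (@xgetPex _ (1%:M, 0) [set Pd | is_spectral_dec S Pd.1 Pd.2]
  (ex_intro _ D HD)).
Qed.

Lemma spectral_SPD S P (d : 'rV[R]_n) : is_spectral_dec S P d -> SPD S.
Proof. by move=> [oP d0 ->]; exact: (@decmx_SPD (P, d)). Qed.

Definition dec_in (al be : R) D :=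
  orthogonalmx D.1 /\ forall i, al <= D.2 ord0 i <= be.

(** Eigenvalues are values of the quadratic form at unit eigenvectors, so they
    move by at most a constant times the norm of the perturbation.  They remain
    in a compact interval of the half-line, on which derivatives are bounded. *)
Lemma SPD_window S : SPD S -> exists (al be de : R),
  [/\ 0 < al, 0 < de & forall A, Sym A -> `|A - S| < de ->
    SPD A /\ forall D, orthogonalmx D.1 -> A = decmx D -> dec_in al be D].
Proof.
move=> /SPD_spectral_dec[D0 [oD0 d0 SE]].
pose a0 : R := \big[Num.min/1]_(i < n) D0.2 ord0 i.
have a00 : 0 < a0 by apply: lt_bigmin => // i _; exact: d0.
have a0le i : a0 <= D0.2 ord0 i by exact: bigmin_le_cond.
pose N : R := n%:R ^+ 2 + 1.
have N0 : 0 < N by rewrite /N ltr_wpDl// sqr_ge0.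
pose de := a0 / 2 / N.
have de0 : 0 < de by rewrite !divr_gt0.
exists (a0 / 2), (N * (`|S| + de)), de; split => //; first by rewrite divr_gt0.
move=> A symA AS.
have K D : orthogonalmx D.1 -> A = decmx D -> dec_in (a0 / 2) (N * (`|S| + de)) D.
  move=> oD AE; split => // i.
  have x1 : `|col i D.1| <= 1.
    by apply: mx_norm_le => // a b; rewrite mxE orthogonalmx_entry.
  have xx : ((col i D.1)^T *m col i D.1) ord0 ord0 = 1.
    have := @qform_col (D.1, const_mx 1) i oD.
    by rewrite /qform /decmx /= diag_const_mx mulmx1 oD mulmx1 [in RHS]mxE.
  have -> : D.2 ord0 i = qform A (col i D.1) by rewrite AE qform_col.
  have NA (M : 'M[R]_n) : n%:R ^+ 2 * `|M| <= N * `|M|.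
    by rewrite ler_wpM2r// /N lerDl.
  apply/andP; split.
    have E : qform A (col i D.1) = qform S (col i D.1) + qform (A - S) (col i D.1).
      by rewrite -qformD addrC subrK.
    have H1 : a0 <= qform S (col i D.1).
      have := @qform_decmx_ge D0 a0 (col i D.1) oD0 a0le.
      by rewrite xx mulr1 -[decmx D0]SE.
    have H2 := qform_bound (A - S) x1.
    have H3 : n%:R ^+ 2 * `|A - S| <= a0 / 2.
      apply: (le_trans (NA _)); rewrite mulrC -ler_pdivlMr//.
      exact: ltW.
    move: H2; rewrite E ler_norml => /andP[H2 _].
    rewrite -[X in X <= _](addrK (a0 / 2)) -splitr lerD// (le_trans _ H2)//.
    by rewrite lerN2.
  apply: (le_trans (ler_norm _)); apply: (le_trans (qform_bound _ x1)).
  apply: (le_trans (NA _)); rewrite ler_pM2l//.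
  by rewrite -[A](subrK S) addrC (le_trans (ler_normD _ _))// lerD2l ltW.
split; last exact: K.
have [P [d [oP AE]]] := spectral_theorem symA.
rewrite AE; apply: (@decmx_SPD (P, d)) => //= i.
have [_ /(_ i)/andP[+ _]] := K (P, d) oP AE.
by apply: lt_le_trans; rewrite divr_gt0.
Qed.

End Decompositions.

(** * Multiple operator sums *)

Section MultipleOperatorSums.
Variables (R : realType) (n : nat).
Notation dec := ('M[R]_n * 'rV[R]_n)%type.
Implicit Types (D E A B : dec) (f g h : R -> R) (X Y H : 'M[R]_n).
Implicit Types (s : seq ('M[R]_n * dec)) (t : seq ('M[R]_n * (dec * dec))).
Implicit Types (Xs : seq 'M[R]_n).

Definition pos_dec D := orthogonalmx D.1 /\ forall i, 0 < D.2 ord0 i.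

(** The sum of f[a_i,b_j,..,c_l] p_i X q_j .. Y r_l over all indices, for the
    spectral projectors p_i, q_j, .., r_l of the given decompositions.  Freezing
    a_i leaves a sum of the same kind for the function f[.,a_i]. *)
Fixpoint multop f D s : 'M[R]_n :=
  if s is (X, D') :: s' then
    \sum_i eigproj D i *m X *m multop (dd1 f ^~ (D.2 ord0 i)) D' s'
  else \sum_i f (D.2 ord0 i) *: eigproj D i.

Fixpoint all_dec (P : dec -> Prop) s : Prop :=
  if s is p :: s' then P p.2 /\ all_dec P s' else True.

Lemma multop_linear (c : R) f g h D s :
  smooth_pos f -> smooth_pos g -> smooth_pos h -> pos_dec D -> all_dec pos_dec s ->
  (forall x, 0 < x -> c * h x = f x - g x) ->
  c *: multop h D s = multop f D s - multop g D s.
Proof.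
elim: s f g h D => [|[X D'] s IH] f g h D sf sg sh [oD pD] /=.
  move=> _ E; rewrite -sumrB scaler_sumr; apply: eq_bigr => i _.
  by rewrite scalerA E// scalerBl.
move=> [pD' ps] E; rewrite -sumrB scaler_sumr; apply: eq_bigr => i _.
rewrite -mulmxBr scalemxAr; congr (_ *m _).
have di := pD i.
apply: (IH _ _ _ _ (smooth_pos_dd1 sf di) (smooth_pos_dd1 sg di)
  (smooth_pos_dd1 sh di) pD' ps) => x x0.
exact: dd1_linear.
Qed.

(** Because p_i (A - B) q_j = (a_i - b_j) p_i q_j, and the projectors of A and
    those of B sum to the identity. *)
Lemma eigproj_telescope A B (Phi Psi : 'I_n -> 'M[R]_n) (Xi : 'I_n -> 'I_n -> 'M[R]_n) :
  orthogonalmx A.1 -> orthogonalmx B.1 ->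
  (forall i j, (A.2 ord0 i - B.2 ord0 j) *: Xi i j = Phi i - Psi j) ->
  \sum_i eigproj A i *m (decmx A - decmx B) *m \sum_j eigproj B j *m Xi i j =
  \sum_i eigproj A i *m Phi i - \sum_j eigproj B j *m Psi j.
Proof.
move=> oA oB E.
have L : \sum_i eigproj A i *m Phi i =
    \sum_i \sum_j eigproj A i *m eigproj B j *m Phi i.
  apply: eq_bigr => i _; rewrite -mulmx_suml -mulmx_sumr sum_eigproj// mulmx1//.
have L' : \sum_j eigproj B j *m Psi j =
    \sum_i \sum_j eigproj A i *m eigproj B j *m Psi j.
  rewrite exchange_big; apply: eq_bigr => j _.
  by rewrite -!mulmx_suml sum_eigproj// mul1mx.
rewrite L L' -sumrB; apply: eq_bigr => i _.
rewrite -sumrB mulmx_sumr; apply: eq_bigr => j _.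
have -> : eigproj A i *m (decmx A - decmx B) *m (eigproj B j *m Xi i j) =
    (A.2 ord0 i - B.2 ord0 j) *: (eigproj A i *m eigproj B j) *m Xi i j.
  rewrite mulmxA mulmxBr [(_ - _) *m eigproj B j]mulmxBl eigproj_decmx//.
  congr (_ *m _).
  by rewrite -scalemxAl -(mulmxA _ (decmx B)) decmx_eigproj// -scalemxAr -scalerBl.
by rewrite -scalemxAl scalemxAr E mulmxBr.
Qed.

(** Changing one matrix inserts the difference of the two matrices: this is
    f(A) - f(B) = sum f^[1](a_i,b_j) p_i (A - B) q_j in the base case, and the
    recurrence of divided differences in general. *)
Lemma multop_change f A B s : smooth_pos f -> pos_dec A -> pos_dec B ->
  all_dec pos_dec s ->
  multop f A s - multop f B s = multop f A ((decmx A - decmx B, B) :: s).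
Proof.
move=> sf [oA pA] [oB pB]; case: s => [|[X D] s].
  move=> _ /=; apply/esym.
  have := @eigproj_telescope A B (fun i => (f (A.2 ord0 i))%:M)
    (fun j => (f (B.2 ord0 j))%:M)
    (fun i j => (dd1 f (B.2 ord0 j) (A.2 ord0 i))%:M) oA oB.
  have K D (c : 'I_n -> R) : \sum_j eigproj D j *m (c j)%:M = \sum_j c j *: eigproj D j.
    by apply: eq_bigr => j _; rewrite mul_mx_scalar.
  rewrite !K => <- => [|i j]; first by apply: eq_bigr => i _; rewrite K.
  by rewrite scale_scalar_mx dd1C dd1_mul raddfB.
move=> [pD ps] /=; apply/esym.
have := @eigproj_telescope A B
    (fun i => X *m multop (dd1 f ^~ (A.2 ord0 i)) D s)
    (fun j => X *m multop (dd1 f ^~ (B.2 ord0 j)) D s)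
    (fun i j => X *m multop (dd1 (dd1 f ^~ (A.2 ord0 i)) ^~ (B.2 ord0 j)) D s) oA oB.
have K D' (c : 'I_n -> 'M[R]_n) :
    \sum_j eigproj D' j *m (X *m c j) = \sum_j eigproj D' j *m X *m c j.
  by apply: eq_bigr => j _; rewrite mulmxA.
rewrite !K => <- => [|i j]; first by apply: eq_bigr => i _; rewrite K.
have ai := pA i; have bj := pB j.
rewrite scalemxAr -mulmxBr; congr (_ *m _).
have sa := smooth_pos_dd1 sf ai; have sb := smooth_pos_dd1 sf bj.
apply: (multop_linear sa sb (smooth_pos_dd1 sa bj) pD ps) => x x0.
exact: dd1_dd1.
Qed.

(** The powers of n account for the entrywise norm of a product and for the
    number of projectors. *)
Definition op_bound Xs : R := foldr (fun X c => n%:R ^+ 3 * `|X| * c) n%:R Xs.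

Fixpoint lip_bound Xs : R :=
  if Xs is X :: Xs' then n%:R ^+ 3 * `|X| * lip_bound Xs' + n%:R ^+ 3 * op_bound Xs
  else n%:R ^+ 3 * n%:R.

Lemma op_bound_ge0 Xs : 0 <= op_bound Xs.
Proof. by elim: Xs => //= X Xs IH; rewrite !mulr_ge0. Qed.

Lemma lip_bound_ge0 Xs : 0 <= lip_bound Xs.
Proof.
elim: Xs => [|X Xs IH] /=; first by rewrite mulr_ge0.
by rewrite addr_ge0 ?mulr_ge0// op_bound_ge0.
Qed.

Lemma sum_norm_le (F : 'I_n -> 'M[R]_n) (c : R) : (forall i, `|F i| <= c) ->
  `|\sum_i F i| <= n%:R * c.
Proof.
move=> H; apply: (le_trans (ler_norm_sum _ _ _)).
by rewrite mulr_natl -[X in _ *+ X]card_ord -sumr_const ler_sum.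
Qed.

Lemma sandwich_norm_le D X (W : 'I_n -> 'M[R]_n) (c : R) : orthogonalmx D.1 ->
  (forall i, `|W i| <= c) ->
  `|\sum_i eigproj D i *m X *m W i| <= n%:R ^+ 3 * `|X| * c.
Proof.
move=> oD H; rewrite exprS -!mulrA; apply: sum_norm_le => i.
apply: (le_trans (mx_norm_mul _ _)).
have H1 : `|eigproj D i *m X| <= n%:R * `|X|.
  apply: (le_trans (mx_norm_mul _ _)).
  by rewrite -mulrA ler_wpM2l// -[leRHS]mul1r ler_wpM2r// eigproj_norm.
by rewrite -!mulrA ler_wpM2l// mulrA ler_pM.
Qed.

Lemma dec_in_pos (al be : R) D : 0 < al -> dec_in al be D -> pos_dec D.
Proof.
move=> al0 [oD H]; split => // i; have /andP[+ _] := H i.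
exact: lt_le_trans.
Qed.

Lemma all_decW (P Q : dec -> Prop) s : (forall D, P D -> Q D) ->
  all_dec P s -> all_dec Q s.
Proof. by move=> PQ; elim: s => //= p s IH [/PQ ? /IH]. Qed.

Lemma multop_bound (al be M : R) f D s : smooth_pos f -> 0 < al -> 0 <= M ->
  dec_in al be D -> all_dec (dec_in al be) s ->
  deriv_bound f (size s) al be M ->
  `|multop f D s| <= op_bound [seq p.1 | p <- s] * M.
Proof.
move=> + al0 M0; elim: s f D => [|[X D'] s IH] f D sf HD /= Hs HM.
  apply: sum_norm_le => i; rewrite normrZ -[leRHS]mulr1.
  have [oD Hd] := HD.
  by apply: ler_pM => //; [exact: (HM 0%N)|exact: eigproj_norm].
have [oD Hd] := HD; rewrite -(mulrA (_ * `|X|)).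
apply: (@sandwich_norm_le D X (fun i => multop (dd1 f ^~ (D.2 ord0 i)) D' s)) => // i.
have [_ /(_ i) di] := dec_in_pos al0 HD.
exact: (IH _ _ (smooth_pos_dd1 sf di) Hs.1 Hs.2 (deriv_bound_dd1 sf al0 (Hd i) HM)).
Qed.

(** In t, each matrix carries two decompositions, to be compared. *)
Definition lefts t : seq ('M[R]_n * dec) := [seq (p.1, p.2.1) | p <- t].
Definition rights t : seq ('M[R]_n * dec) := [seq (p.1, p.2.2) | p <- t].

Fixpoint all_close (al be e : R) t : Prop :=
  if t is p :: t' then
    [/\ dec_in al be p.2.1, dec_in al be p.2.2,
        `|decmx p.2.1 - decmx p.2.2| <= e & all_close al be e t']
  else True.

Lemma all_close_right al be e t : all_close al be e t -> all_dec (dec_in al be) (rights t).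
Proof. by elim: t => //= p t IH [_ ? _ /IH]. Qed.

Lemma rearrange_le (k x c M e : R) : 0 <= k -> 0 <= c -> 0 <= M -> x <= e ->
  k * x * c * M <= k * c * M * e.
Proof.
move=> k0 c0 M0 xe; rewrite (_ : k * x * c * M = k * c * M * x); last by ring.
by rewrite ler_wpM2l// !mulr_ge0.
Qed.

(** The decompositions are changed one at a time; each change inserts a matrix
    of norm at most e in a sum bounded by multop_bound. *)
Lemma multop_lip (al be M e : R) f A B t : smooth_pos f -> 0 < al -> 0 <= M -> 0 <= e ->
  dec_in al be A -> dec_in al be B -> `|decmx A - decmx B| <= e ->
  all_close al be e t ->
  deriv_bound f (size t).+1 al be M ->
  `|multop f A (lefts t) - multop f B (rights t)| <=
     lip_bound [seq p.1 | p <- t] * M * e.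
Proof.
move=> + al0 M0 e0; elim: t f A B => [|[X [D D']] t IH] f A B sf HA HB AB /=.
  move=> _ HM; have pA := dec_in_pos al0 HA; have pB := dec_in_pos al0 HB.
  have := multop_change sf pA pB (s := [::]) I => /= ->.
  have := multop_bound (s := [:: (decmx A - decmx B, B)]) sf al0 M0 HA (conj HB I) HM.
  move=> /le_trans; apply => /=.
  by rewrite rearrange_le ?exprn_ge0.
move=> [HD HD' DD' Ht] HM.
have pA := dec_in_pos al0 HA; have pB := dec_in_pos al0 HB.
pose s' := (X, D') :: rights t.
have Hs' : all_dec (dec_in al be) s' by split => //; exact: all_close_right Ht.
have ps' : all_dec pos_dec s' by apply: all_decW Hs' => ?; exact: dec_in_pos.
have -> : (\sum_i eigproj A i *m X *m multop (dd1 f ^~ (A.2 ord0 i)) D (lefts t) -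
    \sum_i eigproj B i *m X *m multop (dd1 f ^~ (B.2 ord0 i)) D' (rights t)) =
  (\sum_i eigproj A i *m X *m (multop (dd1 f ^~ (A.2 ord0 i)) D (lefts t)
      - multop (dd1 f ^~ (A.2 ord0 i)) D' (rights t)))
   + (multop f A s' - multop f B s').
  rewrite /= addrA; congr (_ - _).
  by rewrite -big_split /=; apply: eq_bigr => i _; rewrite -mulmxDr subrK.
rewrite multop_change//.
apply: (le_trans (ler_normD _ _)); rewrite !mulrDl; apply: lerD.
  have [oA HA'] := HA.
  rewrite -!(mulrA (_ * `|X|)).
  apply: (@sandwich_norm_le A X (fun i => multop (dd1 f ^~ (A.2 ord0 i)) D (lefts t)
      - multop (dd1 f ^~ (A.2 ord0 i)) D' (rights t))) => // i.
  have [_ /(_ i) ai] := pA.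
  exact: (IH _ _ _ (smooth_pos_dd1 sf ai) HD HD' DD' Ht
    (deriv_bound_dd1 sf al0 (HA' i) HM)).
have Hb : all_dec (dec_in al be) ((decmx A - decmx B, B) :: s') by [].
have := multop_bound sf al0 M0 HA Hb.
rewrite /= size_map => /(_ HM)/le_trans; apply.
rewrite /rights -map_comp /comp/=.
set c := n%:R ^+ 3 * `|X| * foldr _ _ _.
have c0 : 0 <= c by rewrite /c !mulr_ge0// op_bound_ge0.
by rewrite rearrange_le ?exprn_ge0.
Qed.
End MultipleOperatorSums.

(** * Differential calculus on SPD(n) *)

Section CkCalculus.
Variables (R : realType) (n : nat).
Implicit Types (S X Y A : 'M[R]_n).

Lemma SymD X Y : Sym X -> Sym Y -> Sym (X + Y).
Proof. by rewrite /Sym/= => sX sY; rewrite linearD/= sX sY. Qed.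

Lemma SymZ c X : Sym X -> Sym (c *: X).
Proof. by rewrite /Sym/= => sX; rewrite linearZ/= sX. Qed.

Lemma Sym0 : Sym (0 : 'M[R]_n).
Proof. by rewrite /Sym/= trmx0. Qed.

Lemma Sym_sum (I : Type) (r : seq I) (P : pred I) (F : I -> 'M[R]_n) :
  (forall i, P i -> Sym (F i)) -> Sym (\sum_(i <- r | P i) F i).
Proof. by move=> H; apply: big_ind => //; [exact: Sym0|exact: SymD]. Qed.

Lemma SPD_open S : SPD S -> exists2 d : R, 0 < d &
  forall A, Sym A -> `|A - S| < d -> SPD A.
Proof. by case/SPD_window => al [be [de [_ d0 H]]]; exists de => // A sA /H[]. Qed.

Lemma SPD_line S X : SPD S -> Sym X -> exists2 d : R, 0 < d &
  forall h : R, `|h| < d -> SPD (h *: X + S).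
Proof.
move=> pS sX; have [d d0 H] := SPD_open pS.
exists (d / (`|X| + 1)); first by rewrite divr_gt0// ltr_wpDl.
move=> h hd; apply: H; first by apply: SymD; [exact: SymZ|case: pS].
rewrite addrK normrZ.
have : `|h| * (`|X| + 1) < d by rewrite -ltr_pdivlMr// ltr_wpDl.
by apply: le_lt_trans; rewrite ler_wpM2l// lerDl.
Qed.

Lemma within_SPDP (V : normedModType R) (F : 'M[R]_n -> V) :
  {within @SPD R n, continuous F} <->
  forall S, SPD S -> forall e : R, 0 < e -> exists2 d : R, 0 < d &
    forall A, SPD A -> `|A - S| < d -> `|F A - F S| <= e.
Proof.
rewrite subspace_continuousP; split=> H S pS.
  move=> e e0; have /cvgrPdist_le/(_ e e0) := H S pS.
  rewrite near_withinE => /nbhs_ballP[d /= d0 Hd].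
  by exists d => // A pA AS; rewrite distrC; apply: Hd => //; rewrite -ball_normE/= distrC.
apply/cvgrPdist_le => e e0; have [d d0 Hd] := H S pS e e0.
rewrite near_withinE; apply/nbhs_ballP; exists d => //= A.
by rewrite -ball_normE/= => AS pA; rewrite distrC; apply: Hd => //; rewrite distrC.
Qed.

Lemma is_derive_SPD_ext (V : normedModType R) (F G : 'M[R]_n -> V) S X l :
  SPD S -> Sym X -> (forall A, SPD A -> F A = G A) ->
  is_derive S X F l -> is_derive S X G l.
Proof.
move=> pS sX FG /is_derive_epsP H; apply/is_derive_epsP => e /H[d d0 Hd].
have [d' d'0 Hd'] := SPD_line pS sX.
exists (Num.min d d'); first by rewrite lt_min d0.
move=> h h0; rewrite lt_min => /andP[h1 h2].
by rewrite -!FG//; [exact: Hd|exact: Hd'].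
Qed.

Lemma derive_SPD_ext (V : normedModType R) (F G : 'M[R]_n -> V) S X :
  SPD S -> Sym X -> (forall A, SPD A -> F A = G A) -> 'D_X G S = 'D_X F S.
Proof.
move=> pS sX FG; have [d d0 Hd] := SPD_line pS sX.
have E : \forall h \near (0 : R)^',
    h^-1 *: ((F \o shift S) (h *: X) - F S) = h^-1 *: ((G \o shift S) (h *: X) - G S).
  rewrite near_withinE; apply/nbhs_ballP; exists d => //= h.
  rewrite /ball /= sub0r normrN => hd _.
  by rewrite !FG//; exact: Hd.
rewrite /derive; congr lim; rewrite eqEsubset; split; apply: near_eq_cvg => //.
by near=> h; apply/esym; near: h.
Unshelve. all: by end_near. Qed.

Lemma Ck_ext (V : normedModType R) k (F G : 'M[R]_n -> V) :
  (forall S, SPD S -> F S = G S) -> Ck k F -> Ck k G.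
Proof.
have cont (F' G' : 'M[R]_n -> V) : (forall S, SPD S -> F' S = G' S) ->
    {within @SPD R n, continuous F'} -> {within @SPD R n, continuous G'}.
  move=> FG; rewrite !within_SPDP => H S pS e /(H S pS)[d d0 Hd].
  by exists d => // A pA; rewrite -!FG//; exact: Hd.
elim: k F G => [|k IH] F G FG [cF H]; split => //; try exact: cont cF.
move=> X sX; have [dF DF] := H X sX; split.
  move=> S pS; have /derivableP dFS := dF S pS.
  by have [] := is_derive_SPD_ext pS sX FG dFS.
by apply: IH DF => S pS; rewrite (derive_SPD_ext pS sX FG).
Qed.

Lemma CkW (V : normedModType R) k (F : 'M[R]_n -> V) : Ck k.+1 F -> Ck k F.
Proof.
elim: k F => [|k IH] F [cF H]; split => // X sX.
by have [dF /IH DF] := H X sX.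
Qed.

Lemma Ck_continuous (V : normedModType R) k (F : 'M[R]_n -> V) :
  Ck k F -> {within @SPD R n, continuous F}.
Proof. by case: k => [|k] []. Qed.

Lemma Ck_derivable (V : normedModType R) k (F : 'M[R]_n -> V) S X :
  Ck k.+1 F -> SPD S -> Sym X -> derivable F S X.
Proof. by move=> [_ /(_ X)] H pS /H[+ _]; apply. Qed.

Lemma Ck_derive (V : normedModType R) k (F : 'M[R]_n -> V) X :
  Ck k.+1 F -> Sym X -> Ck k (fun S => 'D_X F S).
Proof. by move=> [_ H] /H[]. Qed.

Lemma Ck_cst (V : normedModType R) k (c : V) : Ck k (fun _ : 'M[R]_n => c).
Proof.
elim: k c => [|k IH] c; split => //;
  try by apply: continuous_subspaceT => ?; exact: cst_continuous.
move=> X sX; split => [S _|]; first exact: derivable_cst.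
apply: Ck_ext (IH 0) => S _.
by rewrite (derive_cst c S X).
Qed.

Lemma CkD (V : normedModType R) k (F G : 'M[R]_n -> V) :
  Ck k F -> Ck k G -> Ck k (fun S => F S + G S).
Proof.
have cont (F' G' : 'M[R]_n -> V) : {within @SPD R n, continuous F'} ->
    {within @SPD R n, continuous G'} ->
    {within @SPD R n, continuous (fun S => F' S + G' S)}.
  rewrite !subspace_continuousP => cF cG S pS.
  by apply: cvgD; [exact: cF|exact: cG].
elim: k F G => [|k IH] F G HF HG; split => //;
  try exact: cont (Ck_continuous HF) (Ck_continuous HG).
move=> X sX; split => [S pS|].
  by apply: derivableD; [exact: Ck_derivable HF _ _|exact: Ck_derivable HG _ _].
apply: Ck_ext (IH _ _ (Ck_derive HF sX) (Ck_derive HG sX)) => S pS.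
by rewrite -deriveD//; [exact: Ck_derivable HF _ _|exact: Ck_derivable HG _ _].
Qed.

Lemma CkM k (F G : 'M[R]_n -> R) :
  Ck k F -> Ck k G -> Ck k (fun S => F S * G S).
Proof.
have cont (F' G' : 'M[R]_n -> R) : {within @SPD R n, continuous F'} ->
    {within @SPD R n, continuous G'} ->
    {within @SPD R n, continuous (fun S => F' S * G' S)}.
  rewrite !subspace_continuousP => cF cG S pS.
  by apply: cvgM; [exact: cF|exact: cG].
elim: k F G => [|k IH] F G HF HG; split => //;
  try exact: cont (Ck_continuous HF) (Ck_continuous HG).
move=> X sX; split => [S pS|].
  by apply: derivableM; [exact: Ck_derivable HF _ _|exact: Ck_derivable HG _ _].
apply: Ck_ext (CkD (IH _ _ (CkW HF) (Ck_derive HG sX))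
                   (IH _ _ (CkW HG) (Ck_derive HF sX))) => S pS.
rewrite (@deriveM _ _ F G S X)//; [exact: Ck_derivable HF _ _|exact: Ck_derivable HG _ _].
Qed.

Lemma Ck_entry k (F : 'M[R]_n -> 'M[R]_n) i j :
  Ck k F -> Ck k (fun S => F S i j).
Proof.
have cont (F' : 'M[R]_n -> 'M[R]_n) : {within @SPD R n, continuous F'} ->
    {within @SPD R n, continuous (fun S => F' S i j)}.
  rewrite !within_SPDP => cF S pS e /(cF S pS)[d d0 Hd].
  exists d => // A pA /(Hd _ pA); apply: le_trans.
  by have := mx_norm_entry (F' A - F' S) i j; rewrite !mxE.
elim: k F => [|k IH] F HF; split => //; try exact: cont (Ck_continuous HF).
move=> X sX; split => [S pS|].
  by have /derivable_mxP := Ck_derivable HF pS sX; apply.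
apply: Ck_ext (IH _ (Ck_derive HF sX)) => S pS.
by rewrite derive_mx ?mxE//; exact: Ck_derivable HF _ _.
Qed.

Lemma Ck_entries k (F : 'M[R]_n -> 'M[R]_n) :
  (forall i j, Ck k (fun S => F S i j)) -> Ck k F.
Proof.
have cont (F' : 'M[R]_n -> 'M[R]_n) :
    (forall i j, {within @SPD R n, continuous (fun S => F' S i j)}) ->
    {within @SPD R n, continuous F'}.
  move=> cF; rewrite subspace_continuousP => S pS; apply/cvgrPdist_le => e e0.
  have cF' i j : (fun S => F' S i j) @ within (@SPD R n) (nbhs S) --> F' S i j.
    by have := cF i j; rewrite subspace_continuousP; apply.
  near=> A; apply: mx_norm_le; first exact: ltW.
  move=> i j; rewrite !mxE.
  move: i j; near: A; apply: filter_forall => i; apply: filter_forall => j.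
  by move/cvgrPdist_le: (cF' i j); apply.
elim: k F => [|k IH] F HF; split => //;
  try by apply: cont => i j; exact: Ck_continuous (HF i j).
move=> X sX; have dF S : SPD S -> derivable F S X.
  by move=> pS; apply/derivable_mxP => i j; exact: Ck_derivable (HF i j) _ _.
split => //; apply: IH => i j.
apply: Ck_ext (Ck_derive (HF i j) sX) => S pS.
by rewrite derive_mx ?mxE//; exact: dF.
Unshelve. all: by end_near. Qed.

Lemma Ck_scale k (f : 'M[R]_n -> R) (F : 'M[R]_n -> 'M[R]_n) :
  Ck k f -> Ck k F -> Ck k (fun S => f S *: F S).
Proof.
move=> Hf HF; apply: Ck_entries => i j.
by apply: Ck_ext (CkM Hf (Ck_entry i j HF)) => S _; rewrite mxE.
Qed.

Lemma Ck_sum (V : normedModType R) k (I : Type) (r : seq I) (F : I -> 'M[R]_n -> V) :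
  (forall i, Ck k (F i)) -> Ck k (fun S => \sum_(i <- r) F i S).
Proof.
move=> H; elim: r => [|i r IH].
  by apply: Ck_ext (Ck_cst k 0) => S _; rewrite big_nil.
by apply: Ck_ext (CkD (H i) IH) => S _; rewrite big_cons.
Qed.

End CkCalculus.

Section DirectionalDerivatives.
Variables (R : realType) (n : nat).
Implicit Types (S X Y A : 'M[R]_n).

Lemma MVT_origin (phi dphi : R -> R) (h : R) :
  (forall t : R, `|t| <= `|h| -> is_derive t 1 phi (dphi t)) ->
  exists2 c : R, `|c| <= `|h| & phi h - phi 0 = h * dphi c.
Proof.
move=> dP; have [h0|h0|->] := ltgtP h 0; last first.
- by exists 0; rewrite // subrr mul0r.
- have Hn t : t \in `[0, h]%R -> `|t| <= `|h|.
    by rewrite in_itv/= => /andP[t0 th]; rewrite !ger0_norm// ltW.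
  have [||c cI E] := @MVT _ phi dphi 0 h h0.
  + by move=> x xI; apply: dP; apply: Hn; exact: subset_itv_oo_cc xI.
  + apply: derivable_within_continuous => x xI.
    by have [] := dP x (Hn x xI).
  + exists c; first by apply: Hn; exact: subset_itv_oo_cc cI.
    by rewrite E subr0 mulrC.
- have Hn t : t \in `[h, 0]%R -> `|t| <= `|h|.
    by rewrite in_itv/= => /andP[t0 th]; rewrite !ler0_norm ?lerN2// ltW.
  have [||c cI E] := @MVT _ phi dphi h 0 h0.
  + by move=> x xI; apply: dP; apply: Hn; exact: subset_itv_oo_cc xI.
  + apply: derivable_within_continuous => x xI.
    by have [] := dP x (Hn x xI).
  + exists c; first by apply: Hn; exact: subset_itv_oo_cc cI.
    by rewrite -opprB E sub0r mulrN opprK mulrC.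
Qed.

Lemma is_derive_line (V : normedModType R) (F : 'M[R]_n -> V) A X (t : R) :
  derivable F (t *: X + A) X ->
  is_derive t 1 (fun t => F (t *: X + A)) ('D_X F (t *: X + A)).
Proof.
move=> /derivableP/is_derive_epsP H; apply/is_derive_epsP => e /H[d d0 Hd].
exists d => // h h0 hd; have := Hd h h0 hd.
by rewrite scaler1 scalerDl addrA.
Qed.

Lemma SPD_plane S X Y (e : R) : SPD S -> Sym X -> Sym Y -> 0 < e ->
  exists2 d : R, 0 < d & forall s t : R, `|s| <= d -> `|t| <= d ->
    SPD (s *: X + (t *: Y + S)) /\ `|s *: X + (t *: Y + S) - S| < e.
Proof.
move=> pS sX sY e0; have [r r0 Hr] := SPD_open pS.
pose m := Num.min r e; have m0 : 0 < m by rewrite lt_min r0.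
pose N := `|X| + `|Y| + 1; have N0 : 0 < N by rewrite ltr_wpDl// addr_ge0.
exists (m / N / 2); first by rewrite !divr_gt0.
move=> s t sd td.
have H : `|s *: X + (t *: Y + S) - S| < m.
  rewrite addrA addrK; apply: (le_lt_trans (ler_normD _ _)); rewrite !normrZ.
  apply: (@le_lt_trans _ _ (m / N / 2 * N)); last first.
    by rewrite mulrAC divfK ?gt_eqF// gtr_pMr// invf_lt1// ltr1n.
  apply: (@le_trans _ _ (m / N / 2 * `|X| + m / N / 2 * `|Y|)).
    by rewrite lerD// ler_wpM2r.
  by rewrite -mulrDr ler_wpM2l ?lerDl// !divr_ge0// ltW.
split; last by apply: (lt_le_trans H); rewrite ge_min lexx orbT.
apply: Hr; last by apply: (lt_le_trans H); rewrite ge_min lexx.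
by apply: SymD; [exact: SymZ|apply: SymD; [exact: SymZ|case: pS]].
Qed.

Lemma norm_sub_mid (p a b e : R) : `|p - a| <= e / 2 -> `|p - b| <= e / 2 ->
  `|a - b| <= e.
Proof. by rewrite !ler_norml => /andP[? ?] /andP[? ?]; apply/andP; split; lra. Qed.

(** Schwarz's theorem.  The second difference of F over a small parallelogram
    is a value of each of the two mixed derivatives at points close to S. *)
Lemma deriveC (F : 'M[R]_n -> R) S X Y : Ck 2 F -> SPD S -> Sym X -> Sym Y ->
  'D_X (fun A => 'D_Y F A) S = 'D_Y (fun A => 'D_X F A) S.
Proof.
have half X' Y' : Ck 2 F -> SPD S -> Sym X' -> Sym Y' -> forall d h : R,
    (forall s t : R, `|s| <= d -> `|t| <= d -> SPD (s *: X' + (t *: Y' + S))) ->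
    `|h| <= d -> exists s t : R, [/\ `|s| <= d, `|t| <= d &
    F (h *: X' + (h *: Y' + S)) - F (h *: X' + S) - (F (h *: Y' + S) - F S) =
    h * (h * 'D_Y' (fun A => 'D_X' F A) (s *: X' + (t *: Y' + S)))].
  move=> F2 pS sX sY d h Hd hd.
  have d0 : `|0 : R| <= d by rewrite normr0 (le_trans _ hd).
  have [|s sh E] := @MVT_origin
     (fun t => F (t *: X' + (h *: Y' + S)) - F (t *: X' + S))
     (fun t => 'D_X' F (t *: X' + (h *: Y' + S)) - 'D_X' F (t *: X' + S)) h.
    move=> t th; apply: derB; apply: is_derive_line; apply: Ck_derivable F2 _ sX.
      by apply: Hd => //; exact: le_trans hd.
    have := Hd t 0 (le_trans th hd) d0.
    by rewrite scale0r add0r.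
  have [|t th E'] := @MVT_origin (fun t => 'D_X' F (t *: Y' + (s *: X' + S)))
     (fun t => 'D_Y' (fun A => 'D_X' F A) (t *: Y' + (s *: X' + S))) h.
    move=> t th; apply: (@is_derive_line _ (fun A => 'D_X' F A)).
    apply: Ck_derivable (Ck_derive F2 sX) _ sY.
    by rewrite addrCA; apply: Hd; [exact: le_trans hd|exact: le_trans hd].
  exists s, t; split; [exact: le_trans hd|exact: le_trans hd|].
  rewrite /= !scale0r !add0r in E E'.
  by rewrite E addrCA E' [in RHS]addrCA.
move=> F2 pS sX sY; apply/eqP; rewrite -subr_eq0 -normr_le0.
apply/ler_addgt0Pr => e e0; rewrite add0r.
have e20 : 0 < e / 2 by rewrite divr_gt0.
have /within_SPDP/(_ S pS _ e20)[a a0 Ha] :=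
  Ck_continuous (Ck_derive (Ck_derive F2 sX) sY).
have /within_SPDP/(_ S pS _ e20)[b b0 Hb] :=
  Ck_continuous (Ck_derive (Ck_derive F2 sY) sX).
have ab0 : 0 < Num.min a b by rewrite lt_min a0.
have [d d0 Hd] := SPD_plane pS sX sY ab0.
have dd : `|d| <= d by rewrite ger0_norm// ltW.
have [s [t [sd td E]]] := half X Y F2 pS sX sY d d (fun s t sd td => (Hd s t sd td).1) dd.
have [|s' [t' [sd' td' E']]] := half Y X F2 pS sY sX d d _ dd.
  by move=> s' t' sd' td'; rewrite addrCA; have [] := Hd t' s' td' sd'.
have EE : 'D_Y (fun A => 'D_X F A) (s *: X + (t *: Y + S)) =
   'D_X (fun A => 'D_Y F A) (s' *: Y + (t' *: X + S)).
  apply: (mulfI (lt0r_neq0 d0)); apply: (mulfI (lt0r_neq0 d0)).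
  apply: (etrans (esym E)); apply: (etrans _ E').
  rewrite (addrCA (d *: Y) (d *: X) S).
  move: (F (d *: X + (d *: Y + S))) (F (d *: X + S)) (F (d *: Y + S)) (F S).
  by move=> p q r s0; ring.
have [p1 n1] := Hd s t sd td.
have [p2 n2] := Hd t' s' td' sd'; rewrite addrCA in p2 n2.
have H1 := Ha _ p1 (lt_le_trans n1 _).
have H2 := Hb _ p2 (lt_le_trans n2 _).
rewrite EE in H1.
apply: (norm_sub_mid (H2 _) (H1 _)); rewrite ge_min lexx ?orbT//.
Qed.

End DirectionalDerivatives.

(** * Derivatives of univariate maps *)

Section DaletskiiKrein.
Variables (R : realType) (n : nat).
Notation dec := ('M[R]_n * 'rV[R]_n)%type.
Implicit Types (D E : dec) (f g h : R -> R) (A S X Y H : 'M[R]_n).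
Implicit Types (s : seq ('M[R]_n * dec)) (t : seq ('M[R]_n * (dec * dec))).
Implicit Types (Xs : seq 'M[R]_n).

Definition with_dec D Xs : seq ('M[R]_n * dec) := [seq (X, D) | X <- Xs].

(** The places for a new direction among the former ones: each gives a term of
    the derivative of a multiple operator sum. *)
Fixpoint insertions Y Xs : seq (seq 'M[R]_n) :=
  if Xs is X :: Xs' then (Y :: Xs) :: [seq X :: L | L <- insertions Y Xs']
  else [:: [:: Y]].

(** The terms of the telescoping sum from D to E: the matrices before the
    inserted H carry D and those after it carry E.  The second component is what
    the first tends to as D tends to E. *)
Fixpoint mixed D E H Xs : seq (seq ('M[R]_n * (dec * dec))) :=
  if Xs is X :: Xs' then
    [seq (Y, (E, E)) | Y <- H :: Xs] ::
    [seq (X, (D, E)) :: t | t <- mixed D E H Xs']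
  else [:: [:: (H, (E, E))]].

Lemma map_fst_mixed D E H Xs :
  [seq [seq p.1 | p <- t] | t <- mixed D E H Xs] = insertions H Xs.
Proof.
elim: Xs => //= X Xs IH; congr cons.
  by congr [:: _, _ & _]; rewrite -map_comp map_id.
by rewrite -IH -!map_comp; apply: eq_map.
Qed.

Lemma rights_mixed D E H Xs :
  [seq rights t | t <- mixed D E H Xs] = [seq with_dec E L | L <- insertions H Xs].
Proof.
elim: Xs => //= X Xs IH; congr cons.
  by rewrite /rights /= -map_comp.
rewrite -!map_comp.
have := congr1 (map (cons (X, E))) IH; rewrite -!map_comp => E1.
by apply: etrans E1 _; exact: eq_map.
Qed.

Lemma mixed_close al be (e : R) D E H Xs t :
  0 <= e -> dec_in al be D -> dec_in al be E -> `|decmx D - decmx E| <= e ->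
  t \in mixed D E H Xs -> all_close al be e t /\ size t = (size Xs).+1.
Proof.
move=> e0 HD HE DE.
have KE Ys : all_close al be e [seq (Y, (E, E)) | Y <- Ys].
  by elim: Ys => //= Y Ys IH; split => //=; rewrite subrr normr0.
elim: Xs t => [|X Xs IH] t /=.
  by rewrite inE => /eqP ->; split => //; exact: (KE [:: H]).
rewrite inE => /orP[/eqP ->|/mapP[t' /IH[H1 H2] ->]].
  by split; [exact: (KE (H :: X :: Xs))|rewrite /= size_map].
by rewrite /= H2; split.
Qed.

Lemma multop_mixed f D E Xs : smooth_pos f -> pos_dec D -> pos_dec E ->
  multop f D (with_dec D Xs) - multop f E (with_dec E Xs) =
  \sum_(t <- mixed D E (decmx D - decmx E) Xs) multop f D (lefts t).
Proof.
move=> + pD pE; elim: Xs f => [|X Xs IH] f sf.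
  by rewrite multop_change// big_seq1.
have all_E Ys : all_dec (@pos_dec R n) (with_dec E Ys) by elim: Ys => //= Y Ys.
have -> : multop f D (with_dec D (X :: Xs)) - multop f E (with_dec E (X :: Xs)) =
  multop f D ((X, E) :: with_dec E Xs) - multop f E ((X, E) :: with_dec E Xs)
  + (multop f D (with_dec D (X :: Xs)) - multop f D ((X, E) :: with_dec E Xs)).
  by rewrite [RHS]addrC [RHS]addrA subrK.
rewrite [mixed _ _ _ _]/= big_cons big_map; congr (_ + _).
  rewrite (multop_change sf pD pE (all_E (X :: Xs))).
  by congr multop; rewrite /lefts /= -map_comp.
rewrite /= -sumrB exchange_big /=; apply: eq_bigr => i _.
have [_ /(_ i) di] := pD.
by rewrite -mulmxBr (IH _ (smooth_pos_dd1 sf di)) mulmx_sumr.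
Qed.

Lemma multop_mixedZ f D E (c : R) H Xs :
  \sum_(t <- mixed D E (c *: H) Xs) multop f D (lefts t) =
  c *: \sum_(t <- mixed D E H Xs) multop f D (lefts t).
Proof.
have hd g s : multop g D ((c *: H, E) :: s) = c *: multop g D ((H, E) :: s).
  rewrite /= scaler_sumr; apply: eq_bigr => i _.
  by rewrite -scalemxAr -scalemxAl.
elim: Xs f => [|X Xs IH] f; first by rewrite !big_seq1; exact: hd.
rewrite [mixed _ _ _ _]/= big_cons big_map [X in _ = c *: X]big_cons big_map scalerDr.
congr (_ + _); first exact: hd.
rewrite /= exchange_big [X in _ = c *: X]exchange_big scaler_sumr.
apply: eq_bigr => i _.
by rewrite -!mulmx_sumr IH scalemxAr.
Qed.

(** The derivative of umap f along Xs is the sum of these terms over the orders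
    of Xs, the formula of Daletskii and Krein. *)
Definition dkform f Xs S : 'M[R]_n :=
  multop f (spectral_dec S) (with_dec (spectral_dec S) Xs).

Lemma umap_dkform f S : umap f S = dkform f [::] S.
Proof.
rewrite /umap /dkform; case: (spectral_dec S) => P d /=.
by rewrite conj_diagE; apply: eq_bigr => i _; rewrite mxE.
Qed.

Lemma spectral_pos_dec S D : is_spectral_dec S D.1 D.2 -> pos_dec D.
Proof. by case. Qed.

(** The sums do not depend on the eigenbases: two decompositions of the same
    matrix differ by an insertion of the zero matrix. *)
Lemma dkformE f Xs S D : smooth_pos f -> is_spectral_dec S D.1 D.2 ->
  dkform f Xs S = multop f D (with_dec D Xs).
Proof.
move=> sf HD; have pS := spectral_SPD HD; have HE := spectral_decP pS.
apply/eqP; rewrite -subr_eq0 /dkform.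
rewrite multop_mixed//; try exact: spectral_pos_dec HD; try exact: spectral_pos_dec HE.
rewrite -(decmx_spectral HD) -(decmx_spectral HE) subrr.
by rewrite -[X in mixed _ _ X](scale0r 0) multop_mixedZ scale0r.
Qed.

(** The estimates involve the eigenvalues and the difference A - S, never the
    difference of the eigenbases, which need not be small. *)
Lemma dkform_lip f Xs S : smooth_pos f -> SPD S ->
  exists (C d : R), [/\ 0 <= C, 0 < d & forall A, SPD A -> `|A - S| < d ->
    forall H,
    `|\sum_(t <- mixed (spectral_dec A) (spectral_dec S) H Xs)
         multop f (spectral_dec A) (lefts t)
      - \sum_(L <- insertions H Xs) dkform f L S| <=
    (\sum_(L <- insertions H Xs) lip_bound L) * C * `|A - S|].
Proof.
move=> sf pS; have [al [be [de [al0 de0 win]]]] := SPD_window pS.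
have [M M0 HM] := deriv_bound_exists (size Xs).+2 be sf al0.
exists M, de; split => // A pA AS H.
have HA := spectral_decP pA; have HS := spectral_decP pS.
have sA : Sym A by case: pA.
have sS : Sym S by case: pS.
have wA := (win A sA AS).2 _ (let: And3 o _ _ := HA in o) (decmx_spectral HA).
have SS : `|S - S| < de by rewrite subrr normr0.
have wS := (win S sS SS).2 _ (let: And3 o _ _ := HS in o) (decmx_spectral HS).
set DA := spectral_dec A; set DS := spectral_dec S.
have -> : \sum_(L <- insertions H Xs) dkform f L S =
    \sum_(t <- mixed DA DS H Xs) multop f DS (rights t).
  have := rights_mixed DA DS H Xs.
  rewrite -(big_map (@rights R n) predT (fun s => multop f DS s)) => ->.
  by rewrite big_map.
rewrite -sumrB -(map_fst_mixed DA DS) big_map !mulr_suml.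
apply: (le_trans (ler_norm_sum _ _ _)).
rewrite big_seq [leRHS]big_seq; apply: ler_sum => t tm.
have AS' : `|decmx DA - decmx DS| <= `|A - S|.
  by rewrite -(decmx_spectral HA) -(decmx_spectral HS).
have [cl sz] := mixed_close (normr_ge0 _) wA wS AS' tm.
by apply: (multop_lip sf al0 M0 (normr_ge0 _) wA wS AS' cl); rewrite sz.
Qed.

(** By multop_mixed the difference quotient along Y is exactly the telescoping
    sum with Y inserted. *)
Theorem is_derive_dkform f Xs S Y : smooth_pos f -> SPD S -> Sym Y ->
  is_derive S Y (dkform f Xs) (\sum_(L <- insertions Y Xs) dkform f L S).
Proof.
move=> sf pS sY; apply/is_derive_epsP => e e0.
have [C [d [C0 d0 Hd]]] := dkform_lip Xs sf pS.
have [r r0 Hr] := SPD_line pS sY.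
set B := \sum_(L <- insertions Y Xs) lip_bound L.
have B0 : 0 <= B by apply: sumr_ge0 => L _; exact: lip_bound_ge0.
pose N := B * C * `|Y| + `|Y| + 1.
have N0 : 0 < N by rewrite ltr_wpDl// addr_ge0// !mulr_ge0.
exists (Num.min r (Num.min (d / N) (e / N))).
  by rewrite !lt_min r0 !divr_gt0.
move=> h h0; rewrite !lt_min => /and3P[hr hd he].
have pA := Hr h hr; set A := h *: Y + S in pA *.
have AS : A - S = h *: Y by rewrite /A addrK.
have NY : `|A - S| < d.
  rewrite AS normrZ; have : `|h| * N < d by rewrite -ltr_pdivlMr.
  apply: le_lt_trans; rewrite ler_wpM2l// /N -addrA addrCA lerDl.
  by rewrite addr_ge0// !mulr_ge0.
have HA := spectral_decP pA; have HS := spectral_decP pS.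
rewrite /dkform (multop_mixed _ sf (spectral_pos_dec HA) (spectral_pos_dec HS)).
rewrite -(decmx_spectral HA) -(decmx_spectral HS) AS multop_mixedZ.
rewrite scalerA mulVf// scale1r.
apply: (le_trans (Hd A pA NY Y)); rewrite -/B AS normrZ.
have : `|h| * N <= e by rewrite -ler_pdivlMr// ltW.
apply: le_trans; rewrite mulrCA ler_wpM2l// /N -addrA lerDl.
by rewrite addr_ge0.
Qed.

Lemma dkform_continuous f Xs : smooth_pos f ->
  {within @SPD R n, continuous (dkform f Xs)}.
Proof.
move=> sf; apply/within_SPDP => S pS e e0.
have [al [be [de [al0 de0 win]]]] := SPD_window pS.
have [M M0 HM] := deriv_bound_exists (size Xs).+1 be sf al0.
pose N := lip_bound Xs * M + 1.
have N0 : 0 < N by rewrite ltr_wpDl// mulr_ge0// lip_bound_ge0.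
exists (Num.min de (e / N)); first by rewrite lt_min de0 divr_gt0.
move=> A pA; rewrite lt_min => /andP[AS ASe].
have HA := spectral_decP pA; have HS := spectral_decP pS.
have sA : Sym A by case: pA.
have sS : Sym S by case: pS.
have wA := (win A sA AS).2 _ (let: And3 o _ _ := HA in o) (decmx_spectral HA).
have SS : `|S - S| < de by rewrite subrr normr0.
have wS := (win S sS SS).2 _ (let: And3 o _ _ := HS in o) (decmx_spectral HS).
have AS' : `|decmx (spectral_dec A) - decmx (spectral_dec S)| <= `|A - S|.
  by rewrite -(decmx_spectral HA) -(decmx_spectral HS).
pose t := [seq (X, (spectral_dec A, spectral_dec S)) | X <- Xs].
have cl : all_close al be `|A - S| t.
  by rewrite /t; elim: (Xs) => //= X Ys IH; split.
have := multop_lip sf al0 M0 (normr_ge0 _) wA wS AS' cl.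
rewrite /t size_map => /(_ HM).
rewrite /lefts /rights -!map_comp /comp /= map_id => /le_trans; apply.
have : `|A - S| * N <= e by rewrite -ler_pdivlMr// ltW.
by apply: le_trans; rewrite mulrC ler_wpM2l// lerDl.
Qed.

Lemma dkforms_continuous f (Ls : seq (seq 'M[R]_n)) : smooth_pos f ->
  {within @SPD R n, continuous (fun S => \sum_(L <- Ls) dkform f L S)}.
Proof.
move=> sf; apply: (@Ck_continuous _ _ _ 0).
elim: Ls => [|L Ls IH].
  by apply: (@Ck_ext _ _ _ _ (fun=> 0)) => [S _|]; [rewrite big_nil|exact: Ck_cst].
have H1 : Ck 0 (dkform f L) by split => //; exact: dkform_continuous.
by apply: (Ck_ext _ (CkD H1 IH)) => S _; rewrite big_cons.
Qed.

(** Sums over lists of directions are stable under differentiation, by one more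
    insertion. *)
Lemma Ck_dkforms f (Ls : seq (seq 'M[R]_n)) k : smooth_pos f ->
  Ck k (fun S => \sum_(L <- Ls) dkform f L S).
Proof.
move=> sf; elim: k Ls => [|k IH] Ls; split; try exact: dkforms_continuous.
  by [].
move=> X sX.
have dV S : SPD S -> is_derive S X (fun S => \sum_(L <- Ls) dkform f L S)
    (\sum_(L <- flatten [seq insertions X L | L <- Ls]) dkform f L S).
  move=> pS; elim: (Ls) => [|L Ks IHL].
    rewrite big_nil; apply: (is_derive_SPD_ext pS sX _ (is_derive_cst (0 : 'M[R]_n) S X)).
    by move=> A _; rewrite big_nil.
  rewrite /= big_cat /=.
  apply: (is_derive_SPD_ext pS sX _ (is_deriveD (is_derive_dkform L sf pS sX) IHL)).
  by move=> A _; rewrite big_cons.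
split => [S /dV[] //|]; apply: (Ck_ext _ (IH (flatten [seq insertions X L | L <- Ls]))) => S pS.
by have [_ <-] := dV S pS.
Qed.

Lemma smooth_dkform f Xs : smooth_pos f -> smooth (dkform f Xs).
Proof.
move=> sf k; apply: Ck_ext (Ck_dkforms [:: Xs] k sf) => S _.
by rewrite big_seq1.
Qed.

Theorem smooth_umap f : smooth_pos f -> smooth (@umap R n f).
Proof.
move=> sf k; apply: Ck_ext (smooth_dkform [::] sf k) => S _.
by rewrite umap_dkform.
Qed.

End DaletskiiKrein.

(** * Vector fields and affine connections *)

Section VectorFields.
Variables (R : realType) (n : nat).
Implicit Types (S x y z : 'M[R]_n) (X Y Z W : 'M[R]_n -> 'M[R]_n).
Implicit Types (f : 'M[R]_n -> R).

(** These matrices span Sym(n), and the coefficients can be taken to be the n^2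
    entries. *)
Definition symdelta (ij : 'I_n * 'I_n) : 'M[R]_n :=
  2^-1 *: (delta_mx ij.1 ij.2 + delta_mx ij.2 ij.1).

Lemma Sym_symdelta ij : Sym (symdelta ij).
Proof.
by rewrite /symdelta; apply: SymZ; rewrite /Sym/= linearD/= !trmx_delta addrC.
Qed.

Lemma symdelta_sum x : Sym x -> x = \sum_ij x ij.1 ij.2 *: symdelta ij.
Proof.
move=> sx.
have E : x = \sum_ij x ij.1 ij.2 *: delta_mx ij.1 ij.2.
  by rewrite {1}[x]matrix_sum_delta pair_bigA.
have ET : x = \sum_ij x ij.1 ij.2 *: delta_mx ij.2 ij.1.
  rewrite -{1}sx {1}E linear_sum; apply: eq_bigr => ij _ /=.
  by rewrite linearZ/= trmx_delta.
transitivity (2^-1 *: (x + x)).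
  by apply/matrixP => i j; rewrite !mxE; field.
rewrite [X in X + _]E [X in _ + X]ET -big_split scaler_sumr; apply: eq_bigr => ij _ /=.
by rewrite -scalerDr scalerA mulrC -scalerA.
Qed.

Lemma vf_cst x : Sym x -> vector_field (fun _ : 'M[R]_n => x).
Proof. by move=> sx; split => // k; exact: Ck_cst. Qed.

Lemma smooth_cst (c : R) : smooth (fun _ : 'M[R]_n => c).
Proof. by move=> k; exact: Ck_cst. Qed.

Lemma vfD X Y : vector_field X -> vector_field Y ->
  vector_field (fun S => X S + Y S).
Proof.
move=> [sX SX] [sY SY]; split => [k|S pS]; first exact: CkD.
by apply: SymD; [exact: SX|exact: SY].
Qed.

Lemma vfZ f X : smooth f -> vector_field X -> vector_field (fun S => f S *: X S).
Proof.
move=> sf [sX SX]; split => [k|S pS]; first exact: Ck_scale.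
by apply: SymZ; exact: SX.
Qed.

Lemma vf_sum (I : Type) (r : seq I) (F : I -> 'M[R]_n -> 'M[R]_n) :
  (forall i, vector_field (F i)) -> vector_field (fun S => \sum_(i <- r) F i S).
Proof.
move=> H; split => [k|S pS]; first by apply: Ck_sum => i; case: (H i).
by apply: Sym_sum => i _; case: (H i) => _; apply.
Qed.

Lemma vf_ext X Y : vector_field X -> (forall S, SPD S -> Y S = X S) -> vector_field Y.
Proof.
move=> [sX SX] E; split => [k|S pS]; last by rewrite E//; exact: SX.
by apply: Ck_ext (sX k) => S pS; rewrite E.
Qed.

Lemma smooth_entry X i j : vector_field X -> smooth (fun S => X S i j).
Proof. by move=> [sX _] k; exact: Ck_entry. Qed.

Lemma smooth_derive (V : normedModType R) (F : 'M[R]_n -> V) x :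
  smooth F -> Sym x -> smooth (fun S => 'D_x F S).
Proof. by move=> sF sx k; apply: Ck_derive. Qed.

Lemma smooth_derivable (V : normedModType R) (F : 'M[R]_n -> V) x S :
  smooth F -> SPD S -> Sym x -> derivable F S x.
Proof. by move=> sF; apply: Ck_derivable (sF 1%N). Qed.

Lemma derive_entry X x S i j : vector_field X -> SPD S -> Sym x ->
  'D_x (fun A => X A i j) S = ('D_x X S) i j.
Proof.
by move=> [sX _] pS sx; rewrite derive_mx ?mxE//; exact: smooth_derivable.
Qed.

Lemma Sym_derive X x S : vector_field X -> SPD S -> Sym x -> Sym ('D_x X S).
Proof.
move=> vX pS sx; apply/matrixP => i j; rewrite mxE -!derive_entry//.
apply: derive_SPD_ext => // A pA.
by have sA := vX.2 A pA; rewrite -[in RHS]sA mxE.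
Qed.

(** The cancellation in a commutator of covariant derivatives: the first-order
    terms b and c occur twice and the second derivatives d are symmetric. *)
Lemma sums_swap (I : finType) (V : zmodType) (a a' b c d d' : I -> V) :
  (forall i, d' i = d i) ->
  \sum_i (a i + b i) + \sum_i (c i + d i) -
  (\sum_i (a' i + c i) + \sum_i (b i + d' i)) = \sum_i a i - \sum_i a' i.
Proof.
move=> dE; rewrite !big_split /= (eq_bigr _ (fun i _ => dE i)).
move: (\sum_i a i) (\sum_i a' i) (\sum_i b i) (\sum_i c i) (\sum_i d i) => A A' B C D.
rewrite -(addrA A) -(addrA A') (addrCA C B D).
by rewrite opprD addrACA subrr addr0.
Qed.

Lemma sum_split_zero (I : finType) (V : zmodType) (a b b' z : I -> V) :
  (forall i, z i = 0) -> (forall i, b i = b' i) ->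
  \sum_i (a i + b i) = \sum_i (a i + z i) + \sum_i b' i.
Proof.
move=> z0 bb; rewrite -big_split; apply: eq_bigr => i _ /=.
by rewrite z0 addr0 bb.
Qed.

(** Connections act on maps defined on all matrices.  This function is smooth
    and equal to 1 on SPD(n); multiplying by it removes the dependence on the
    values outside SPD(n). *)
Definition SPD_indicator S : R := (`[< SPD S >])%:R.

Lemma SPD_indicatorE S : SPD S -> SPD_indicator S = 1.
Proof. by move=> pS; rewrite /SPD_indicator asboolT. Qed.

Lemma smooth_indicator : smooth SPD_indicator.
Proof.
by move=> k; apply: (Ck_ext _ (smooth_cst 1 k)) => S /SPD_indicatorE.
Qed.

Section Connection.
Variable nabla : ('M[R]_n -> 'M[R]_n) -> ('M[R]_n -> 'M[R]_n) -> 'M[R]_n -> 'M[R]_n.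
Hypothesis Hn : is_affine_connection nabla.

Lemma derive_cst_SPD f x S (c : R) : (forall A, SPD A -> f A = c) -> SPD S -> Sym x ->
  'D_x f S = 0.
Proof.
move=> E pS sx.
by rewrite (@derive_SPD_ext R n _ (fun=> c))// ?derive_cst// => A /E.
Qed.

Lemma nabla_extr X Y Y' S : vector_field X -> vector_field Y -> vector_field Y' ->
  (forall A, SPD A -> Y A = Y' A) -> SPD S -> nabla X Y S = nabla X Y' S.
Proof.
move=> vX vY vY' E pS.
have K Z : vector_field Z -> nabla X (fun A => SPD_indicator A *: Z A) S = nabla X Z S.
  move=> vZ; rewrite (nabla_Leibniz Hn smooth_indicator vX vZ pS).
  rewrite (derive_cst_SPD SPD_indicatorE pS (vX.2 S pS)) scale0r addr0.
  by rewrite SPD_indicatorE// scale1r.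
rewrite -(K Y vY) -(K Y' vY'); congr (nabla X _ S).
apply/funext => A; rewrite /SPD_indicator; case: (pselect (SPD A)) => pA.
  by rewrite E.
by rewrite asboolF// !scale0r.
Qed.

Lemma nabla_0l Y S : vector_field Y -> SPD S -> nabla (fun=> 0) Y S = 0.
Proof.
move=> vY pS; have v0 := vf_cst (@Sym0 R n).
have := nabla_linear Hn (smooth_cst 1) v0 v0 vY pS.
rewrite (_ : (fun _ => _) = (fun=> 0)); last first.
  by apply/funext => A; rewrite scaler0 addr0.
rewrite scale1r => /eqP; rewrite -subr_eq0 opprD addrA subrr sub0r oppr_eq0.
by move/eqP.
Qed.

Lemma nabla_Zl f X Y S : smooth f -> vector_field X -> vector_field Y -> SPD S ->
  nabla (fun A => f A *: X A) Y S = f S *: nabla X Y S.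
Proof.
move=> sf vX vY pS; have v0 := vf_cst (@Sym0 R n).
have := nabla_linear Hn sf vX v0 vY pS.
rewrite nabla_0l// addr0 => <-; congr (nabla _ Y S).
by apply/funext => A; rewrite addr0.
Qed.

Lemma nabla_Dl X X' Y S : vector_field X -> vector_field X' -> vector_field Y -> SPD S ->
  nabla (fun A => X A + X' A) Y S = nabla X Y S + nabla X' Y S.
Proof.
move=> vX vX' vY pS.
have := nabla_linear Hn (smooth_cst 1) vX vX' vY pS.
rewrite scale1r => <-; congr (nabla _ Y S).
by apply/funext => A; rewrite scale1r.
Qed.

Lemma nabla_extl X X' Y S : vector_field X -> vector_field X' -> vector_field Y ->
  (forall A, SPD A -> X A = X' A) -> SPD S -> nabla X Y S = nabla X' Y S.
Proof.
move=> vX vX' vY E pS.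
have K Z : vector_field Z -> nabla (fun A => SPD_indicator A *: Z A) Y S = nabla Z Y S.
  by move=> vZ; rewrite (nabla_Zl smooth_indicator vZ vY pS) SPD_indicatorE// scale1r.
rewrite -(K X vX) -(K X' vX'); congr (nabla _ Y S).
apply/funext => A; rewrite /SPD_indicator; case: (pselect (SPD A)) => pA.
  by rewrite E.
by rewrite asboolF// !scale0r.
Qed.

Lemma nabla_0r X S : vector_field X -> SPD S -> nabla X (fun=> 0) S = 0.
Proof.
move=> vX pS; have v0 := vf_cst (@Sym0 R n).
have := nabla_add Hn vX v0 v0 pS.
rewrite (_ : (fun _ => _) = (fun=> 0)); last by apply/funext => A; rewrite addr0.
by move/eqP; rewrite -subr_eq0 opprD addrA subrr sub0r oppr_eq0 => /eqP.
Qed.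

Lemma nabla_expand_l (I : Type) (r : seq I) (F : I -> 'M[R]_n -> R)
    (Z : I -> 'M[R]_n -> 'M[R]_n) X Y S :
  (forall i, smooth (F i)) -> (forall i, vector_field (Z i)) ->
  vector_field X -> vector_field Y -> SPD S ->
  (forall A, SPD A -> X A = \sum_(i <- r) F i A *: Z i A) ->
  nabla X Y S = \sum_(i <- r) F i S *: nabla (Z i) Y S.
Proof.
move=> sF vZ vX vY pS E.
have vs r' : vector_field (fun A => \sum_(i <- r') F i A *: Z i A).
  by apply: vf_sum => i; exact: vfZ.
rewrite (nabla_extl vX (vs r) vY E pS).
elim: r {E} => [|i r IH].
  rewrite big_nil; apply: etrans (nabla_0l vY pS); congr (nabla _ Y S).
  by apply/funext => A; rewrite big_nil.
rewrite big_cons -IH -(nabla_Zl (sF i) (vZ i) vY pS) -nabla_Dl//; last exact: vfZ.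
by congr (nabla _ Y S); apply/funext => A; rewrite big_cons.
Qed.

Lemma nabla_expand_r (I : Type) (r : seq I) (F : I -> 'M[R]_n -> R)
    (Z : I -> 'M[R]_n -> 'M[R]_n) X Y S :
  (forall i, smooth (F i)) -> (forall i, vector_field (Z i)) ->
  vector_field X -> vector_field Y -> SPD S ->
  (forall A, SPD A -> Y A = \sum_(i <- r) F i A *: Z i A) ->
  nabla X Y S =
  \sum_(i <- r) (F i S *: nabla X (Z i) S + 'D_(X S) (F i) S *: Z i S).
Proof.
move=> sF vZ vX vY pS E.
have vs r' : vector_field (fun A => \sum_(i <- r') F i A *: Z i A).
  by apply: vf_sum => i; exact: vfZ.
rewrite (nabla_extr vX vY (vs r) E pS).
elim: r {E} => [|i r IH].
  rewrite big_nil; apply: etrans (nabla_0r vX pS); congr (nabla X _ S).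
  by apply/funext => A; rewrite big_nil.
rewrite big_cons -IH -(nabla_Leibniz Hn (sF i) vX (vZ i) pS) -(nabla_add Hn)//; last exact: vfZ.
by congr (nabla X _ S); apply/funext => A; rewrite big_cons.
Qed.

Let Z_ (ij : 'I_n * 'I_n) : 'M[R]_n -> 'M[R]_n := fun=> symdelta ij.
Let vZ_ ij : vector_field (Z_ ij) := vf_cst (Sym_symdelta ij).

Lemma field_expansion X : vector_field X -> forall A, SPD A ->
  X A = \sum_ij X A ij.1 ij.2 *: Z_ ij A.
Proof. by move=> vX A pA; apply: symdelta_sum; exact: vX.2. Qed.

(** A field is a combination of constant fields with functions as
    coefficients, which come out of the direction of differentiation. *)
Lemma nabla_dir X Y S : vector_field X -> vector_field Y -> SPD S ->
  nabla X Y S = nabla (fun=> X S) Y S.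
Proof.
move=> vX vY pS.
have vx := vf_cst (vX.2 S pS).
rewrite (nabla_expand_l (fun ij => smooth_entry ij.1 ij.2 vX) vZ_ vX vY pS (field_expansion vX)).
by rewrite (nabla_expand_l (fun ij => smooth_entry ij.1 ij.2 vx) vZ_ vx vY pS (field_expansion vx)).
Qed.

(** The last term, where Y itself is differentiated, is the one that the
    bracket compensates in the curvature. *)
Lemma nabla_nabla_dir x Y Z S : Sym x -> vector_field Y -> vector_field Z -> SPD S ->
  nabla (fun=> x) (nabla Y Z) S =
  nabla (fun=> x) (nabla (fun=> Y S) Z) S + nabla (fun=> 'D_x Y S) Z S.
Proof.
move=> sx vY vZ pS; have vx := vf_cst sx.
have vN W : vector_field W -> vector_field (nabla W Z).
  by move=> vW; exact: (nabla_vector_field Hn).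
have key W : vector_field W -> nabla (fun=> x) (nabla W Z) S =
    \sum_ij (W S ij.1 ij.2 *: nabla (fun=> x) (nabla (Z_ ij) Z) S +
             'D_x (fun A => W A ij.1 ij.2) S *: nabla (Z_ ij) Z S).
  move=> vW.
  have E A (pA : SPD A) := nabla_expand_l (fun ij => smooth_entry ij.1 ij.2 vW)
    vZ_ vW vZ pA (field_expansion vW).
  exact: (nabla_expand_r (fun ij => smooth_entry ij.1 ij.2 vW)
    (fun ij => vN _ (vZ_ ij)) vx (vN _ vW) pS E).
have vy := vf_cst (vY.2 S pS); have vd := vf_cst (Sym_derive vY pS sx).
rewrite (key Y vY) (key _ vy).
rewrite (nabla_expand_l (fun ij => smooth_entry ij.1 ij.2 vd) vZ_ vd vZ pS (field_expansion vd)).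
apply: sum_split_zero => ij; first by rewrite derive_cst scale0r.
by rewrite derive_entry.
Qed.

(** When Z is expanded over constant fields, the terms with first derivatives of
    its entries are symmetric in x and y, and those with second derivatives are
    so by Schwarz's theorem. *)
Lemma nabla_nabla_const x y Z S : Sym x -> Sym y -> vector_field Z -> SPD S ->
  nabla (fun=> x) (nabla (fun=> y) Z) S - nabla (fun=> y) (nabla (fun=> x) Z) S =
  nabla (fun=> x) (nabla (fun=> y) (fun=> Z S)) S -
  nabla (fun=> y) (nabla (fun=> x) (fun=> Z S)) S.
Proof.
move=> sx sy vZ pS.
have key a b W : Sym a -> Sym b -> vector_field W ->
    nabla (fun=> a) (nabla (fun=> b) W) S =
    \sum_ij (W S ij.1 ij.2 *: nabla (fun=> a) (nabla (fun=> b) (Z_ ij)) S +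
             'D_a (fun A => W A ij.1 ij.2) S *: nabla (fun=> b) (Z_ ij) S) +
    \sum_ij ('D_b (fun A => W A ij.1 ij.2) S *: nabla (fun=> a) (Z_ ij) S +
             'D_a (fun A => 'D_b (fun A' => W A' ij.1 ij.2) A) S *: Z_ ij S).
  move=> sa sb vW; have va := vf_cst sa; have vb := vf_cst sb.
  have sE ij : smooth (fun A => W A ij.1 ij.2) by exact: smooth_entry.
  have sD ij : smooth (fun A => 'D_b (fun A' => W A' ij.1 ij.2) A).
    exact: smooth_derive.
  have vN ij : vector_field (nabla (fun=> b) (Z_ ij)) by exact: (nabla_vector_field Hn).
  pose W1 A := \sum_ij W A ij.1 ij.2 *: nabla (fun=> b) (Z_ ij) A.
  pose W2 A := \sum_ij 'D_b (fun A' => W A' ij.1 ij.2) A *: Z_ ij A.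
  have v1 : vector_field W1 by apply: vf_sum => ij; exact: vfZ.
  have v2 : vector_field W2 by apply: vf_sum => ij; exact: vfZ.
  have E A : SPD A -> nabla (fun=> b) W A = W1 A + W2 A.
    move=> pA; rewrite (nabla_expand_r sE vZ_ vb vW pA (field_expansion vW)).
    by rewrite big_split.
  rewrite (nabla_extr va (nabla_vector_field Hn vb vW) (vfD v1 v2) E pS).
  rewrite (nabla_add Hn va v1 v2 pS); congr (_ + _).
    exact: (nabla_expand_r sE vN va v1 pS).
  exact: (nabla_expand_r sD vZ_ va v2 pS).
have key2 W : vector_field W ->
    nabla (fun=> x) (nabla (fun=> y) W) S - nabla (fun=> y) (nabla (fun=> x) W) S =
    \sum_ij W S ij.1 ij.2 *: nabla (fun=> x) (nabla (fun=> y) (Z_ ij)) S -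
    \sum_ij W S ij.1 ij.2 *: nabla (fun=> y) (nabla (fun=> x) (Z_ ij)) S.
  move=> vW; rewrite (key x y W sx sy vW) (key y x W sy sx vW).
  apply: (@sums_swap _ _
    (fun ij => W S ij.1 ij.2 *: nabla (fun=> x) (nabla (fun=> y) (Z_ ij)) S)
    (fun ij => W S ij.1 ij.2 *: nabla (fun=> y) (nabla (fun=> x) (Z_ ij)) S)
    (fun ij => 'D_x (fun A => W A ij.1 ij.2) S *: nabla (fun=> y) (Z_ ij) S)
    (fun ij => 'D_y (fun A => W A ij.1 ij.2) S *: nabla (fun=> x) (Z_ ij) S)
    (fun ij => 'D_x (fun A => 'D_y (fun A' => W A' ij.1 ij.2) A) S *: Z_ ij S)
    (fun ij => 'D_y (fun A => 'D_x (fun A' => W A' ij.1 ij.2) A) S *: Z_ ij S)).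
  move=> ij.
  exact: (congr1 (fun c => c *: Z_ ij S)
    (esym (deriveC (smooth_entry ij.1 ij.2 vW 2) pS sx sy))).
by rewrite (key2 Z vZ) (key2 _ (vf_cst (vZ.2 S pS))).
Qed.

Lemma nabla_Bl_cst x y Z S : Sym x -> Sym y -> vector_field Z -> SPD S ->
  nabla (fun=> x - y) Z S = nabla (fun=> x) Z S - nabla (fun=> y) Z S.
Proof.
move=> sx sy vZ pS; have vx := vf_cst sx; have vy := vf_cst sy.
have := nabla_linear Hn (smooth_cst (-1)) vy vx vZ pS.
move=> E; rewrite [RHS]addrC; apply: etrans (etrans E _).
  by congr (nabla _ Z S); apply/funext => A; rewrite scaleN1r addrC.
by rewrite scaleN1r.
Qed.

(** The bracket removes the derivatives of X and Y, and the commutator those of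
    Z. *)
Theorem curvature_tensorial g X Y Z T S :
  (forall X Y, vector_field X -> vector_field Y -> forall S, SPD S ->
     nabla X Y S - nabla Y X S = lie_bracket X Y S) ->
  vector_field X -> vector_field Y -> vector_field Z -> SPD S ->
  curvature g nabla X Y Z T S =
  - g S (nabla (fun=> X S) (nabla (fun=> Y S) (fun=> Z S)) S -
         nabla (fun=> Y S) (nabla (fun=> X S) (fun=> Z S)) S) (T S).
Proof.
move=> tf vX vY vZ pS; rewrite /curvature; congr (- g S _ (T S)).
have sx := vX.2 S pS; have sy := vY.2 S pS.
have vXY := nabla_vector_field Hn vX vY; have vYX := nabla_vector_field Hn vY vX.
have vB : vector_field (lie_bracket X Y).
  apply: vf_ext (vfD vXY (vfZ (smooth_cst (-1)) vYX)) _ => A pA.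
  by rewrite scaleN1r tf.
rewrite (nabla_dir vX (nabla_vector_field Hn vY vZ) pS).
rewrite (nabla_dir vY (nabla_vector_field Hn vX vZ) pS) (nabla_dir vB vZ pS).
rewrite (nabla_nabla_dir sx vY vZ pS) (nabla_nabla_dir sy vX vZ pS).
rewrite /lie_bracket nabla_Bl_cst//; [|exact: Sym_derive..].
rewrite -(nabla_nabla_const sx sy vZ pS).
move: (nabla _ _ S) (nabla _ _ S) (nabla _ _ S) (nabla _ _ S) => a b c d.
by apply/matrixP => i j; rewrite !mxE; ring.
Qed.

End Connection.
End VectorFields.

(** * Derivatives of univariate maps in an eigenbasis *)

Section EigenEntries.
Variables (R : realType) (n : nat).
Notation dec := ('M[R]_n * 'rV[R]_n)%type.
Implicit Types (D : dec) (f : R -> R) (S X Y Z A : 'M[R]_n).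

(** The matrix X read in the eigenbasis P. *)
Definition conj_by (P X : 'M[R]_n) : 'M[R]_n := P^T *m X *m P.

Lemma conj_by_sym P X : Sym X -> forall i j, conj_by P X i j = conj_by P X j i.
Proof.
move=> sX i j; have E : (conj_by P X)^T = conj_by P X.
  by rewrite /conj_by !trmx_mul trmxK sX mulmxA.
by rewrite -[in LHS]E mxE.
Qed.

Lemma conj_byM P X Y : orthogonalmx P ->
  conj_by P (X *m Y) = conj_by P X *m conj_by P Y.
Proof.
by move=> oP; rewrite /conj_by !mulmxA -(mulmxA (_ *m X) P) oP mulmx1.
Qed.

Lemma mxtrace_conj P X : orthogonalmx P -> \tr (conj_by P X) = \tr X.
Proof. by move=> oP; rewrite /conj_by mxtrace_mulC mulmxA oP mul1mx. Qed.

Lemma mxtrace_mul_entries P X Y : orthogonalmx P ->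
  \tr (X *m Y) = \sum_i \sum_j conj_by P X i j * conj_by P Y j i.
Proof.
move=> oP; rewrite -(mxtrace_conj _ oP) conj_byM//.
by apply: eq_bigr => i _; rewrite mxE.
Qed.

Lemma conj_by_eigproj D i (W : 'I_n -> 'M[R]_n) j : orthogonalmx D.1 ->
  conj_by D.1 (\sum_k eigproj D k *m W k) i j = conj_by D.1 (W i) i j.
Proof.
move=> /orthogonalmxT oD.
have E k : D.1^T *m eigproj D k = delta_mx k k *m D.1^T.
  rewrite /eigproj colE trmx_mul trmx_delta !mulmxA oD mul1mx.
  by rewrite mul_delta_mx.
rewrite /conj_by mulmx_sumr mulmx_suml summxE (bigD1 i)//= big1 ?addr0.
  rewrite mulmxA E -!mulmxA (mulmxA D.1^T).
  by rewrite mxE (bigD1 i)//= mxE !eqxx mul1r big1 ?addr0// => k ki;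
    rewrite mxE (negbTE ki) andbF mul0r.
move=> k ki; rewrite mulmxA E -!mulmxA mxE big1// => l _.
by rewrite mxE eq_sym (negbTE ki) mul0r.
Qed.

Lemma conj_by_multop_nil f D i j : orthogonalmx D.1 ->
  conj_by D.1 (multop f D (with_dec D [::])) i j = if i == j then f (D.2 ord0 i) else 0.
Proof.
move=> oD; have -> : multop f D (with_dec D [::]) = \sum_k eigproj D k *m (f (D.2 ord0 k))%:M.
  by apply: eq_bigr => k _; rewrite mul_mx_scalar.
rewrite conj_by_eigproj// /conj_by mul_mx_scalar -scalemxAl (orthogonalmxT oD).
by rewrite !mxE; case: eqP => _; rewrite ?mulr1 ?mulr0.
Qed.

Lemma sum_pick (a b : 'I_n -> R) j :
  \sum_k a k * (if k == j then b k else 0) = a j * b j.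
Proof.
by rewrite (bigD1 j)//= eqxx big1 ?addr0// => k /negbTE ->; rewrite mulr0.
Qed.

Lemma conj_by_multop_cons f D X Xs i j : orthogonalmx D.1 ->
  conj_by D.1 (multop f D (with_dec D (X :: Xs))) i j =
  \sum_k conj_by D.1 X i k *
     conj_by D.1 (multop (dd1 f ^~ (D.2 ord0 i)) D (with_dec D Xs)) k j.
Proof.
move=> oD.
have -> : multop f D (with_dec D (X :: Xs)) = \sum_i eigproj D i *m
    (X *m multop (dd1 f ^~ (D.2 ord0 i)) D (with_dec D Xs)).
  by apply: eq_bigr => k _; rewrite mulmxA.
by rewrite conj_by_eigproj// conj_byM// mxE.
Qed.

Lemma dkform1_entry f S D X i j : smooth_pos f -> is_spectral_dec S D.1 D.2 ->
  conj_by D.1 (dkform f [:: X] S) i j =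
  dd1 f (D.2 ord0 i) (D.2 ord0 j) * conj_by D.1 X i j.
Proof.
move=> sf HD; rewrite (dkformE _ sf HD); have [oD _ _] := HD.
rewrite conj_by_multop_cons//.
under eq_bigr => k _ do rewrite conj_by_multop_nil//.
by rewrite sum_pick mulrC dd1C.
Qed.

Lemma dkform2_entry f S D X Y i j : smooth_pos f -> is_spectral_dec S D.1 D.2 ->
  conj_by D.1 (dkform f [:: X; Y] S) i j =
  \sum_k dd2 f (D.2 ord0 i) (D.2 ord0 k) (D.2 ord0 j) *
         (conj_by D.1 X i k * conj_by D.1 Y k j).
Proof.
move=> sf HD; rewrite (dkformE _ sf HD); have [oD pD _] := HD.
rewrite conj_by_multop_cons//; apply: eq_bigr => k _.
rewrite conj_by_multop_cons//.
under eq_bigr => l _ do rewrite conj_by_multop_nil//.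
by rewrite sum_pick dd2E//; ring.
Qed.

Lemma is_derive_entry (F : 'M[R]_n -> 'M[R]_n) S X dF i j :
  is_derive S X F dF -> is_derive S X (fun A => F A i j) (dF i j).
Proof.
move=> [dFS <-]; apply: DeriveDef; first by move/derivable_mxP: dFS; apply.
by rewrite derive_mx// mxE.
Qed.

Lemma is_derive_bigsum (I : finType) (F : I -> 'M[R]_n -> R) S X (dF : I -> R) :
  (forall i, is_derive S X (F i) (dF i)) ->
  is_derive S X (fun A => \sum_i F i A) (\sum_i dF i).
Proof.
move=> H; elim: (index_enum I) => [|i r IH].
  rewrite big_nil (_ : (fun _ => _) = (fun=> 0)); first exact: is_derive_cst.
  by apply/funext => A; rewrite big_nil.
rewrite big_cons (_ : (fun _ => _) = (fun A => F i A + \sum_(j <- r) F j A)).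
  exact: (derD (H i) IH erefl).
by apply/funext => A; rewrite big_cons.
Qed.

Lemma is_derive_mxtrace_mul (F G : 'M[R]_n -> 'M[R]_n) S X dF dG :
  is_derive S X F dF -> is_derive S X G dG ->
  is_derive S X (fun A => \tr (F A *m G A)) (\tr (dF *m G S) + \tr (F S *m dG)).
Proof.
move=> hF hG.
have -> : (fun A => \tr (F A *m G A)) = (fun A => \sum_i \sum_j F A i j * G A j i).
  by apply/funext => A; apply: eq_bigr => i _; rewrite mxE.
have -> : \tr (dF *m G S) + \tr (F S *m dG) =
    \sum_i \sum_j (F S i j * dG j i + G S j i * dF i j).
  rewrite -big_split; apply: eq_bigr => i _ /=; rewrite !mxE -big_split.
  by apply: eq_bigr => j _ /=; rewrite addrC [in RHS]addrC (mulrC (G S _ _)) addrC.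
apply: is_derive_bigsum => i; apply: is_derive_bigsum => j.
exact: (derM (is_derive_entry i j hF) (is_derive_entry j i hG) erefl).
Qed.

(** Symmetrized in the directions, these are the second and third derivatives of
    umap f. *)
Definition dk2 f X Y S := dkform f [:: X; Y] S + dkform f [:: Y; X] S.

Definition dk3 f X Y Z S := \sum_(L <- insertions X [:: Y; Z]) dkform f L S +
  \sum_(L <- insertions X [:: Z; Y]) dkform f L S.

Lemma dk2C f X Y S : dk2 f X Y S = dk2 f Y X S.
Proof. by rewrite /dk2 addrC. Qed.

Lemma dk3C f X Y Z S : dk3 f X Y Z S = dk3 f Y X Z S.
Proof.
rewrite /dk3 /= !big_cons !big_nil !addr0.
by apply/matrixP => i j; rewrite !mxE; ring.
Qed.

Lemma is_derive_dk1 f X Y S : smooth_pos f -> SPD S -> Sym X ->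
  is_derive S X (dkform f [:: Y]) (dk2 f X Y S).
Proof.
move=> sf pS sX; have := is_derive_dkform [:: Y] sf pS sX.
by rewrite /= !big_cons big_nil addr0.
Qed.

Lemma is_derive_dk2 f X Y Z S : smooth_pos f -> SPD S -> Sym X ->
  is_derive S X (dk2 f Y Z) (dk3 f X Y Z S).
Proof.
move=> sf pS sX.
exact: (is_deriveD (is_derive_dkform [:: Y; Z] sf pS sX) (is_derive_dkform [:: Z; Y] sf pS sX)).
Qed.

Lemma derive_umap f S X : smooth_pos f -> SPD S -> Sym X ->
  is_derive S X (@umap R n f) (dkform f [:: X] S).
Proof.
move=> sf pS sX; have := is_derive_dkform [::] sf pS sX.
rewrite /= big_seq1; apply: is_derive_SPD_ext => // A _.
by rewrite umap_dkform.
Qed.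

End EigenEntries.

(** * Levi-Civita connection of a mixed-Euclidean metric *)

Section MixedEuclidean.
Variables (R : realType) (n : nat) (u v : R -> R).
Notation dec := ('M[R]_n * 'rV[R]_n)%type.
Implicit Types (D : dec) (S A x y z t : 'M[R]_n).
Hypotheses (su : smooth_pos u) (sv : smooth_pos v).

Let c : R := (derive1 u 1 * derive1 v 1)^-1.
Local Notation g := (@ME_metric R n u v).

(** The trace of DU(x) DV(y) does not depend on the decomposition, hence
    neither does the entrywise formula. *)
Lemma ME_metric_entries S D x y : is_spectral_dec S D.1 D.2 -> Sym y ->
  g S x y = c * \sum_i \sum_j
    dd1 u (D.2 ord0 i) (D.2 ord0 j) * dd1 v (D.2 ord0 i) (D.2 ord0 j) *
    (conj_by D.1 x i j * conj_by D.1 y i j).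
Proof.
move=> HD sy; have HS := spectral_decP (spectral_SPD HD).
have trE D' : is_spectral_dec S D'.1 D'.2 ->
    \sum_i \sum_j
    dd1 u (D'.2 ord0 i) (D'.2 ord0 j) * dd1 v (D'.2 ord0 i) (D'.2 ord0 j) *
    (conj_by D'.1 x i j * conj_by D'.1 y i j) =
    \tr (dkform u [:: x] S *m dkform v [:: y] S).
  move=> HD'; have [oD' _ _] := HD'; rewrite (mxtrace_mul_entries _ _ oD').
  apply: eq_bigr => i _; apply: eq_bigr => j _.
  rewrite (dkform1_entry _ _ _ su HD') (dkform1_entry _ _ _ sv HD').
  by rewrite (conj_by_sym _ sy j i) (dd1C v); ring.
rewrite (trE D HD) -(trE _ HS) /ME_metric -/c.
move: HS; case: (spectral_dec S) => P d HS /=.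
congr (_ * _); apply: eq_bigr => i _; apply: eq_bigr => j _.
by rewrite !mulrA.
Qed.

Lemma ME_metric_trace S x y : SPD S -> Sym y ->
  g S x y = c * \tr (dkform u [:: x] S *m dkform v [:: y] S).
Proof.
move=> pS sy; have HS := spectral_decP pS; have [oD _ _] := HS.
rewrite (ME_metric_entries x HS sy) (mxtrace_mul_entries _ _ oD); congr (_ * _).
apply: eq_bigr => i _; apply: eq_bigr => j _.
rewrite (dkform1_entry _ _ _ su HS) (dkform1_entry _ _ _ sv HS).
by rewrite (conj_by_sym _ sy j i) (dd1C v); ring.
Qed.

Lemma ME_metricC S x y : g S x y = g S y x.
Proof.
rewrite /ME_metric; case: (spectral_dec S) => P d; congr (_ * _).
by apply: eq_bigr => i _; apply: eq_bigr => j _; ring.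
Qed.

Lemma ME_metricBl S x x' y : g S (x - x') y = g S x y - g S x' y.
Proof.
rewrite /ME_metric; case: (spectral_dec S) => P d; rewrite -mulrBr -sumrB.
congr (_ * _); apply: eq_bigr => i _; rewrite -sumrB; apply: eq_bigr => j _.
by rewrite mulmxBr mulmxBl !mxE; ring.
Qed.

Section LeviCivita.
Variable nabla : ('M[R]_n -> 'M[R]_n) -> ('M[R]_n -> 'M[R]_n) -> 'M[R]_n -> 'M[R]_n.
Hypothesis LC : is_levi_civita g nabla.
Let Hn := levi_civita_connection LC.

Let Gam x y : 'M[R]_n -> 'M[R]_n := nabla (fun=> x) (fun=> y).

Let vGam x y : Sym x -> Sym y -> vector_field (Gam x y).
Proof. by move=> sx sy; apply: (nabla_vector_field Hn); exact: vf_cst. Qed.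

Let GamC x y S : Sym x -> Sym y -> SPD S -> Gam x y S = Gam y x S.
Proof.
move=> sx sy pS; apply/eqP; rewrite -subr_eq0; apply/eqP.
rewrite /Gam (levi_civita_torsion_free LC (vf_cst sx) (vf_cst sy) pS).
by rewrite /lie_bracket !derive_cst subrr.
Qed.

Lemma is_derive_metric x y z S : Sym x -> Sym y -> Sym z -> SPD S ->
  is_derive S x (fun A => g A y z)
    (c * (\tr (dk2 u x y S *m dkform v [:: z] S) +
          \tr (dkform u [:: y] S *m dk2 v x z S))).
Proof.
move=> sx sy sz pS.
have H := is_derive_mxtrace_mul (is_derive_dk1 y su pS sx) (is_derive_dk1 z sv pS sx).
have H' := derM (is_derive_cst c S x) H erefl.
apply: (is_derive_eq (is_derive_SPD_ext pS sx _ H')).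
  by move=> A pA; rewrite ME_metric_trace.
by rewrite mulr0 addr0.
Qed.

Lemma metric_compat x y z S : Sym x -> Sym y -> Sym z -> SPD S ->
  g S (Gam x y S) z + g S y (Gam x z S) =
  c * (\tr (dk2 u x y S *m dkform v [:: z] S) +
       \tr (dkform u [:: y] S *m dk2 v x z S)).
Proof.
move=> sx sy sz pS; have [_ <-] := is_derive_metric sx sy sz pS.
by rewrite (levi_civita_metric LC (vf_cst sx) (vf_cst sy) (vf_cst sz) pS).
Qed.

(** Koszul's formula: the Levi-Civita connection is the mean of the two flat
    connections that u and v pull back from Sym(n). *)
Lemma koszul y z t S : Sym y -> Sym z -> Sym t -> SPD S ->
  g S (Gam y z S) t =
  c / 2 * (\tr (dk2 u y z S *m dkform v [:: t] S) +
           \tr (dkform u [:: t] S *m dk2 v y z S)).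
Proof.
move=> sy sz st pS.
have E1 := metric_compat sy sz st pS.
have E2 := metric_compat sz st sy pS.
have E3 := metric_compat st sz sy pS.
rewrite (GamC sz st pS) (GamC sz sy pS) (ME_metricC S t) (dk2C u z t) (dk2C v z y) in E2.
rewrite (GamC st sy pS) (dk2C v t y) in E3.
rewrite (ME_metricC S z) in E1; rewrite (ME_metricC S z) in E3.
move: E1 E2 E3.
move: (g S _ _) (g S _ _) (g S _ _) (\tr _) (\tr _) (\tr _) (\tr _) => a b d p q r s.
move: c => k E1 E2 E3; lra.
Qed.

(** Koszul's formula is differentiated along x, and compatibility with the
    metric turns the derivative of g(nabla_y z, t) into a second covariant
    derivative. *)
Lemma nabla_const_pairing x y z t S : Sym x -> Sym y -> Sym z -> Sym t -> SPD S ->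
  g S (nabla (fun=> x) (Gam y z) S) t =
  c / 2 * (\tr (dk3 u x y z S *m dkform v [:: t] S) +
           \tr (dk2 u y z S *m dk2 v x t S) +
           (\tr (dk2 u x t S *m dk2 v y z S) +
            \tr (dkform u [:: t] S *m dk3 v x y z S))) -
  g S (Gam y z S) (Gam x t S).
Proof.
move=> sx sy sz st pS.
have H1 := is_derive_mxtrace_mul (is_derive_dk2 y z su pS sx) (is_derive_dk1 t sv pS sx).
have H2 := is_derive_mxtrace_mul (is_derive_dk1 t su pS sx) (is_derive_dk2 y z sv pS sx).
have H3 := derM (is_derive_cst (c / 2) S x) (derD H1 H2 erefl) erefl.
have E A : SPD A -> c / 2 * (\tr (dk2 u y z A *m dkform v [:: t] A) +
    \tr (dkform u [:: t] A *m dk2 v y z A)) = g A (Gam y z A) t.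
  by move=> pA; rewrite koszul.
have [_ D] := is_derive_SPD_ext pS sx E H3.
have := levi_civita_metric LC (vf_cst sx) (vGam sy sz) (vf_cst st) pS.
by rewrite D mulr0 addr0 => ->; rewrite addrK.
Qed.

Section Entries.
Variables (S : 'M[R]_n) (D : dec).
Hypothesis HD : is_spectral_dec S D.1 D.2.
Hypotheses (u0 : forall i j, dd1 u (D.2 ord0 i) (D.2 ord0 j) != 0)
           (v0 : forall i j, dd1 v (D.2 ord0 i) (D.2 ord0 j) != 0).

Let d i := D.2 ord0 i.
Let u1 i j := dd1 u (d i) (d j).
Let v1 i j := dd1 v (d i) (d j).
Let pS : SPD S := spectral_SPD HD.
Let oD : orthogonalmx D.1. Proof. by case: HD. Qed.
Let d0 i : 0 < d i. Proof. by case: HD. Qed.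

Lemma dk2_entry f y z i j : smooth_pos f ->
  conj_by D.1 (dk2 f y z S) i j =
  \sum_k dd2 f (d i) (d k) (d j) *
    (conj_by D.1 y i k * conj_by D.1 z k j + conj_by D.1 z i k * conj_by D.1 y k j).
Proof.
move=> sf; rewrite /dk2 /conj_by mulmxDr mulmxDl mxE -!/(conj_by _ _).
rewrite (dkform2_entry _ _ _ _ sf HD) (dkform2_entry _ _ _ _ sf HD) -big_split.
by apply: eq_bigr => k _; rewrite mulrDr.
Qed.

Lemma dk2_entry_sym f y z i j : smooth_pos f -> Sym y -> Sym z ->
  conj_by D.1 (dk2 f y z S) i j = conj_by D.1 (dk2 f y z S) j i.
Proof.
move=> sf sy sz; rewrite !dk2_entry//; apply: eq_bigr => k _.
have -> : dd2 f (d i) (d k) (d j) = dd2 f (d j) (d k) (d i).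
  have di := d0 i; have dj := d0 j; have dk := d0 k.
  by rewrite (dd2_swap23 sf di dk dj) (dd2_swap12 sf di dj dk) (dd2_swap23 sf dj di dk).
rewrite (conj_by_sym _ sy i k) (conj_by_sym _ sz k j).
rewrite (conj_by_sym _ sz i k) (conj_by_sym _ sy k j).
by congr (_ * _); rewrite addrC; congr (_ + _); rewrite mulrC.
Qed.

Lemma metric_Gam_Gam x y z t : Sym x -> Sym y -> Sym z -> Sym t ->
  g S (Gam y z S) (Gam x t S) = c / 4 * \sum_i \sum_j
    ((conj_by D.1 (dk2 u y z S) i j * v1 i j + u1 i j * conj_by D.1 (dk2 v y z S) i j) *
     (conj_by D.1 (dk2 u x t S) i j * v1 i j + u1 i j * conj_by D.1 (dk2 v x t S) i j)
     / (u1 i j * v1 i j)).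
Proof.
move=> sx sy sz st.
pose a := conj_by D.1 (dk2 u y z S); pose b := conj_by D.1 (dk2 v y z S).
(* T = A + B with DU(A) = D^2 U(y,z) and DV(B) = D^2 V(y,z): the two flat
   connections applied to (y,z). By Koszul's formula the connection is half of T. *)
pose W : 'M[R]_n := \matrix_(i, j) (a i j / u1 i j + b i j / v1 i j).
pose T := D.1 *m W *m D.1^T.
have u1C i j : u1 i j = u1 j i by rewrite /u1 dd1C.
have v1C i j : v1 i j = v1 j i by rewrite /v1 dd1C.
have WE i j : W i j = a i j / u1 i j + b i j / v1 i j by rewrite /W [LHS]mxE.
have WT : W^T = W.
  apply/matrixP => i j; rewrite [LHS]mxE [LHS]mxE [RHS]mxE (u1C j) (v1C j).
  by rewrite /a /b (dk2_entry_sym j i su sy sz) (dk2_entry_sym j i sv sy sz).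
have sT : Sym T by rewrite /Sym/= /T !trmx_mul trmxK WT mulmxA.
have cT : conj_by D.1 T = W.
  by rewrite /conj_by /T !mulmxA (orthogonalmxT oD) mul1mx -mulmxA (orthogonalmxT oD) mulmx1.
have kE y' z' t' : Sym y' -> Sym z' -> Sym t' ->
    \tr (dk2 u y' z' S *m dkform v [:: t'] S) + \tr (dkform u [:: t'] S *m dk2 v y' z' S) =
    \sum_i \sum_j (conj_by D.1 (dk2 u y' z' S) i j * v1 i j +
       u1 i j * conj_by D.1 (dk2 v y' z' S) i j) * conj_by D.1 t' i j.
  move=> sy' sz' st'; rewrite !(mxtrace_mul_entries _ _ oD) -big_split.
  apply: eq_bigr => i _; rewrite -big_split; apply: eq_bigr => j _ /=.
  rewrite (dkform1_entry _ _ _ sv HD) (dkform1_entry _ _ _ su HD).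
  rewrite (dk2_entry_sym j i sv sy' sz') (conj_by_sym _ st' j i).
  by rewrite (dd1C v) /u1 /v1 /d; ring.
have sG := (vGam sx st).2 S pS.
rewrite (koszul sy sz sG pS) (kE _ _ _ sy sz sG).
have E : \sum_i \sum_j (a i j * v1 i j + u1 i j * b i j) * conj_by D.1 (Gam x t S) i j =
    \sum_i \sum_j u1 i j * v1 i j * (conj_by D.1 (Gam x t S) i j * conj_by D.1 T i j).
  apply: eq_bigr => i _; apply: eq_bigr => j _; rewrite cT WE.
  have := u0 i j; have := v0 i j; rewrite -/(u1 i j) -/(v1 i j).
  move: (u1 i j) (v1 i j) (a i j) (b i j) (conj_by D.1 _ i j) => p q r s w nv nu.
  by field; rewrite nu nv.
rewrite E -mulrA mulrCA.
have := ME_metric_entries (Gam x t S) HD sT; rewrite -/c => M.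
transitivity (2^-1 * g S (Gam x t S) T); first by rewrite M.
rewrite (koszul sx st sT pS) (kE _ _ _ sx st sT) !mulr_sumr.
apply: eq_bigr => i _; rewrite !mulr_sumr; apply: eq_bigr => j _; rewrite cT WE -/a -/b.
have := u0 i j; have := v0 i j; rewrite -/(u1 i j) -/(v1 i j).
move: (u1 i j) (v1 i j) (a i j) (b i j) (conj_by D.1 _ i j) (conj_by D.1 _ i j) c.
by move=> p q r s w w' k nv nu; field; rewrite nu nv.
Qed.

End Entries.

End LeviCivita.
End MixedEuclidean.

(** * Curvature of a mixed-Euclidean metric *)

Section SumRearrangement.
Variables (R : comNzRingType) (n : nat).
Implicit Types (x y z t : 'I_n -> 'I_n -> R) (C : 'I_n -> 'I_n -> 'I_n -> R).

Definition contract C y z j l : R :=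
  \sum_k C j k l * (y j k * z k l + z j k * y k l).

(** Both pairs of monomials coming from the expansion of the second
    contraction give the same sum: they are exchanged by j <-> l. *)
Lemma contract_mul_sum C (w : 'I_n -> 'I_n -> R) x y z t :
  (forall i j, x i j = x j i) -> (forall i j, y i j = y j i) ->
  (forall i j, z i j = z j i) -> (forall i j, t i j = t j i) ->
  (forall i j l, C j i l = C l i j) -> (forall j l, w j l = w l j) ->
  \sum_j \sum_l w j l * (contract C y z j l * contract C x t j l) =
  2 * \sum_i \sum_j \sum_k \sum_l w j l * C j i l * C j k l *
    (x i j * y j k * z k l * t l i + x i j * z j k * y k l * t l i).
Proof.
move=> sx sy sz st sC sw.
pose A j l := contract C y z j l.
pose B j l := \sum_i C j i l * (x i j * t l i).
have AC j l : A j l = A l j.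
  apply: eq_bigr => k _; rewrite (sC k j l) (sy j k) (sz k l) (sz j k) (sy k l).
  by ring.
have BE j l : contract C x t j l = B j l + B l j.
  rewrite -big_split; apply: eq_bigr => i _ /=.
  by rewrite (sC i l j) (sx j i) (st i l) (st j i) (sx i l); ring.
have -> : \sum_j \sum_l w j l * (A j l * contract C x t j l) =
    2 * \sum_j \sum_l w j l * (A j l * B j l).
  have W : \sum_j \sum_l w j l * (A j l * B j l) =
      \sum_j \sum_l w j l * (A j l * B l j).
    rewrite exchange_big; apply: eq_bigr => j _; apply: eq_bigr => l _.
    by rewrite (sw l j) (AC l j).
  rewrite mulr_natl mulr2n [X in _ = _ + X]W -big_split; apply: eq_bigr => j _.
  by rewrite -big_split; apply: eq_bigr => l _ /=; rewrite BE -!mulrDr.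
congr (2 * _).
rewrite [RHS]exchange_big; apply: eq_bigr => j _.
transitivity (\sum_l \sum_i \sum_k w j l * C j i l * C j k l *
    (x i j * y j k * z k l * t l i + x i j * z j k * y k l * t l i)); last first.
  by rewrite exchange_big; apply: eq_bigr => i _; rewrite exchange_big.
apply: eq_bigr => l _; rewrite mulrC mulr_sumr mulr_suml.
apply: eq_bigr => i _; rewrite -mulrA /A /contract mulr_suml.
by apply: eq_bigr => k _; ring.
Qed.

End SumRearrangement.

Section Curvature.
Variables (R : realType) (n : nat) (u v : R -> R).
Notation dec := ('M[R]_n * 'rV[R]_n)%type.
Hypotheses (su : smooth_pos u) (sv : smooth_pos v).
Hypotheses (u0 : forall a b : R, 0 < a -> 0 < b -> dd1 u a b != 0)
           (v0 : forall a b : R, 0 < a -> 0 < b -> dd1 v a b != 0).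
Let c : R := (derive1 u 1 * derive1 v 1)^-1.
Local Notation g := (@ME_metric R n u v).
Variable nabla : ('M[R]_n -> 'M[R]_n) -> ('M[R]_n -> 'M[R]_n) -> 'M[R]_n -> 'M[R]_n.
Hypothesis LC : is_levi_civita g nabla.

Section AtPoint.
Variables (S : 'M[R]_n) (D : dec).
Hypothesis HD : is_spectral_dec S D.1 D.2.
Let d i := D.2 ord0 i.
Let u1 i j := dd1 u (d i) (d j).
Let v1 i j := dd1 v (d i) (d j).
Let pS : SPD S := spectral_SPD HD.
Let oD : orthogonalmx D.1. Proof. by case: HD. Qed.
Let d0 i : 0 < d i. Proof. by case: HD. Qed.
Let C i k j := dd_cross u v (d i) (d j) (d k).
Local Notation e := (conj_by D.1).

Lemma trace_dk2 x y z t : Sym x -> Sym t ->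
  \tr (dk2 u y z S *m dk2 v x t S) =
  \sum_i \sum_j e (dk2 u y z S) i j * e (dk2 v x t S) i j.
Proof.
move=> sx st; rewrite (mxtrace_mul_entries _ _ oD).
apply: eq_bigr => i _; apply: eq_bigr => j _.
by rewrite (dk2_entry_sym HD j i sv sx st).
Qed.

Lemma cross_contract y z i j :
  u1 i j * e (dk2 v y z S) i j - v1 i j * e (dk2 u y z S) i j =
  contract C (fun i j => e y i j) (fun i j => e z i j) i j.
Proof.
rewrite (dk2_entry HD _ _ _ _ sv) (dk2_entry HD _ _ _ _ su) !mulr_sumr -sumrB.
apply: eq_bigr => k _.
have di := d0 i; have dj := d0 j; have dk := d0 k.
rewrite /C /dd_cross -/(u1 i j) -/(v1 i j).
rewrite -/(d i) -/(d j) -/(d k) (dd2_swap23 su di dk dj) (dd2_swap23 sv di dk dj).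
move: (dd2 u _ _ _) (dd2 v _ _ _) (u1 i j) (v1 i j) => p q r s.
by rewrite mulrBl !mulrA.
Qed.

(** The second derivatives of u and v contribute to the curvature through the
    difference of the two flat connections only. *)
Lemma half_curvature x y z t : Sym x -> Sym y -> Sym z -> Sym t ->
  c / 2 * (\tr (dk2 u y z S *m dk2 v x t S) + \tr (dk2 u x t S *m dk2 v y z S)) -
  g S (nabla (fun=> y) (fun=> z) S) (nabla (fun=> x) (fun=> t) S) =
  - (c / 4) * \sum_i \sum_j (u1 i j * v1 i j)^-1 *
   (contract C (fun i j => e y i j) (fun i j => e z i j) i j *
    contract C (fun i j => e x i j) (fun i j => e t i j) i j).
Proof.
move=> sx sy sz st.
have u0' i j : dd1 u (D.2 ord0 i) (D.2 ord0 j) != 0 by apply: u0; exact: d0.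
have v0' i j : dd1 v (D.2 ord0 i) (D.2 ord0 j) != 0 by apply: v0; exact: d0.
rewrite (metric_Gam_Gam su sv LC HD u0' v0' sx sy sz st).
rewrite (trace_dk2 _ _ sx st) (trace_dk2 _ _ sy sz) -big_split !mulr_sumr -sumrB.
apply: eq_bigr => i _; rewrite -big_split !mulr_sumr -sumrB; apply: eq_bigr => j _.
rewrite -!cross_contract -/c.
have := u0' i j; have := v0' i j; rewrite /= -/(u1 i j) -/(v1 i j).
move: (u1 i j) (v1 i j) (e (dk2 u y z S) i j) (e (dk2 v y z S) i j)
  (e (dk2 u x t S) i j) (e (dk2 v x t S) i j) c.
by move=> p q a b a' b' k q0 p0; field; rewrite p0 q0.
Qed.

(** Third derivatives are symmetric in X and Y and disappear from the
    commutator; half_curvature evaluates what remains. *)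
Theorem ME_curvature_entries X Y Z T :
  vector_field X -> vector_field Y -> vector_field Z -> vector_field T ->
  curvature g nabla X Y Z T S = c * \sum_i \sum_j \sum_k \sum_l
    (C j i l * C j k l / (2 * u1 j l * v1 j l)) *
    (e (X S) i j * e (Y S) j k * e (Z S) k l * e (T S) l i
     - e (Y S) i j * e (X S) j k * e (Z S) k l * e (T S) l i
     + e (X S) i j * e (Z S) j k * e (Y S) k l * e (T S) l i
     - e (Y S) i j * e (Z S) j k * e (X S) k l * e (T S) l i).
Proof.
move=> vX vY vZ vT.
have sx := vX.2 S pS; have sy := vY.2 S pS; have sz := vZ.2 S pS; have st := vT.2 S pS.
rewrite (curvature_tensorial (levi_civita_connection LC) g T
  (levi_civita_torsion_free LC) vX vY vZ pS) ME_metricBl.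
rewrite (nabla_const_pairing su sv LC sx sy sz st pS).
rewrite (nabla_const_pairing su sv LC sy sx sz st pS).
rewrite (dk3C u (Y S)) (dk3C v (Y S)).
have H1 := half_curvature sx sy sz st.
have H2 := half_curvature sy sx sz st.
have sE x : Sym x -> forall i j, e x i j = e x j i by exact: conj_by_sym.
have sC i j l : C j i l = C l i j.
  exact: dd_cross_swap12 su sv (d0 j) (d0 l) (d0 i).
have sw j l : (u1 j l * v1 j l)^-1 = (u1 l j * v1 l j)^-1.
  by rewrite /u1 /v1 (dd1C u) (dd1C v).
rewrite (contract_mul_sum (sE _ sx) (sE _ sy) (sE _ sz) (sE _ st) sC sw) in H1.
rewrite (contract_mul_sum (sE _ sy) (sE _ sx) (sE _ sz) (sE _ st) sC sw) in H2.
move: H1 H2; rewrite -/c.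
set s1 := \sum_i \sum_j \sum_k \sum_l _; set s2 := \sum_i \sum_j \sum_k \sum_l _.
set s3 := \sum_i \sum_j \sum_k \sum_l _.
have E3 : s3 = 2^-1 * (s1 - s2).
  rewrite /s3 /s1 /s2 -sumrB mulr_sumr; apply: eq_bigr => i _.
  rewrite -sumrB mulr_sumr; apply: eq_bigr => j _.
  rewrite -sumrB mulr_sumr; apply: eq_bigr => k _.
  rewrite -sumrB mulr_sumr; apply: eq_bigr => l _.
  by rewrite -(mulrA 2) invfM; ring.
rewrite E3; clearbody s1 s2; clear E3 s3 sE sC sw.
move: (\tr _) (\tr _) (\tr _) (\tr _) (\tr _) (\tr _) (g S _ _) (g S _ _) s1 s2 c.
move=> t1 t2 t3 t4 t5 t6 g1 g2 s1 s2 k H1 H2.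
have -> : k * (2^-1 * (s1 - s2)) = - (- (k / 4) * (2 * s1)) + - (k / 4) * (2 * s2) by field.
by rewrite -H1 -H2; ring.
Qed.

End AtPoint.
End Curvature.

(** * Univariate diffeomorphisms *)

Section UnivariateDiffeomorphisms.
Variables (R : realType) (n : nat).
Implicit Types (f g u v : R -> R) (S A : 'M[R]_n) (x y z : R).

Lemma spectral_scalar x : 0 < x ->
  is_spectral_dec (x%:M : 'M[R]_n) 1%:M (const_mx x).
Proof.
move=> x0; split; first by rewrite /orthogonalmx trmx1 mulmx1.
  by move=> i; rewrite mxE.
by rewrite diag_const_mx mul1mx trmx1 mulmx1.
Qed.

Lemma SPD_scalar x : 0 < x -> SPD (x%:M : 'M[R]_n).
Proof. by move=> x0; exact: spectral_SPD (spectral_scalar x0). Qed.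

Lemma conj_diag_scalar (P : 'M[R]_n) (d : 'rV[R]_n) x : orthogonalmx P ->
  P *m diag_mx d *m P^T = x%:M <-> d = const_mx x.
Proof.
move=> oP; split=> [E|->]; last first.
  by rewrite diag_const_mx mul_mx_scalar -scalemxAl oP scalemx1.
have E' : diag_mx d = x%:M.
  transitivity (P^T *m (P *m diag_mx d *m P^T) *m P).
    rewrite !mulmxA orthogonalmxT// mul1mx -mulmxA orthogonalmxT//.
    by rewrite mulmx1.
  by rewrite E mul_mx_scalar -scalemxAl orthogonalmxT// scalemx1.
apply/rowP => i; have := congr1 (fun M : 'M[R]_n => M i i) E'.
by rewrite !mxE eqxx !mulr1n.
Qed.

Lemma umap_scalar f x : 0 < x -> umap f (x%:M : 'M[R]_n) = (f x)%:M.
Proof.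
move=> x0; have := spectral_decP (SPD_scalar x0).
rewrite /umap; case: (spectral_dec _) => P d [/= oP _ /esym].
move/(conj_diag_scalar _ _ oP) => ->.
by apply/(conj_diag_scalar _ _ oP)/rowP => i; rewrite !mxE.
Qed.

Lemma umapE f S (P : 'M[R]_n) d : smooth_pos f -> is_spectral_dec S P d ->
  umap f S = P *m diag_mx (map_mx f d) *m P^T.
Proof.
move=> sf HD; rewrite umap_dkform (dkformE _ sf (HD : is_spectral_dec S (P, d).1 (P, d).2)).
by rewrite conj_diagE; apply: eq_bigr => i _; rewrite mxE.
Qed.

Lemma umap_spectral f S P d : smooth_pos f -> (forall x, 0 < x -> 0 < f x) ->
  is_spectral_dec S P d -> is_spectral_dec (umap f S) P (map_mx f d).
Proof.
move=> sf fp HD; have [oP dp _] := HD; split => //; last exact: umapE.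
by move=> i; rewrite mxE; exact: fp.
Qed.

Record smooth_inverse f g : Prop := {
  si_smooth : smooth_pos f;
  si_smooth' : smooth_pos g;
  si_pos : forall x, 0 < x -> 0 < f x;
  si_pos' : forall x, 0 < x -> 0 < g x;
  si_K : forall x, 0 < x -> g (f x) = x;
  si_K' : forall x, 0 < x -> f (g x) = x }.

Lemma smooth_inverse_sym f g : smooth_inverse f g -> smooth_inverse g f.
Proof. by case=> *; split. Qed.

Lemma smooth_inverse_comp f g f' g' : smooth_inverse f g -> smooth_inverse f' g' ->
  smooth_inverse (f' \o f) (g \o g').
Proof.
move=> H H'; split=> [||x x0|x x0|x x0|x x0] /=.
- apply: smooth_pos_comp; [exact: si_pos H|exact: si_smooth H'|exact: si_smooth H].
- apply: smooth_pos_comp; [exact: si_pos' H'|exact: si_smooth' H|exact: si_smooth' H'].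
- by apply: (si_pos H'); exact: si_pos H _ x0.
- by apply: (si_pos' H); exact: si_pos' H' _ x0.
- by rewrite (si_K H' (si_pos H x0)) (si_K H x0).
- by rewrite (si_K' H (si_pos' H' x0)) (si_K' H' x0).
Qed.

Lemma diffeo_umap f g : smooth_inverse f g -> diffeo (@umap R n f).
Proof.
move=> H; split; first exact: smooth_umap (si_smooth H).
have cancel f1 g1 (H1 : smooth_inverse f1 g1) (S : 'M[R]_n) : SPD S ->
    SPD (umap f1 S) /\ umap g1 (umap f1 S) = S.
  move=> /SPD_spectral_dec[[P d] /= HD].
  have HD' := umap_spectral (si_smooth H1) (si_pos H1) HD.
  split; first exact: spectral_SPD HD'.
  rewrite (umapE (si_smooth' H1) HD'); have [_ dp ->] := HD.
  congr (_ *m diag_mx _ *m _); apply/rowP => i; rewrite !mxE.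
  by rewrite (si_K H1).
exists (@umap R n g); split; first exact: smooth_umap (si_smooth' H).
  by move=> S pS; exact: cancel.
by move=> S pS; apply: cancel => //; exact: smooth_inverse_sym.
Qed.

Section FromMatrices.
Variable i0 : 'I_n.

(** The derivatives at scalar matrices in the direction of the identity are
    those of a function of one variable. *)
Lemma smooth_scalar_entry (F : 'M[R]_n -> 'M[R]_n) : smooth F ->
  smooth_pos (fun x => F x%:M i0 i0).
Proof.
move=> sF; have s1 : Sym (1%:M : 'M[R]_n) by rewrite /Sym/= trmx1.
pose D k : 'M[R]_n -> 'M[R]_n := iter k (fun G S => 'D_1%:M G S) F.
have sD k : smooth (D k).
  by elim: k => [//|k IH]; exact: smooth_derive IH s1.
have D0 x : 0 < x -> F x%:M i0 i0 = D 0%N x%:M i0 i0 by [].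
have dD k x : 0 < x ->
    is_derive x 1 (fun x => D k x%:M i0 i0) (D k.+1 x%:M i0 i0).
  move=> x0; have xE t : t *: (1%:M : 'M[R]_n) + 0 = t%:M.
    by rewrite addr0 scalemx1.
  have dF : derivable (D k) (x *: 1%:M + 0) 1%:M.
    by rewrite xE; apply: (smooth_derivable (sD k)) s1; exact: SPD_scalar.
  have [dl El] := is_derive_line dF.
  have E1 : (fun t : R => D k (t *: 1%:M + 0)) = (fun t => D k t%:M).
    by apply/funext => t; rewrite xE.
  rewrite E1 in dl El; rewrite xE in El.
  apply: DeriveDef; first by move/derivable_mxP: dl; apply.
  have := derive_mx dl; rewrite El => /(congr1 (fun M : 'M[R]_n => M i0 i0)).
  by rewrite mxE => <-.
by have [] := @derive_towerP R _ (fun k x => D k x%:M i0 i0) D0 dD.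
Qed.

(** The map preserves scalar matrices and so does its inverse, since f is
    injective: if f(d_i) = y for all i then the d_i coincide. *)
Lemma diffeo_smooth_inverse f : diffeo (@umap R n f) ->
  exists g, smooth_inverse f g.
Proof.
move=> [sF [G [sG FG GF]]].
have sc x : (x%:M : 'M[R]_n) i0 i0 = x by rewrite mxE eqxx mulr1n.
have scI x y : (x%:M : 'M[R]_n) = y%:M -> x = y.
  by move/(congr1 (fun M : 'M[R]_n => M i0 i0)); rewrite !sc.
have fpos x : 0 < x -> 0 < f x.
  move=> x0; have [] := FG _ (SPD_scalar x0); rewrite umap_scalar// => pf _.
  have [[P d] /= [oP dp /esym/(conj_diag_scalar _ _ oP) dE]] := SPD_spectral_dec pf.
  by have := dp i0; rewrite dE mxE.
have finj a b : 0 < a -> 0 < b -> f a = f b -> a = b.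
  move=> a0 b0 E; apply: scI.
  have [_ <-] := FG _ (SPD_scalar a0); have [_ <-] := FG _ (SPD_scalar b0).
  by rewrite !umap_scalar// E.
have GE y : 0 < y -> exists x, [/\ 0 < x, f x = y & G y%:M = x%:M].
  move=> y0; have [pG] := GF _ (SPD_scalar y0).
  have := spectral_decP pG; rewrite /umap.
  case: (spectral_dec _) => P d /= [oP dp GE] /(conj_diag_scalar _ _ oP) dE.
  have fd i : f (d ord0 i) = y.
    by have := congr1 (fun M : 'rV[R]_n => M ord0 i) dE; rewrite !mxE.
  exists (d ord0 i0); split => //; rewrite GE; apply/(conj_diag_scalar _ _ oP).
  by apply/rowP => i; rewrite mxE; apply: finj => //; rewrite !fd.
have sf : smooth_pos f.
  have fE x : 0 < x -> f x = umap f x%:M i0 i0 by move=> x0; rewrite umap_scalar// sc.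
  by have [] := smooth_pos_ext (smooth_scalar_entry sF) fE.
exists (fun y => G y%:M i0 i0); split => //.
- exact: smooth_scalar_entry.
- by move=> y /GE[x [x0 _ ->]]; rewrite sc.
- by move=> x x0; rewrite -umap_scalar// (FG _ (SPD_scalar x0)).2 sc.
- by move=> y /GE[x [x0 fx ->]]; rewrite sc.
Qed.

End FromMatrices.
Lemma smooth_inverse_derive1_neq0 f g x : smooth_inverse f g -> 0 < x ->
  derive1 f x != 0.
Proof.
move=> H x0; apply/eqP => E.
have sf := si_smooth H; have sg := si_smooth' H.
have df : derivable f x 1 by exact: (sf 0%N x x0).
have dg : derivable g (f x) 1 by exact: (sg 0%N (f x) (si_pos H x0)).
have := derive1_comp df dg; rewrite E mulr0.
have -> : derive1 (g \o f) x = derive1 id x.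
  by apply: derive1_ext x0 => z z0 /=; rewrite (si_K H).
by rewrite derive1_id => /eqP; rewrite oner_eq0.
Qed.

(** A divided difference is a value of the derivative. *)
Lemma dd1_neq0 f : smooth_pos f -> (forall x, 0 < x -> derive1 f x != 0) ->
  forall x y, 0 < x -> 0 < y -> dd1 f x y != 0.
Proof.
move=> sf f0 x y x0 y0.
have [c [c1 _]] := derive_dd1_mean 0 sf y0 x0.
rewrite derive1n0 divr1 derive1n1 => ->; apply: f0.
by apply: lt_le_trans c1; rewrite lt_min x0.
Qed.

(** The chain rule for divided differences, with w o u = v. *)
Section Quotient.
Variables u v w : R -> R.
Hypotheses (su : smooth_pos u) (sv : smooth_pos v) (sw : smooth_pos w).
Hypotheses (up : forall x, 0 < x -> 0 < u x)
           (u0 : forall x y, 0 < x -> 0 < y -> dd1 u x y != 0)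
           (wu : forall x, 0 < x -> w (u x) = v x).

Lemma u_neq x y : 0 < x -> 0 < y -> x != y -> u x != u y.
Proof.
move=> x0 y0 xy; have := u0 x0 y0; rewrite dd1_neq// mulf_eq0 negb_or subr_eq0.
by case/andP.
Qed.

Lemma derive1_quotient x : 0 < x -> derive1 w (u x) * derive1 u x = derive1 v x.
Proof.
move=> x0; have du : derivable u x 1 by exact: (@su 0%N x x0).
have dw : derivable w (u x) 1 by exact: (@sw 0%N (u x) (up x0)).
rewrite -(derive1_comp du dw); apply: derive1_ext x0 => z z0 /=.
exact: wu.
Qed.

Lemma dd1_quotient x y : 0 < x -> 0 < y ->
  dd1 w (u x) (u y) = dd1 v x y / dd1 u x y.
Proof.
move=> x0 y0; apply: (canRL (mulfK (u0 x0 y0))).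
have [->|xy] := eqVneq x y; first by rewrite !dd1_diag derive1_quotient.
have nxy : x - y != 0 by rewrite subr_eq0.
have := u_neq x0 y0 xy => uxy; have nuxy : u x - u y != 0 by rewrite subr_eq0.
rewrite (dd1_neq _ uxy) (dd1_neq u xy) (dd1_neq v xy) !wu//.
move: (v x - v y) (u x - u y) (x - y) nuxy nxy => p q r q0 r0.
by field; rewrite q0 r0.
Qed.

Lemma derive2_quotient x : 0 < x ->
  derive1n 2 w (u x) * derive1 u x ^+ 2 + derive1 w (u x) * derive1n 2 u x =
  derive1n 2 v x.
Proof.
move=> x0.
have d1u : is_derive x 1 u (derive1 u x) by exact: (smooth_pos_is_derive 0 su x0).
have d2u : is_derive x 1 (derive1 u) (derive1n 2 u x).
  exact: (smooth_pos_is_derive 1 su x0).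
have d2w : is_derive (u x) 1 (derive1 w) (derive1n 2 w (u x)).
  exact: (smooth_pos_is_derive 1 sw (up x0)).
have := derM (is_derive1_comp d2w d1u) d2u erefl.
move=> [_ E].
have -> : derive1n 2 v x = derive1 (fun x => derive1 w (u x) * derive1 u x) x.
  by apply: derive1_ext x0 => z z0; rewrite (derive1_quotient z0).
have alg (a b p q : R) : a * p ^+ 2 + q * b = q * b + p * (a * p) by ring.
apply: etrans (alg _ _ _ _) (esym (etrans (derive1E _ _) E)).
Qed.

Lemma dd2_diag f z : dd2 f z z z = derive1n 2 f z / 2.
Proof. by rewrite /dd2 !eqxx. Qed.

Lemma dd2_quotient_algebra (s W a m b U V k p q : R) :
  s != 0 -> a != 0 -> b != 0 -> s * m = k -> k * W = p / a - q / b ->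
  s * U = a - b -> s * V = p - q -> W * (a * m * b) = a * V - p * U.
Proof.
move=> s0 a0 b0 Em EW EU EV; apply: (mulfI s0).
have -> : s * (W * (a * m * b)) = k * W * (a * b) by rewrite -Em; ring.
have -> : s * (a * V - p * U) = a * (s * V) - p * (s * U) by ring.
by rewrite EW EU EV; field; rewrite a0 b0.
Qed.

(** For y <> z, two instances of the first-order chain rule are subtracted;
    if only one pair differs, symmetry brings it to the last two places; at three
    equal points this is the chain rule for second derivatives. *)
Lemma dd2_quotient x y z : 0 < x -> 0 < y -> 0 < z ->
  dd2 w (u x) (u y) (u z) * (dd1 u x y * dd1 u y z * dd1 u x z) =
  dd_cross u v x y z.
Proof.
move: x y z; have neq x y z : 0 < x -> 0 < y -> 0 < z -> y != z ->
  dd2 w (u x) (u y) (u z) * (dd1 u x y * dd1 u y z * dd1 u x z) =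
  dd_cross u v x y z.
  move=> x0 y0 z0 yz.
  have nyz : y - z != 0 by rewrite subr_eq0.
  have E := dd2_mul sw (up y0) (up z0) (up x0).
  rewrite (dd2_rot sw (up x0) (up y0) (up z0)) in E.
  rewrite (dd1_quotient y0 x0) (dd1_quotient z0 x0) in E.
  have Eu := dd2_mul su y0 z0 x0; rewrite (dd2_rot su x0 y0 z0) in Eu.
  have Ev := dd2_mul sv y0 z0 x0; rewrite (dd2_rot sv x0 y0 z0) in Ev.
  rewrite /dd_cross (dd1C u x y) (dd1C u x z) (dd1C v x y).
  exact: (dd2_quotient_algebra nyz (u0 y0 x0) (u0 z0 x0) (dd1_mul u y z) E Eu Ev).
move=> x y z x0 y0 z0; have [->|] := eqVneq y z; last exact: neq.
have [->|xz] := eqVneq x z.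
  rewrite /dd_cross !dd2_diag !dd1_diag -(derive2_quotient z0).
  rewrite -(derive1_quotient z0).
  move: (derive1n 2 w (u z)) (derive1n 2 u z) (derive1 u z) (derive1 w (u z)).
  by move=> a b p q; field.
rewrite (dd2_swap12 sw (up x0) (up z0) (up z0)) (dd_cross_swap12 su sv x0 z0 z0).
rewrite -(neq z x z z0 x0 z0 xz) (dd1C u x z).
by congr (_ * _); rewrite mulrAC.
Qed.

End Quotient.

End UnivariateDiffeomorphisms.

(** * Isometry with ME(Id,w) and the coefficients rho *)

Section TransferredFunction.
Variables (R : realType) (n : nat) (u gu v gv : R -> R).
Hypotheses (Hu : smooth_inverse u gu) (Hv : smooth_inverse v gv).
Let su := si_smooth Hu.
Let sv := si_smooth Hv.
Let up := si_pos Hu.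
Let w := wfun u v.

Lemma smooth_inverse_dd1_neq0 f g (x y : R) : smooth_inverse f g ->
  0 < x -> 0 < y -> dd1 f x y != 0.
Proof.
move=> H; apply: (dd1_neq0 (si_smooth H)) => z z0.
exact: smooth_inverse_derive1_neq0 H z0.
Qed.

Let u0 x y : 0 < x -> 0 < y -> dd1 u x y != 0.
Proof. exact: smooth_inverse_dd1_neq0 Hu. Qed.
Let v0 x y : 0 < x -> 0 < y -> dd1 v x y != 0.
Proof. exact: smooth_inverse_dd1_neq0 Hv. Qed.

Lemma wfunE x : 0 < x -> w (u x) = v x.
Proof.
move=> x0; rewrite /w /wfun /=; congr v; apply: pinvKV; last by rewrite inE.
move=> a b; rewrite !inE /= => a0 b0 E.
by rewrite -(si_K Hu a0) E (si_K Hu b0).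
Qed.

Lemma smooth_inverse_wfun : smooth_inverse w (u \o gv).
Proof.
have H := smooth_inverse_comp (smooth_inverse_sym Hu) Hv.
have E y : 0 < y -> w y = (v \o gu) y.
  by move=> y0; rewrite -{1}(si_K' Hu y0) wfunE//; exact: (si_pos' Hu).
have [sw _] := smooth_pos_ext (si_smooth H) E.
split=> [//|||x x0|x x0|x x0].
- exact: si_smooth' H.
- by move=> x x0; rewrite E//; exact: si_pos H x x0.
- exact: si_pos' H x x0.
- by rewrite E//; exact: si_K H x x0.
- by rewrite E; [exact: si_K' H x x0|exact: si_pos' H x x0].
Qed.

Let sw := si_smooth smooth_inverse_wfun.

Lemma umap_wfun (S : 'M[R]_n) : SPD S -> umap w (umap u S) = umap v S.
Proof.
move=> /SPD_spectral_dec[[P d] /= HD].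
rewrite (umapE sw (umap_spectral su up HD)) (umapE sv HD).
have [_ dp _] := HD.
congr (_ *m diag_mx _ *m _); apply/rowP => i; rewrite !mxE.
exact: wfunE.
Qed.

Lemma dd1_id (x y : R) : dd1 id x y = 1.
Proof.
have [->|xy] := eqVneq x y; first by rewrite dd1_diag derive1_id.
by rewrite dd1_neq// divff// subr_eq0.
Qed.

(** In an eigenbasis DU multiplies entries by u[d_i,d_j], and the product of
    w[u(d_i),u(d_j)] by u[d_i,d_j] is v[d_i,d_j]. *)
Lemma isometry_umap : isometry (@umap R n u) (ME_metric u v)
  (fun S X Y => derive1 w 1 / (derive1 u 1 * derive1 v 1)
                * ME_metric id w S X Y).
Proof.
have sid : smooth_pos (id : R -> R).
  have E x : 0 < x -> id x = x `^ 1 :> R by move=> x0; rewrite powRr1// ltW.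
  by have [] := smooth_pos_ext (@smooth_pos_powR R 1) E.
split; first exact: diffeo_umap Hu.
move=> S X Y pS sX sY; have [D HD] := SPD_spectral_dec pS.
have [oD dp _] := HD.
have [_ ->] := derive_umap su pS sX.
have dY := derive_umap su pS sY.
have sdY : Sym (dkform u [:: Y] S).
  have [_ <-] := dY; apply: Sym_derive pS sY; split; first exact: smooth_umap.
  move=> A /SPD_spectral_dec[D' /(umap_spectral su up) HD'].
  by have [] := spectral_SPD HD'.
have [_ ->] := dY.
have HD' : is_spectral_dec (umap u S) (D.1, map_mx u D.2).1 (D.1, map_mx u D.2).2.
  exact: umap_spectral su up HD.
rewrite (ME_metric_entries sid sw _ HD' sdY) (ME_metric_entries su sv _ HD sY).
have w1 : derive1 w 1 != 0.
  exact: smooth_inverse_derive1_neq0 smooth_inverse_wfun ltr01.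
have -> : derive1 (id : R -> R) 1 = 1 by rewrite derive1_id.
rewrite mul1r mulrA; congr (_ * _); first by rewrite mulrAC divff// mul1r.
apply: eq_bigr => i _; apply: eq_bigr => j _ /=.
rewrite !(dkform1_entry _ _ _ su HD) dd1_id !mxE.
rewrite (dd1_quotient su sw up u0 wfunE (dp i) (dp j)).
have := u0 (dp i) (dp j).
rewrite -!/(conj_by _ _).
move: (conj_by D.1 X i j) (conj_by D.1 Y i j) => p q.
move: (dd1 u (D.2 ord0 i) (D.2 ord0 j)) (dd1 v (D.2 ord0 i) (D.2 ord0 j)).
by move=> a b a0; field.
Qed.

Section Coefficients.
Variable d : 'rV[R]_n.
Hypothesis d0 : forall i, 0 < d ord0 i.
Local Notation u1 i j := (dd1 u (d ord0 i) (d ord0 j)).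
Local Notation v1 i j := (dd1 v (d ord0 i) (d ord0 j)).
Local Notation C i j k := (dd_cross u v (d ord0 i) (d ord0 j) (d ord0 k)).

Lemma rho_algebra (m m' a b p q r s X Y : R) :
  a != 0 -> b != 0 -> p != 0 -> q != 0 -> r != 0 -> s != 0 ->
  m * (p * a * q) = X -> m' * (a * r * s) = Y ->
  m * m' / (2 * (b / a)) * p * s * r * q = 1 / (2 * a * b) * X * Y.
Proof.
move=> a0 b0 p0 q0 r0 s0 <- <-; field.
by rewrite a0 b0.
Qed.

Lemma rhoE i j k l :
  rho u v d i j k l = 1 / (2 * u1 j l * v1 j l) * C i j l * C j k l.
Proof.
rewrite /rho (dd1_quotient su sw up u0 wfunE (d0 j) (d0 l)).
rewrite (dd1C u (d ord0 k) (d ord0 l)) (dd1C u (d ord0 l) (d ord0 i)).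
have E1 := dd2_quotient su sv sw up u0 wfunE (d0 i) (d0 j) (d0 l).
have E2 := dd2_quotient su sv sw up u0 wfunE (d0 j) (d0 l) (d0 k).
rewrite (dd_cross_swap23 su sv (d0 j) (d0 k) (d0 l)).
exact: (rho_algebra (u0 (d0 j) (d0 l)) (v0 (d0 j) (d0 l)) (u0 (d0 i) (d0 j))
  (u0 (d0 i) (d0 l)) (u0 (d0 l) (d0 k)) (u0 (d0 j) (d0 k)) E1 E2).
Qed.

Lemma rho_sym_ik i j k l : rho u v d i j k l = rho u v d k j i l.
Proof.
rewrite !rhoE (dd_cross_swap12 su sv (d0 i) (d0 j) (d0 l)).
by rewrite (dd_cross_swap12 su sv (d0 k) (d0 j) (d0 l)) mulrAC.
Qed.

Lemma rho_sym_jl i j k l : rho u v d i j k l = rho u v d i l k j.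
Proof.
rewrite !rhoE (dd_cross_swap23 su sv (d0 i) (d0 j) (d0 l)).
rewrite (dd_cross_swap12 su sv (d0 l) (d0 k) (d0 j)).
rewrite (dd_cross_swap23 su sv (d0 k) (d0 l) (d0 j)).
rewrite (dd_cross_swap12 su sv (d0 k) (d0 j) (d0 l)).
by rewrite (dd1C u (d ord0 l)) (dd1C v (d ord0 l)).
Qed.

Lemma ME_curvature_rho (nabla : ('M[R]_n -> 'M[R]_n) -> ('M[R]_n -> 'M[R]_n) ->
    'M[R]_n -> 'M[R]_n) S P X Y Z T : is_levi_civita (ME_metric u v) nabla ->
  is_spectral_dec S P d ->
  vector_field X -> vector_field Y -> vector_field Z -> vector_field T ->
  let e := conj_by P in
  curvature (ME_metric u v) nabla X Y Z T S =
  1 / (derive1 u 1 * derive1 v 1) *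
  \sum_(i < n) \sum_(j < n) \sum_(k < n) \sum_(l < n) rho u v d i j k l *
    (e (X S) i j * e (Y S) j k * e (Z S) k l * e (T S) l i
     - e (Y S) i j * e (X S) j k * e (Z S) k l * e (T S) l i
     + e (X S) i j * e (Z S) j k * e (Y S) k l * e (T S) l i
     - e (Y S) i j * e (Z S) j k * e (X S) k l * e (T S) l i).
Proof.
move=> LC HD vX vY vZ vT e.
have HD' : is_spectral_dec S (P, d).1 (P, d).2 by exact: HD.
rewrite (ME_curvature_entries su sv u0 v0 LC HD' vX vY vZ vT) div1r; congr (_ * _).
apply: eq_bigr => i _; apply: eq_bigr => j _; apply: eq_bigr => k _.
apply: eq_bigr => l _; congr (_ * _); rewrite rhoE /=.
rewrite (dd_cross_swap12 su sv (d0 i) (d0 j) (d0 l)).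
rewrite (dd_cross_swap23 su sv (d0 j) (d0 i) (d0 l)).
rewrite (dd_cross_swap23 su sv (d0 j) (d0 k) (d0 l)).
by rewrite div1r -[RHS]mulrA [RHS]mulrC.
Qed.

End Coefficients.

End TransferredFunction.

Lemma rhoC (R : realType) (n : nat) (u gu v gv : R -> R) (d : 'rV[R]_n) i j k l :
  smooth_inverse u gu -> smooth_inverse v gv -> (forall i, 0 < d ord0 i) ->
  rho u v d i j k l = rho v u d i j k l.
Proof.
move=> Hu Hv d0; rewrite (rhoE Hu Hv d0) (rhoE Hv Hu d0).
rewrite (dd_crossC u) (dd_crossC u v (d ord0 j)).
by rewrite !mulrN mulNr opprK -!(mulrA 2) (mulrC (dd1 u _ _)).
Qed.

(** * Power functions and logarithmic derivatives *)

Section PowerFunctions.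
Variable R : realType.
Implicit Types (a x y z : R).

Lemma dd1_ext (f g : R -> R) x y : (forall t, 0 < t -> f t = g t) ->
  0 < x -> 0 < y -> dd1 f x y = dd1 g x y.
Proof.
by move=> E x0 y0; rewrite /dd1 (derive1_ext E x0) !E.
Qed.

(** The derivative of power_fun a is power_coef a times x^(a-1), for the
    logarithm too. *)
Definition power_coef a : R := if a == 0 then 1 else a.

Lemma power_coef_neq0 a : power_coef a != 0.
Proof. by rewrite /power_coef; case: ifP => [_|/negbT//]; exact: oner_neq0. Qed.

Lemma derive1_power_fun a x : 0 < x ->
  derive1 (power_fun a) x = power_coef a * x `^ (a - 1).
Proof.
move=> x0; rewrite derive1E /power_fun /power_coef; case: eqP => [->|_].
  by have [_ ->] := is_derive1_ln x0; rewrite sub0r powR_inv1 ?mul1r// ltW.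
by have [_ ->] := is_derive1_powR a x0.
Qed.

Lemma derive2_power_fun a x : 0 < x ->
  derive1n 2 (power_fun a) x = power_coef a * (a - 1) * x `^ (a - 2).
Proof.
move=> x0.
transitivity (derive1 (fun x => power_coef a * x `^ (a - 1)) x).
  by apply: derive1_ext x0 => z z0; exact: derive1_power_fun.
have dp := is_derive1_powR (a - 1) x0.
have [_ E] := derM (is_derive_cst (power_coef a) x 1) dp erefl.
rewrite derive1E; apply: etrans E _; rewrite mulr0 addr0 /cst -mulrA.
by rewrite -addrA -opprD.
Qed.

Lemma power_fun_dd1_neq0 a x y : 0 < x -> 0 < y -> dd1 (power_fun a) x y != 0.
Proof.
apply: (dd1_neq0 (@smooth_pos_power_fun R a)) => z z0.
by rewrite derive1_power_fun// mulf_neq0 ?power_coef_neq0// gt_eqF// powR_gt0.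
Qed.

Section Scaling.
Variables (a c : R).
Hypothesis c0 : 0 < c.
Let c_neq0 : c != 0. Proof. by rewrite gt_eqF. Qed.

Lemma powRB1 : c `^ (a - 1) = c `^ a / c.
Proof. by rewrite powRD ?c_neq0 ?implybT// powR_inv1// ltW. Qed.

Lemma powRB2 : c `^ (a - 2) = c `^ a / c ^+ 2.
Proof.
rewrite powRD ?c_neq0 ?implybT// powRN; congr (_ / _).
by rewrite powR_mulrn// ltW.
Qed.

(** The additive constant ln c disappears from differences, which makes the
    logarithm homogeneous of degree 0. *)
Lemma power_fun_scaleB x y : 0 < x -> 0 < y ->
  power_fun a (c * x) - power_fun a (c * y) =
  c `^ a * (power_fun a x - power_fun a y).
Proof.
move=> x0 y0; rewrite /power_fun; case: eqP => [->|_].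
  by rewrite powRr0 mul1r !lnM// opprD addrACA subrr add0r.
by rewrite !powRM ?ltW// mulrBr.
Qed.

Lemma dd1_power_scale x y : 0 < x -> 0 < y ->
  dd1 (power_fun a) (c * x) (c * y) = c `^ a / c * dd1 (power_fun a) x y.
Proof.
move=> x0 y0; have [->|xy] := eqVneq x y.
  rewrite !dd1_diag !derive1_power_fun ?mulr_gt0// powRM ?ltW// powRB1.
  by rewrite mulrCA.
rewrite !dd1_neq//; last by rewrite (inj_eq (mulfI c_neq0)).
rewrite power_fun_scaleB// -mulrBr invfM.
by rewrite mulrACA.
Qed.

Lemma dd2_power_scale x y z : 0 < x -> 0 < y -> 0 < z ->
  dd2 (power_fun a) (c * x) (c * y) (c * z) =
  c `^ a / c ^+ 2 * dd2 (power_fun a) x y z.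
Proof.
move=> x0 y0 z0; rewrite /dd2 !(inj_eq (mulfI c_neq0)) !dd1_power_scale//.
rewrite !derive2_power_fun ?mulr_gt0// powRM ?ltW// powRB2.
have alg (p q r s t : R) : (p / c * q - p / c * r) / (c * s - c * t) =
    p / c ^+ 2 * ((q - r) / (s - t)).
  by rewrite -!mulrBr invfM expr2 invfM mulrACA !mulrA.
rewrite !alg; case: ifP => // _; case: ifP => // _.
have alg2 (k m p s : R) : k * m * (p * s) / 2 = p * (k * m * s / 2) by ring.
exact: alg2.
Qed.

End Scaling.

Lemma dd_cross_power_scale a b c x y z : 0 < c -> 0 < x -> 0 < y -> 0 < z ->
  dd_cross (power_fun a) (power_fun b) (c * x) (c * y) (c * z) =
  c `^ a * c `^ b / c ^+ 3 * dd_cross (power_fun a) (power_fun b) x y z.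
Proof.
move=> c0 x0 y0 z0; rewrite /dd_cross !dd1_power_scale// !dd2_power_scale//.
have : c != 0 by rewrite gt_eqF.
move: (dd1 _ _ _) (dd1 _ _ _) (dd2 _ _ _ _) (dd2 _ _ _ _) (c `^ a) (c `^ b).
by move=> p q r s k l cn; field.
Qed.

(** The logarithmic derivative, without discussing the sign of f: the
    logarithm of the absolute value is half that of the square. *)
Lemma derive1_ln_norm (f : R -> R) x df : f x != 0 -> is_derive x 1 f df ->
  derive1 (fun z => ln `|f z|) x = df / f x.
Proof.
move=> fx0 hf; have f20 : 0 < f x ^+ 2 by rewrite exprn_even_gt0.
have E : (fun z => ln `|f z|) = (fun z => 2^-1 * ln (f z ^+ 2)).
  apply/funext => z; rewrite -real_normK ?num_real//.
  have [->|fz0] := eqVneq (f z) 0; first by rewrite normr0 expr0n/= ln0// mulr0.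
  rewrite lnXn ?normr_gt0//; move: (ln _) => y.
  by rewrite mulr2n; field.
rewrite E derive1E.
have d2 := @is_derive1_comp R (@ln R) (fun z => f z ^+ 2) x _ _
  (is_derive1_ln f20) (derX (k := 1) hf erefl).
have [_ H] := derM (is_derive_cst (2^-1 : R) x 1) d2 erefl.
apply: etrans H _; rewrite /= /cst mulr0 addr0 expr1.
by move: (f x) fx0 => y y0; field.
Qed.

End PowerFunctions.

(** * Curvature at the identity *)

Section BracketForm.
Variables (R : realType) (n : nat).
Implicit Types (X Y Z T : 'M[R]_n).

(** On symmetric matrices, half the trace of [X,Y][Z,T]. *)
Definition bracket_form X Y Z T : R :=
  \tr (X *m Y *m Z *m T) - \tr (Y *m X *m Z *m T)
  + \tr (X *m Z *m Y *m T) - \tr (Y *m Z *m X *m T).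

Lemma mxtrace_mul4 X Y Z T : \tr (X *m Y *m Z *m T) =
  \sum_i \sum_j \sum_k \sum_l X i j * Y j k * Z k l * T l i.
Proof.
rewrite /mxtrace; apply: eq_bigr => i _; rewrite [LHS]mxE.
under eq_bigr => l _ do rewrite mxE.
rewrite (eq_bigr (fun l => \sum_k (\sum_j X i j * Y j k) * Z k l * T l i)); last first.
  move=> l _; rewrite big_distrl /=; apply: eq_bigr => k _.
  by rewrite [(X *m Y) _ _]mxE.
rewrite exchange_big /=.
rewrite (eq_bigr (fun k => \sum_j \sum_l X i j * Y j k * Z k l * T l i)).
  by rewrite exchange_big.
move=> k _; rewrite exchange_big /=; apply: eq_bigr => l _.
by rewrite !big_distrl.
Qed.

Lemma bracket_form_entries X Y Z T : bracket_form X Y Z T =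
  \sum_i \sum_j \sum_k \sum_l
    (X i j * Y j k * Z k l * T l i - Y i j * X j k * Z k l * T l i
     + X i j * Z j k * Y k l * T l i - Y i j * Z j k * X k l * T l i).
Proof.
rewrite /bracket_form !mxtrace_mul4 -!sumrN -!big_split /=.
apply: eq_bigr => i _; rewrite -!sumrN -!big_split /=.
apply: eq_bigr => j _; rewrite -!sumrN -!big_split /=.
apply: eq_bigr => k _; rewrite -!sumrN -!big_split /=.
by apply: eq_bigr.
Qed.

Lemma bracket_formXYXY X Y :
  bracket_form X Y X Y = \tr (X *m Y *m X *m Y) - \tr (Y *m X *m X *m Y).
Proof.
rewrite /bracket_form (_ : \tr (X *m X *m Y *m Y) = \tr (Y *m X *m X *m Y)).
  by rewrite addrNK.
by rewrite [LHS]mxtrace_mulC !mulmxA.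
Qed.

(** Twice the form is minus the squared Frobenius norm of XY - YX. *)
Lemma bracket_form_le0 X Y : Sym X -> Sym Y -> bracket_form X Y X Y <= 0.
Proof.
rewrite /Sym /= => sX sY; pose K := X *m Y - Y *m X.
have KT : K^T = - K by rewrite /K linearB /= !trmx_mul sX sY opprB.
have pos : 0 <= \tr (K *m K^T).
  rewrite /mxtrace sumr_ge0// => i _; rewrite mxE sumr_ge0// => j _.
  by rewrite [K^T _ _]mxE -expr2 sqr_ge0.
have E : \tr (K *m K^T) = - (2 * bracket_form X Y X Y).
  rewrite KT mulmxN raddfN /= bracket_formXYXY /K mulmxBl !mulmxBr !raddfB /=.
  have -> : \tr (X *m Y *m (Y *m X)) = \tr (Y *m X *m X *m Y).
    by rewrite mxtrace_mulC !mulmxA.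
  have -> : \tr (Y *m X *m (Y *m X)) = \tr (X *m Y *m X *m Y).
    by rewrite -mulmxA mxtrace_mulC !mulmxA.
  rewrite !mulmxA; move: (\tr _) (\tr _) => p q; ring.
move: pos; rewrite E; clear; move: (bracket_form X Y X Y) => q; lra.
Qed.

End BracketForm.

(** The squared norm of C f - B g, a multiple of the component of f orthogonal
    to g, is C(AC - B^2). *)
Lemma sum_CauchySchwarz (R : realType) (I : finType) (f g : I -> R) :
  (\sum_i f i * g i) ^+ 2 <= (\sum_i f i ^+ 2) * \sum_i g i ^+ 2.
Proof.
set A := \sum_i f i ^+ 2; set C := \sum_i g i ^+ 2; set B := \sum_i f i * g i.
have C0 : 0 <= C by apply: sumr_ge0 => i _; exact: sqr_ge0.
have E : \sum_i (C * f i - B * g i) ^+ 2 = C * (A * C - B ^+ 2).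
  transitivity (\sum_i (C ^+ 2 * f i ^+ 2 - 2 * C * B * (f i * g i) + B ^+ 2 * g i ^+ 2)).
    by apply: eq_bigr => i _; ring.
  rewrite big_split sumrB /= -!mulr_sumr -/A -/B -/C; ring.
have pos : 0 <= C * (A * C - B ^+ 2).
  by rewrite -E; apply: sumr_ge0 => i _; exact: sqr_ge0.
have [C1|C1] := eqVneq C 0.
  have g0 i : g i = 0.
    have /allP : all (fun i => g i ^+ 2 == 0) (index_enum I).
      by have/eqP := C1; rewrite psumr_eq0// => j _; exact: sqr_ge0.
    by move/(_ i); rewrite mem_index_enum => /(_ isT); rewrite sqrf_eq0 => /eqP.
  have -> : B = 0 by rewrite /B big1// => i _; rewrite g0 mulr0.
  by rewrite C1 mulr0 expr0n.
by move: pos; rewrite pmulr_rge0 ?subr_ge0// lt_neqAle eq_sym C1.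
Qed.

Section AtIdentity.
Variables (R : realType) (n : nat) (u v : R -> R).
Hypotheses (su : smooth_pos u) (sv : smooth_pos v).
Hypotheses (u0 : forall a b : R, 0 < a -> 0 < b -> dd1 u a b != 0)
           (v0 : forall a b : R, 0 < a -> 0 < b -> dd1 v a b != 0).
Local Notation g := (@ME_metric R n u v).

Lemma spectral_cst c : 0 < c ->
  is_spectral_dec (c%:M : 'M[R]_n) ((1%:M : 'M[R]_n), const_mx c : 'rV[R]_n).1
    ((1%:M : 'M[R]_n), const_mx c : 'rV_n).2.
Proof. by move=> c0; exact: spectral_scalar. Qed.

Lemma conj_by1 (X : 'M[R]_n) : conj_by 1%:M X = X.
Proof. by rewrite /conj_by trmx1 mul1mx mulmx1. Qed.

Let u1 : derive1 u 1 != 0. Proof. by rewrite -dd1_diag; exact: u0. Qed.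
Let v1 : derive1 v 1 != 0. Proof. by rewrite -dd1_diag; exact: v0. Qed.

Lemma ME_metric_id X Y : Sym Y -> g 1%:M X Y = \sum_i \sum_j X i j * Y i j.
Proof.
move=> sY; rewrite (ME_metric_entries su sv X (spectral_cst ltr01) sY) /=.
rewrite mulr_sumr; apply: eq_bigr => i _; rewrite mulr_sumr.
apply: eq_bigr => j _; rewrite !conj_by1 ![const_mx _ _ _]mxE !dd1_diag.
by rewrite mulrA mulVf ?mul1r// mulf_neq0.
Qed.

Lemma ME_metric_id_pair X Y : Sym Y ->
  g 1%:M X Y = \sum_(p : 'I_n * 'I_n) X p.1 p.2 * Y p.1 p.2.
Proof. by move=> sY; rewrite ME_metric_id// pair_big. Qed.

Definition log_ratio_slope : R :=
  derive1n 2 v 1 / derive1 v 1 - derive1n 2 u 1 / derive1 u 1.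

Lemma log_ratio_slopeE :
  derive1 (fun x => ln `|derive1 v x / derive1 u x|) 1 = log_ratio_slope.
Proof.
have du : is_derive (1 : R) 1 (derive1 u) (derive1n 2 u 1).
  exact: (smooth_pos_is_derive 1 su ltr01).
have dv : is_derive (1 : R) 1 (derive1 v) (derive1n 2 v 1).
  exact: (smooth_pos_is_derive 1 sv ltr01).
have h0 : derive1 v 1 / derive1 u 1 != 0 by rewrite mulf_neq0 ?invr_eq0.
have dh := derM dv (derV u1 du erefl) erefl.
rewrite (@derive1_ln_norm R (fun z => derive1 v z / derive1 u z) 1 _ h0 dh) /log_ratio_slope.
move: (derive1 u 1) (derive1 v 1) u1 v1 => p q p0 q0.
move: (derive1n 2 u 1) (derive1n 2 v 1) => r s.
by field; rewrite p0 q0.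
Qed.

Variable nabla : ('M[R]_n -> 'M[R]_n) -> ('M[R]_n -> 'M[R]_n) -> 'M[R]_n -> 'M[R]_n.
Hypothesis LC : is_levi_civita g nabla.

(** All eigenvalues being 1, the coefficients do not depend on the indices. *)
Lemma ME_curvature_id X Y Z T :
  vector_field X -> vector_field Y -> vector_field Z -> vector_field T ->
  curvature g nabla X Y Z T 1%:M =
  log_ratio_slope ^+ 2 / 8 * bracket_form (X 1%:M) (Y 1%:M) (Z 1%:M) (T 1%:M).
Proof.
move=> vX vY vZ vT.
rewrite (ME_curvature_entries su sv u0 v0 LC (spectral_cst ltr01) vX vY vZ vT).
rewrite bracket_form_entries !mulr_sumr; apply: eq_bigr => i _.
rewrite !mulr_sumr; apply: eq_bigr => j _; rewrite !mulr_sumr.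
apply: eq_bigr => k _; rewrite !mulr_sumr; apply: eq_bigr => l _.
rewrite /= !conj_by1 mulrA; congr (_ * _).
rewrite ![const_mx _ _ _]mxE /dd_cross !dd2_diag !dd1_diag /log_ratio_slope.
move: (derive1 u 1) (derive1 v 1) u1 v1 => p q p0 q0.
move: (derive1n 2 u 1) (derive1n 2 v 1) => r s.
by field; rewrite p0 q0.
Qed.

Lemma ME_sectional_id X Y : Sym X -> Sym Y ->
  sectional g nabla 1%:M X Y =
  log_ratio_slope ^+ 2 / 8 * bracket_form X Y X Y /
  (g 1%:M X X * g 1%:M Y Y - g 1%:M X Y ^+ 2).
Proof.
move=> sX sY; rewrite /sectional ME_curvature_id //; exact: vf_cst.
Qed.

Lemma ME_sectional_id_le0 X Y : Sym X -> Sym Y ->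
  sectional g nabla 1%:M X Y <= 0.
Proof.
move=> sX sY; rewrite ME_sectional_id//.
rewrite mulr_le0_ge0//.
  apply: mulr_ge0_le0; last exact: bracket_form_le0.
  by rewrite divr_ge0// sqr_ge0.
rewrite invr_ge0 subr_ge0 !ME_metric_id_pair//.
exact: sum_CauchySchwarz.
Qed.

End AtIdentity.

(** * Affine-invariant metric *)

Section AffineInvariant.
Variables (R : realType) (n : nat).

Lemma dd1_power1 (x y : R) : 0 < x -> 0 < y -> dd1 (power_fun 1) x y = 1.
Proof.
move=> x0 y0; rewrite -[RHS](dd1_id x y); apply: dd1_ext x0 y0 => t t0.
by rewrite /power_fun oner_eq0 powRr1// ltW.
Qed.

Lemma dd1_powerN1 (x y : R) : 0 < x -> 0 < y ->
  dd1 (power_fun (-1)) x y = - (x^-1 * y^-1).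
Proof.
move=> x0 y0; have n1 : (-1 : R) == 0 = false by rewrite oppr_eq0 oner_eq0.
have [->|xy] := eqVneq x y.
  rewrite dd1_diag derive1_power_fun// /power_coef n1 mulN1r.
  have -> : -1 - 1 = - 2%:R :> R by ring.
  by rewrite powRN powR_mulrn ?ltW// expr2 invfM.
have x1 : x != 0 by rewrite gt_eqF. have y1 : y != 0 by rewrite gt_eqF.
rewrite dd1_neq// /power_fun n1 !powR_inv1 ?ltW//.
have : x - y != 0 by rewrite subr_eq0.
by move=> xy0; field; rewrite xy0 x1 y1.
Qed.

Lemma conj_invmx S (P : 'M[R]_n) d X i j : is_spectral_dec S P d ->
  conj_by P (invmx S *m X) i j = (d ord0 i)^-1 * conj_by P X i j.
Proof.
move=> [oP dp ->]; have oPT := orthogonalmxT oP.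
pose e : 'rV[R]_n := map_mx GRing.inv d.
have de : diag_mx d *m diag_mx e = 1%:M.
  rewrite mulmx_diag -diag_const_mx; congr diag_mx; apply/rowP => k.
  by rewrite !mxE mulfV// gt_eqF.
have E : P *m diag_mx d *m P^T *m (P *m diag_mx e *m P^T) = 1%:M.
  rewrite -!mulmxA (mulmxA P^T P) oPT mul1mx (mulmxA (diag_mx d)) de mul1mx.
  exact: oP.
have [uS _] := mulmx1_unit E.
have -> : invmx (P *m diag_mx d *m P^T) = P *m diag_mx e *m P^T.
  by rewrite -[LHS]mulmx1 -E mulKmx.
rewrite /conj_by !mulmxA oPT mul1mx -!mulmxA mul_diag_mx.
by rewrite [LHS]mxE mxE.
Qed.

(** The divided differences of x and 1/x are 1 and -1/(xy); both functions are
    powers. *)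
Lemma affine_metricE S (X Y : 'M[R]_n) : SPD S -> Sym Y ->
  affine_metric S X Y = ME_metric (power_fun 1) (power_fun (-1)) S X Y.
Proof.
move=> pS sY; have [D HD] := SPD_spectral_dec pS; have [oD dp _] := HD.
rewrite (ME_metric_entries (@smooth_pos_power_fun R 1)
  (@smooth_pos_power_fun R (-1)) X HD sY) /affine_metric.
rewrite (mxtrace_mul_entries _ _ oD) -!dd1_diag dd1_power1 ?dd1_powerN1//.
rewrite !invr1 !mul1r invrN1 mulr_sumr; apply: eq_bigr => i _.
rewrite mulr_sumr; apply: eq_bigr => j _.
rewrite !(conj_invmx _ _ _ HD) dd1_power1// dd1_powerN1//.
rewrite (conj_by_sym D.1 sY j i).
move: (conj_by D.1 X i j) (conj_by D.1 Y i j) (D.2 ord0 i)^-1 (D.2 ord0 j)^-1.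
by move=> p q r s; ring.
Qed.

Lemma is_levi_civita_ext (g g' : 'M[R]_n -> 'M[R]_n -> 'M[R]_n -> R) nabla :
  (forall S X Y, SPD S -> Sym X -> Sym Y -> g S X Y = g' S X Y) ->
  is_levi_civita g nabla -> is_levi_civita g' nabla.
Proof.
move=> E [C T M]; split => // X Y Z vX vY vZ S pS.
have sX := vX.2 S pS.
have vn W : vector_field W -> Sym (nabla X W S).
  by move=> vW; exact: (nabla_vector_field C vX vW).2.
rewrite -!E//; [|by [exact: vY.2|exact: vn|exact: vZ.2]..].
rewrite -(M X Y Z vX vY vZ S pS); apply: derive_SPD_ext pS sX _ => A pA.
by rewrite E//; [exact: vY.2|exact: vZ.2].
Qed.

Lemma affine_curvature_id nabla X Y Z T : is_levi_civita (@affine_metric R n) nabla ->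
  vector_field X -> vector_field Y -> vector_field Z -> vector_field T ->
  curvature (@affine_metric R n) nabla X Y Z T 1%:M =
  2^-1 * bracket_form (X 1%:M) (Y 1%:M) (Z 1%:M) (T 1%:M).
Proof.
move=> LC vX vY vZ vT; have p1 : SPD (1%:M : 'M[R]_n) by exact: SPD_scalar.
have LC' : is_levi_civita (ME_metric (power_fun 1) (power_fun (-1))) nabla.
  by apply: is_levi_civita_ext LC => S x y pS _; exact: affine_metricE.
rewrite /curvature affine_metricE//; last exact: vT.2.
rewrite -/(curvature (ME_metric (power_fun 1) (power_fun (-1))) nabla X Y Z T 1%:M).
rewrite (ME_curvature_id (@smooth_pos_power_fun R 1) (@smooth_pos_power_fun R (-1))
  (@power_fun_dd1_neq0 R 1) (@power_fun_dd1_neq0 R (-1)) LC' vX vY vZ vT).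
congr (_ * _); rewrite /log_ratio_slope !derive2_power_fun// !derive1_power_fun//.
rewrite !powR1 !mulr1 !(mulrC (power_coef _)) !mulfK ?power_coef_neq0//.
by field.
Qed.

End AffineInvariant.

(** * Mixed-power-Euclidean metrics *)

Lemma scaling_algebra (F : realFieldType) (c r s p q x y : F) :
  c != 0 -> r != 0 -> s != 0 -> p != 0 -> q != 0 ->
  r * s / c ^+ 3 * x * (r * s / c ^+ 3 * y) / (2 * (r / c * p) * (s / c * q)) =
  r * s / c ^+ 4 * (x * y / (2 * p * q)).
Proof. by move=> c0 r0 s0 p0 q0; field; rewrite q0 p0 s0 r0 c0. Qed.

Section MixedPowerEuclidean.
Variables (R : realType) (n : nat) (a b : R).
Local Notation g := (@MPE_metric R n a b).
Let su := @smooth_pos_power_fun R a.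
Let sv := @smooth_pos_power_fun R b.

Lemma mxtrace_delta (i j : 'I_n) : \tr (delta_mx i j : 'M[R]_n) = (i == j)%:R.
Proof.
rewrite /mxtrace (bigD1 i)//= big1 => [|k /negbTE ki]; last by rewrite mxE ki.
by rewrite mxE eqxx addr0.
Qed.

Lemma spectral_scale S (P : 'M[R]_n) d c : 0 < c -> is_spectral_dec S P d ->
  is_spectral_dec (c *: S) P (c *: d).
Proof.
move=> c0 [oP dp ->]; split => //; first by move=> i; rewrite mxE mulr_gt0.
by rewrite linearZ /= -scalemxAr -scalemxAl.
Qed.

Lemma MPE_metric_scale (c : R) S X Y : 0 < c -> SPD S -> Sym Y ->
  g (c *: S) X Y = c `^ a * c `^ b / c ^+ 2 * g S X Y.
Proof.
move=> c0 /SPD_spectral_dec[D HD] sY; have [_ dp _] := HD.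
have HD' : is_spectral_dec (c *: S) (D.1, c *: D.2).1 (D.1, c *: D.2).2.
  exact: spectral_scale.
have cn : c != 0 by rewrite gt_eqF.
rewrite /MPE_metric (ME_metric_entries su sv X HD' sY).
rewrite (ME_metric_entries su sv X HD sY) [RHS]mulrCA; congr (_ * _).
rewrite mulr_sumr; apply: eq_bigr => i _; rewrite mulr_sumr.
apply: eq_bigr => j _ /=; rewrite ![(c *: D.2) _ _]mxE !dd1_power_scale//.
rewrite [RHS]mulrA; congr (_ * _).
move: (dd1 _ _ _) (dd1 _ _ _) (c `^ a) (c `^ b) => p q r s.
by field.
Qed.

Variable nabla : ('M[R]_n -> 'M[R]_n) -> ('M[R]_n -> 'M[R]_n) -> 'M[R]_n -> 'M[R]_n.
Hypothesis LC : is_levi_civita g nabla.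

Lemma MPE_curvature_scale (c : R) S X Y Z T : 0 < c -> SPD S ->
  Sym X -> Sym Y -> Sym Z -> Sym T ->
  curvature g nabla (fun=> X) (fun=> Y) (fun=> Z) (fun=> T) (c *: S) =
  c `^ a * c `^ b / c ^+ 4 *
  curvature g nabla (fun=> X) (fun=> Y) (fun=> Z) (fun=> T) S.
Proof.
move=> c0 /SPD_spectral_dec[D HD] sX sY sZ sT; have [_ dp _] := HD.
have HD' : is_spectral_dec (c *: S) (D.1, c *: D.2).1 (D.1, c *: D.2).2.
  exact: spectral_scale.
have cn : c != 0 by rewrite gt_eqF.
have pa : c `^ a != 0 by rewrite gt_eqF// powR_gt0.
have pb : c `^ b != 0 by rewrite gt_eqF// powR_gt0.
have E := ME_curvature_entries su sv (@power_fun_dd1_neq0 R a)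
  (@power_fun_dd1_neq0 R b) LC.
rewrite (E _ _ HD' _ _ _ _ (vf_cst sX) (vf_cst sY) (vf_cst sZ) (vf_cst sT)).
rewrite (E _ _ HD _ _ _ _ (vf_cst sX) (vf_cst sY) (vf_cst sZ) (vf_cst sT)).
rewrite [RHS]mulrCA; congr (_ * _).
rewrite mulr_sumr; apply: eq_bigr => i _; rewrite mulr_sumr.
apply: eq_bigr => j _; rewrite mulr_sumr; apply: eq_bigr => k _.
rewrite mulr_sumr; apply: eq_bigr => l _; rewrite [RHS]mulrA; congr (_ * _).
rewrite /= ![(c *: D.2) _ _]mxE !dd1_power_scale// !dd_cross_power_scale//.
have := power_fun_dd1_neq0 a (dp j) (dp l).
have := power_fun_dd1_neq0 b (dp j) (dp l).
move=> q0 p0; apply: (scaling_algebra _ _ cn pa pb); [exact: p0|exact: q0].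
Qed.

Lemma MPE_sectional_scale (c : R) S X Y : 0 < c -> SPD S -> Sym X -> Sym Y ->
  sectional g nabla (c *: S) X Y =
  c `^ (- (a + b)) * sectional g nabla S X Y.
Proof.
move=> c0 pS sX sY; have cn : c != 0 by rewrite gt_eqF.
have pa : c `^ a != 0 by rewrite gt_eqF// powR_gt0.
have pb : c `^ b != 0 by rewrite gt_eqF// powR_gt0.
rewrite /sectional MPE_curvature_scale// !MPE_metric_scale//.
have alg (p q K x y z : R) : p != 0 -> q != 0 ->
    p * q / c ^+ 4 * K / (p * q / c ^+ 2 * x * (p * q / c ^+ 2 * y) -
      (p * q / c ^+ 2 * z) ^+ 2) = (p * q)^-1 * (K / (x * y - z ^+ 2)).
  move=> p0 q0.
  have -> : p * q / c ^+ 2 * x * (p * q / c ^+ 2 * y) - (p * q / c ^+ 2 * z) ^+ 2 =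
      (p * q / c ^+ 2) ^+ 2 * (x * y - z ^+ 2) by ring.
  move: (x * y - z ^+ 2) => e.
  rewrite [(_ ^+ 2 * e)^-1]invfM; move: e^-1 => f.
  by field; rewrite p0 q0 cn.
by rewrite alg// powRN powRD// cn implybT.
Qed.

Lemma MPE_sectional_id X Y : Sym X -> Sym Y ->
  sectional g nabla 1%:M X Y =
  (b - a) ^+ 2 / 8 * bracket_form X Y X Y /
  (g 1%:M X X * g 1%:M Y Y - g 1%:M X Y ^+ 2).
Proof.
move=> sX sY.
rewrite (ME_sectional_id su sv (@power_fun_dd1_neq0 R a)
  (@power_fun_dd1_neq0 R b) LC sX sY).
congr (_ ^+ 2 / 8 * _ / _).
rewrite /log_ratio_slope !derive2_power_fun// !derive1_power_fun//.
rewrite !powR1 !mulr1 !(mulrC (power_coef _)) !mulfK ?power_coef_neq0//.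
by ring.
Qed.

(** The plane spanned by E_00 and E_01 + E_10, of sectional curvature
    -(a-b)^2/16. *)
Lemma MPE_sectional_negative : a != b -> (1 < n)%N -> exists X Y,
  [/\ Sym X, Sym Y, free [:: X; Y] & sectional g nabla 1%:M X Y < 0].
Proof.
move=> ab n1; pose i0 : 'I_n := Ordinal (ltn_trans (ltnSn 0) n1).
pose i1 : 'I_n := Ordinal n1.
pose X : 'M[R]_n := delta_mx i0 i0.
pose Y : 'M[R]_n := delta_mx i0 i1 + delta_mx i1 i0.
have sX : Sym X by rewrite /Sym /= trmx_delta.
have sY : Sym Y by rewrite /Sym /= linearD /= !trmx_delta addrC.
have n01 : i0 != i1 by [].
have XY : X *m Y = delta_mx i0 i1.
  by rewrite mulmxDr !mul_delta_mx_cond eqxx (negbTE n01) mulr1n mulr0n addr0.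
have YX : Y *m X = delta_mx i1 i0.
  rewrite mulmxDl !mul_delta_mx_cond eqxx eq_sym (negbTE n01).
  by rewrite mulr1n mulr0n add0r.
exists X, Y; split => //.
  rewrite free_cons span_seq1 seq1_free; apply/andP; split.
    apply/negP => /vlineP[k /(congr1 (fun M : 'M[R]_n => M i0 i0))].
    rewrite !mxE !eqxx /= addr0 mulr0 => /eqP.
    by rewrite oner_eq0.
  apply/eqP => /(congr1 (fun M : 'M[R]_n => M i0 i1)); rewrite !mxE !eqxx /=.
  by rewrite addr0 => /eqP; rewrite oner_eq0.
rewrite MPE_sectional_id// bracket_formXYXY XY YX.
have -> : delta_mx i0 i1 *m X *m Y = 0.
  by rewrite mul_delta_mx_cond eq_sym (negbTE n01) mulr0n mul0mx.
have -> : delta_mx i1 i0 *m X *m Y = delta_mx i1 i1.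
  by rewrite -mulmxA XY mul_delta_mx.
have gE U V : Sym V -> g 1%:M U V = \tr (U *m V).
  move=> sV; rewrite /MPE_metric (ME_metric_id su sv (@power_fun_dd1_neq0 R a)
    (@power_fun_dd1_neq0 R b) U sV).
  rewrite /mxtrace; apply: eq_bigr => i _; rewrite mxE; apply: eq_bigr => j _.
  by rewrite -{1}sV mxE.
rewrite !gE// XY /Y mulmxDr !mulmxDl !mul_delta_mx_cond !eqxx (negbTE n01).
rewrite eq_sym (negbTE n01) !mulr1n !mulr0n.
rewrite !raddfD /= linear0 !mxtrace_delta !eqxx (negbTE n01) !mulr1n.
rewrite !mulr0n.
have : 0 < (b - a) ^+ 2 by rewrite exprn_even_gt0//= subr_eq0 eq_sym.
move: ((b - a) ^+ 2) => s s0.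
have -> : s / 8 * (0 - 1) / (1 * (0 + 1 + (1 + 0)) - 0 ^+ 2) = - (s / 16).
  by field.
by rewrite oppr_lt0 divr_gt0.
Qed.

(** As a + b does not vanish, scaling the identity multiplies its negative
    sectional curvature by any positive number. *)
Lemma MPE_sectional_inf : a ^+ 2 != b ^+ 2 -> (1 < n)%N ->
  ereal_inf [set k : \bar R | exists S X Y : 'M[R]_n,
       [/\ SPD S, Sym X, Sym Y, free [:: X; Y]
         & k = (sectional g nabla S X Y)%:E]] = -oo%E.
Proof.
rewrite eqf_sqr negb_or => /andP[ab aNb] n1.
have [X [Y [sX sY fXY neg]]] := MPE_sectional_negative ab n1.
have ab0 : - (a + b) != 0 by rewrite oppr_eq0 addr_eq0.
have key m : exists2 c, 0 < c & c `^ (- (a + b)) * sectional g nabla 1%:M X Y < m.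
  move: (sectional g nabla 1%:M X Y) neg => k k0.
  (* t k = k - `|m| is below m *)
  pose t : R := 1 + `|m| / - k.
  have t0 : 0 < t by rewrite ltr_pwDl// divr_ge0// oppr_ge0 ltW.
  exists (t `^ (- (a + b))^-1); first exact: powR_gt0.
  rewrite -powRrM mulVf// powRr1 ?ltW// /t.
  have -> : (1 + `|m| / - k) * k = k - `|m| by field; rewrite lt_eqF.
  rewrite ltrBlDr; apply: lt_le_trans k0 _; rewrite -lerBlDr sub0r.
  exact: lerNnormlW.
apply: eq_ninfty => m; have [c c0 /ltW cm] := key m.
have p1 : SPD (1%:M : 'M[R]_n) by exact: SPD_scalar.
apply: (@le_trans _ _ (sectional g nabla (c *: 1%:M) X Y)%:E).
  apply: ereal_inf_lbound; exists (c *: 1%:M), X, Y; split => //.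
  by rewrite scalemx1; exact: SPD_scalar.
by rewrite lee_fin MPE_sectional_scale.
Qed.

End MixedPowerEuclidean.

(** * Curvature of ME(u,v) and of MPE(a,b) *)

Theorem theorem5p1 (R : realType) (n : nat) (hn : (0 < n)%N) :
  (forall u v : R -> R,
     diffeo (@umap R n u) -> diffeo (@umap R n v) ->
     let w := wfun u v in
     [/\ diffeo (@umap R n w),
         (forall S : 'M[R]_n, SPD S -> umap w (umap u S) = umap v S),
         isometry (@umap R n u) (ME_metric u v)
           (fun S X Y => derive1 w 1 / (derive1 u 1 * derive1 v 1)
                         * ME_metric id w S X Y),
         (forall d : 'rV[R]_n, (forall i, 0 < d ord0 i) ->
            let u1 i j := dd1 u (d ord0 i) (d ord0 j) in
            let v1 i j := dd1 v (d ord0 i) (d ord0 j) in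
            let u2 i j k := dd2 u (d ord0 i) (d ord0 j) (d ord0 k) in
            let v2 i j k := dd2 v (d ord0 i) (d ord0 j) (d ord0 k) in
            (forall i j : 'I_n,
               dd1 w (u (d ord0 i)) (u (d ord0 j)) = v1 i j / u1 i j) /\
            (forall i j k l : 'I_n,
               [/\ rho u v d i j k l =
                     1 / (2 * u1 j l * v1 j l)
                     * (u1 i j * v2 i j l - v1 i j * u2 i j l)
                     * (u1 j k * v2 j k l - v1 j k * u2 j k l),
                   rho u v d i j k l = rho u v d k j i l,
                   rho u v d i j k l = rho u v d i l k j
                 & rho u v d i j k l = rho v u d i j k l]))
       & forall nabla, is_levi_civita (@ME_metric R n u v) nabla ->
         [/\ (forall (S P : 'M[R]_n) (d : 'rV[R]_n), is_spectral_dec S P d ->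
                forall X Y Z T : 'M[R]_n -> 'M[R]_n,
                vector_field X -> vector_field Y ->
                vector_field Z -> vector_field T ->
                let X' := P^T *m X S *m P in
                let Y' := P^T *m Y S *m P in
                let Z' := P^T *m Z S *m P in
                let T' := P^T *m T S *m P in
                curvature (ME_metric u v) nabla X Y Z T S =
                1 / (derive1 u 1 * derive1 v 1) *
                \sum_(i < n) \sum_(j < n) \sum_(k < n) \sum_(l < n)
                  rho u v d i j k l *
                  (X' i j * Y' j k * Z' k l * T' l i
                   - Y' i j * X' j k * Z' k l * T' l i
                   + X' i j * Z' j k * Y' k l * T' l i
                   - Y' i j * Z' j k * X' k l * T' l i)),
             (forall nablaA, is_levi_civita (@affine_metric R n) nablaA ->
                forall X Y Z T : 'M[R]_n -> 'M[R]_n,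
                vector_field X -> vector_field Y ->
                vector_field Z -> vector_field T ->
                curvature (ME_metric u v) nabla X Y Z T 1%:M =
                1 / 4 * (derive1 (fun x => ln `|derive1 v x / derive1 u x|) 1) ^+ 2
                * curvature (@affine_metric R n) nablaA X Y Z T 1%:M)
           & forall X Y : 'M[R]_n, Sym X -> Sym Y -> free [:: X; Y] ->
               sectional (ME_metric u v) nabla 1%:M X Y <= 0]])
  /\
  ((1 < n)%N -> forall a b : R, a ^+ 2 != b ^+ 2 ->
     forall nabla, is_levi_civita (@MPE_metric R n a b) nabla ->
     (forall (c : R) (S X Y : 'M[R]_n),
        0 < c -> SPD S -> Sym X -> Sym Y -> free [:: X; Y] ->
        sectional (MPE_metric a b) nabla (c *: S) X Y =
        c `^ (- (a + b)) * sectional (MPE_metric a b) nabla S X Y) /\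
     ereal_inf [set k : \bar R | exists S X Y : 'M[R]_n,
       [/\ SPD S, Sym X, Sym Y, free [:: X; Y]
         & k = (sectional (MPE_metric a b) nabla S X Y)%:E]] = -oo%E).
Proof.
split=> [u v du dv w|n1 a b ab nabla LC]; last first.
  split=> [c S X Y c0 pS sX sY _|]; first exact: MPE_sectional_scale.
  exact: MPE_sectional_inf.
have [gu Hu] := diffeo_smooth_inverse (Ordinal hn) du.
have [gv Hv] := diffeo_smooth_inverse (Ordinal hn) dv.
have su := si_smooth Hu; have sv := si_smooth Hv.
have u0 x y := @smooth_inverse_dd1_neq0 R u gu x y Hu.
have v0 x y := @smooth_inverse_dd1_neq0 R v gv x y Hv.
have Hw := smooth_inverse_wfun Hu Hv.
split.
- exact: diffeo_umap Hw.
- exact: umap_wfun Hu Hv.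
- exact: isometry_umap Hu Hv.
- move=> d d0 /=; split=> [i j|i j k l].
    exact: (dd1_quotient su (si_smooth Hw) (si_pos Hu) u0 (wfunE v Hu)).
  split.
  + exact: (rhoE Hu Hv d0 i j k l).
  + exact: (rho_sym_ik Hu Hv d0 i j k l).
  + exact: (rho_sym_jl Hu Hv d0 i j k l).
  + exact: (rhoC i j k l Hu Hv d0).
move=> nabla LC; split.
- move=> S P d HD X Y Z T vX vY vZ vT /=.
  have [_ d0 _] := HD.
  exact: (ME_curvature_rho Hu Hv d0 LC HD vX vY vZ vT).
- move=> nablaA LA X Y Z T vX vY vZ vT.
  rewrite (ME_curvature_id su sv u0 v0 LC vX vY vZ vT).
  rewrite (affine_curvature_id LA vX vY vZ vT) (log_ratio_slopeE su sv u0 v0).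
  move: (log_ratio_slope u v) (bracket_form _ _ _ _) => s q.
  by field.
- by move=> X Y sX sY _; exact: (ME_sectional_id_le0 su sv u0 v0 LC sX sY).
Qed.
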